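(* Suppose $f$ is the generator of a continuous one-parameter semigroup of holomorphic self-mappings of the open unit disk $\mathbb{D}$ with the Denjoy-Wolff point $a=0$, and $\zeta_1,\dots,\zeta_N\in\partial\mathbb{D}$ are pairwise distinct boundary regular null points of $f$. Given any $\eta_1,\dots,\eta_N\in\partial\mathbb{D}$ satisfying $\eta_n\ne\zeta_n$ for all $n=1,\dots,N$, there is an $r\ge0$ such that $$\frac1{f(z)}=\sum_{n=1}^N\frac1{|f'(\zeta_n)|}\Big(\frac{\bar\zeta_n\eta_n}{\bar\zeta_n\eta_n-1}\,\frac1z-\frac1{z-\zeta_n}\Big)+\frac{r}{h(z)},$$ where $h$ is a holomorphic generator on $\mathbb{D}$ with $h(0)=0$ and $$\angle\lim_{z\to\zeta_n}\frac{h(z)}{z-\zeta_n}=\infty\quad\text{for all } n=1,\dots,N.$$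
   Context: $\mathbb{D}$ is the open unit disk in $\mathbb{C}$. A (continuous one-parameter) semigroup on $\mathbb{D}$ is a family $\{F_t\}_{t\ge0}$ of holomorphic self-mappings of $\mathbb{D}$ with $F_{s+t}=F_s\circ F_t$, $F_0(z)=z$, continuous in $t$. Its (infinitesimal) generator is the holomorphic function $f(z)=\lim_{t\to0^+}\frac1t(z-F_t(z))$ on $\mathbb{D}$; a ''holomorphic generator on $\mathbb{D}$'' is a function arising in this way. For a semigroup that is nontrivial and contains no elliptic automorphisms of $\mathbb{D}$, the Denjoy-Wolff point is the unique $a\in\overline{\mathbb{D}}$ with $F_t(z)\to a$ as $t\to\infty$ for all $z\in\mathbb{D}$. $\angle\lim$ denotes the angular (nontangential) limit; for $\zeta\in\partial\mathbb{D}$, $f(\zeta)$ denotes the angular limit of $f$ at $\zeta$, and, when this is $0$, $f'(\zeta)=\angle\lim_{z\to\zeta}\frac{f(z)}{z-\zeta}$ is the angular derivative. A boundary regular null point of $f$ is a point $\zeta\in\partial\mathbb{D}$ at which the angular limit of $f$ exists and equals $0$ and the angular derivative exists and is finite; at such points (different from the Denjoy-Wolff point) the angular derivative is a negative real number. *)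

(* Defs.v *)
From Stdlib Require Import Reals.
From Coquelicot Require Import Coquelicot.

Open Scope R_scope.

Definition in_disk (z : C) : Prop := Cmod z < 1.

Definition holomorphic_on_disk (g : C -> C) : Prop :=
  forall z : C, in_disk z -> ex_derive (K := C_AbsRing) (V := C_NormedModule) g z.

(* Functions on the disk are total functions on [C]; their values outside the
   disk are never constrained or used. *)
Definition holomorphic_self_map (G : C -> C) : Prop :=
  holomorphic_on_disk G /\ (forall z : C, in_disk z -> in_disk (G z)).

Definition disk_automorphism (G : C -> C) : Prop :=
  holomorphic_self_map G /\
  exists H : C -> C, holomorphic_self_map H /\
    forall z : C, in_disk z -> H (G z) = z /\ G (H z) = z.

Definition elliptic_automorphism (G : C -> C) : Prop :=
  disk_automorphism G /\
  (exists z : C, in_disk z /\ G z = z) /\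
  (exists z : C, in_disk z /\ G z <> z).

(* Only the values [F t z] with [0 <= t] and [z] in the disk matter.
   Continuity in [t] is pointwise in [z]. *)
Definition semigroup (F : R -> C -> C) : Prop :=
  (forall t : R, 0 <= t -> holomorphic_self_map (F t)) /\
  (forall z : C, in_disk z -> F 0 z = z) /\
  (forall (s t : R) (z : C), 0 <= s -> 0 <= t -> in_disk z ->
     F (s + t) z = F s (F t z)) /\
  (forall (t : R) (z : C), 0 <= t -> in_disk z ->
     filterlim (fun s : R => F s z)
       (within (fun s : R => 0 <= s) (locally t)) (locally (F t z))).

Definition generator_of (F : R -> C -> C) (f : C -> C) : Prop :=
  holomorphic_on_disk f /\
  forall z : C, in_disk z ->
    filterlim (fun t : R => (/ RtoC t * (z - F t z))%C)
      (at_right 0) (locally (f z)).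

Definition holomorphic_generator (f : C -> C) : Prop :=
  exists F : R -> C -> C, semigroup F /\ generator_of F f.

(* The Denjoy-Wolff point is only defined for semigroups which are nontrivial
   and contain no elliptic automorphisms. *)
Definition denjoy_wolff_point (F : R -> C -> C) (a : C) : Prop :=
  (exists (t : R) (z : C), 0 <= t /\ in_disk z /\ F t z <> z) /\
  (forall t : R, 0 <= t -> ~ elliptic_automorphism (F t)) /\
  Cmod a <= 1 /\
  (forall z : C, in_disk z ->
     filterlim (fun t : R => F t z) (Rbar_locally p_infty) (locally a)).

(* The nontangential approach region at [zeta] of aperture [M]; as [M] grows
   these exhaust the disk and are cofinal with the Stolz angles at [zeta]. *)
Definition stolz (zeta : C) (M : R) (z : C) : Prop :=
  in_disk z /\ Cmod (z - zeta)%C < M * (1 - Cmod z).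

Definition angular_lim (g : C -> C) (zeta l : C) : Prop :=
  forall M : R, 1 < M ->
    filterlim g (within (stolz zeta M) (locally zeta)) (locally l).

Definition angular_lim_infty (g : C -> C) (zeta : C) : Prop :=
  forall M : R, 1 < M ->
    filterlim (fun z : C => Cmod (g z))
      (within (stolz zeta M) (locally zeta)) (Rbar_locally p_infty).

(* [f'(zeta) = d], for a boundary point at which [f] has angular limit [0]. *)
Definition angular_derivative (f : C -> C) (zeta d : C) : Prop :=
  angular_lim f zeta 0 /\
  angular_lim (fun z : C => (f z / (z - zeta))%C) zeta d.

Definition boundary_regular_null_point (f : C -> C) (zeta : C) : Prop :=
  Cmod zeta = 1 /\ exists d : C, angular_derivative f zeta d.

(* Main.v *)
(* Schwarz's lemma applied to the semigroup gives [f z = z p z] with [Re p >= 0], so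
   [q = 1 / p] maps the disc into the closed right half plane, and
   [(1 - s) q (s zeta_n)] tends to [L_n = 1 / |f'(zeta_n)|] as [s -> 1].
   By Julia's lemma [L_n] is a lower bound for the mass at [zeta_n] of the measure
   representing [q]: subtracting the corresponding Poisson kernels one
   boundary point after the other keeps the real part nonnegative. The summands of the
   theorem, multiplied by [z], are those kernels up to imaginary constants. The
   remainder [Q] is either identically zero ([r = 0]) or without zeros, and then [h = z / Q]
   satisfies [Re (conj z h z) >= 0], which makes it a generator: trajectories of [u' = - h u] stay
   in the disc and depend holomorphically on the initial value.

   Complex differentiability comes without continuity of the derivative, so everything rests
   on Goursat's subdivision argument, which yields the mean value property and
   the maximum principle. *)

(* The quotient [p] of [f] by [z] and its reciprocal [q] are known to be differentiable only away
   from 0; at 0 there is just the continuity of a divided difference. So the results on functions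
   with nonnegative real part allow one exceptional point at which only continuity is assumed, and
   [h = z / Q] is differentiable at 0 because [1 / Q] serves as its slope function there.

   Besides positivity, the subtraction carries along the limit of [(z - zeta_n) * Q z] at every
   boundary point. Each kernel has the same limit as [q] at its own point and limit 0 at the others,
   so one limit becomes 0 and the rest stay available for the next use of Julia's lemma. The final
   zero limits are what make [h z / (z - zeta_n) = z / ((z - zeta_n) * Q z)] infinite.

   A regular null point only provides a complex derivative [d]. That [d] is nonzero follows from the
   growth of [q], and that it is negative from [Re p >= 0] on segments in all directions at the
   point.

   The [eta_n] enter through [w / (w - 1)] with [w = conj zeta_n * eta_n]; its real part is 1/2 for
   every unimodular [w] other than 1, whence their freedom. *)
Require Import Defs.
From Stdlib Require Import Reals Lra Lia Classical ClassicalEpsilon.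
From Coquelicot Require Import Coquelicot.

Open Scope R_scope.

(** * Continuity and differentiability of complex functions *)


(* [field] needs to see [C] itself, not a canonical structure on it. *)
Ltac as_C := match goal with |- @eq _ ?a ?b => change (@eq C a b) end.

Lemma Cmod_sqr (z : C) : Cmod z * Cmod z = Re z * Re z + Im z * Im z.
Proof. generalize (Cmod2_alt z); simpl; intros; lra. Qed.

Lemma Cmod_le_Rabs (z : C) : Cmod z <= Rabs (Re z) + Rabs (Im z).
Proof.
  apply Rsqr_incr_0_var; unfold Rsqr.
  - rewrite Cmod_sqr.
    pose proof (Rabs_pos (Re z)); pose proof (Rabs_pos (Im z)).
    assert (forall x, x * x = Rabs x * Rabs x) as E.
    { intros x; rewrite <- Rabs_mult, Rabs_pos_eq; nra. }
    rewrite (E (Re z)), (E (Im z)); nra.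
  - pose proof (Rabs_pos (Re z)); pose proof (Rabs_pos (Im z)); lra.
Qed.

Lemma im_le_Cmod (z : C) : Rabs (Im z) <= Cmod z.
Proof. eapply Rle_trans; [apply Rmax_r | apply Rmax_Cmod]. Qed.

Lemma Cmod_re_bound (z : C) : - Cmod z <= Re z <= Cmod z.
Proof. generalize (re_le_Cmod z); intros H; apply Rabs_le_between in H; lra. Qed.

Lemma Cmod_im_bound (z : C) : - Cmod z <= Im z <= Cmod z.
Proof. generalize (im_le_Cmod z); intros H; apply Rabs_le_between in H; lra. Qed.

Lemma Cmod_sub_sym (z w : C) : Cmod (z - w) = Cmod (w - z).
Proof. rewrite <- Cmod_opp; f_equal; ring. Qed.

Lemma Cmod_triangle_sub (z w : C) : Cmod z <= Cmod w + Cmod (z - w).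
Proof.
  replace z with (w + (z - w))%C at 1 by ring. apply Cmod_triangle.
Qed.

Lemma Cmod_minus_le (z w : C) : Cmod (z - w) <= Cmod z + Cmod w.
Proof.
  unfold Cminus. eapply Rle_trans; [apply Cmod_triangle|]. rewrite Cmod_opp; lra.
Qed.

Lemma Cmod_pos_sub (z w : C) : z <> w -> 0 < Cmod (z - w).
Proof.
  intros H; apply Cmod_gt_0; intros E; apply H.
  replace z with ((z - w) + w)%C by ring; rewrite E; ring.
Qed.

Lemma Csub_neq_0 (z w : C) : z <> w -> (z - w)%C <> 0.
Proof. intros H; apply Cmod_gt_0, Cmod_pos_sub, H. Qed.

Lemma C_eq (z w : C) : Re z = Re w -> Im z = Im w -> z = w.
Proof. destruct z, w; simpl; intros; subst; reflexivity. Qed.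

(** The uniform structure on [C] is that of a product, with squares as balls; a square of half side
    [d / 2] fits into the disc of radius [d]. *)
Lemma locally_C_iff (z : C) (P : C -> Prop) :
  locally z P <-> exists d, 0 < d /\ forall w, Cmod (w - z) < d -> P w.
Proof.
  split.
  - intros [d H]; exists d; split; [apply cond_pos|]; intros w Hw.
    apply H. split; unfold ball; simpl; unfold AbsRing_ball, abs, minus, plus, opp; simpl.
    + eapply Rle_lt_trans; [|exact Hw]. exact (re_le_Cmod (w - z)).
    + eapply Rle_lt_trans; [|exact Hw]. exact (im_le_Cmod (w - z)).
  - intros [d [Hd H]].
    assert (0 < d / 2) as Hd' by lra.
    exists (mkposreal _ Hd'); intros w [H1 H2]; apply H.
    unfold ball in H1, H2; simpl in H1, H2;
    unfold AbsRing_ball, abs, minus, plus, opp in H1, H2; simpl in H1, H2.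
    eapply Rle_lt_trans; [apply Cmod_le_Rabs|].
    change (Re (w - z)) with (fst w + - fst z); change (Im (w - z)) with (snd w + - snd z).
    lra.
Qed.

Lemma filterlim_C_iff {T : Type} (F : (T -> Prop) -> Prop) {FF : Filter F}
    (g : T -> C) (l : C) :
  filterlim g F (locally l) <-> forall e, 0 < e -> F (fun x => Cmod (g x - l) < e).
Proof.
  split.
  - intros H e He. apply (H (fun y => Cmod (y - l) < e)).
    apply locally_C_iff. exists e; split; auto.
  - intros H P HP. apply locally_C_iff in HP. destruct HP as [d [Hd HP]].
    unfold filtermap. generalize (H d Hd). apply filter_imp. intros x; apply HP.
Qed.

Lemma continuous_C_iff (g : C -> C) (z : C) :
  continuous g z <->
  forall e, 0 < e -> exists d, 0 < d /\ forall w, Cmod (w - z) < d -> Cmod (g w - g z) < e.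
Proof.
  unfold continuous. rewrite filterlim_C_iff by apply locally_filter.
  split; intros H e He; specialize (H e He).
  - apply locally_C_iff in H; exact H.
  - apply locally_C_iff; exact H.
Qed.

Section ContinuousC.
Context {T : UniformSpace}.

Lemma continuous_Re_Im (g : T -> C) (x : T) :
  continuous g x <-> continuous (fun y => Re (g y)) x /\ continuous (fun y => Im (g y)) x.
Proof.
  split.
  - intros H; split.
    + apply (continuous_comp g (fun c : C => fst c) x H).
      destruct (g x); apply continuous_fst.
    + apply (continuous_comp g (fun c : C => snd c) x H).
      destruct (g x); apply continuous_snd.
  - intros [H1 H2]. apply continuous_ext with (fun y => (Re (g y), Im (g y))).
    { intros y; destruct (g y); reflexivity. }
    apply (continuous_comp_2 (fun y => Re (g y)) (fun y => Im (g y)) (fun a b => (a, b) : C) x H1 H2).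
    apply continuous_ext with (fun y => y); [intros [a b]; reflexivity|].
    apply continuous_id.
Qed.

Lemma continuous_Cplus (g h : T -> C) (x : T) :
  continuous g x -> continuous h x -> continuous (fun y => g y + h y)%C x.
Proof.
  rewrite !continuous_Re_Im; intros [H1 H2] [H3 H4]; split.
  - exact (continuous_plus _ _ x H1 H3).
  - exact (continuous_plus _ _ x H2 H4).
Qed.

Lemma continuous_Copp (g : T -> C) (x : T) :
  continuous g x -> continuous (fun y => - g y)%C x.
Proof.
  rewrite !continuous_Re_Im; intros [H1 H2]; split.
  - exact (continuous_opp _ x H1).
  - exact (continuous_opp _ x H2).
Qed.

Lemma continuous_Cminus (g h : T -> C) (x : T) :
  continuous g x -> continuous h x -> continuous (fun y => g y - h y)%C x.
Proof. intros; apply continuous_Cplus; auto; apply continuous_Copp; auto. Qed.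

Lemma continuous_Cmult (g h : T -> C) (x : T) :
  continuous g x -> continuous h x -> continuous (fun y => g y * h y)%C x.
Proof.
  rewrite !continuous_Re_Im; intros [H1 H2] [H3 H4]; split.
  - exact (continuous_minus _ _ x (continuous_mult _ _ x H1 H3) (continuous_mult _ _ x H2 H4)).
  - exact (continuous_plus _ _ x (continuous_mult _ _ x H1 H4) (continuous_mult _ _ x H2 H3)).
Qed.

Lemma continuous_Cconj (g : T -> C) (x : T) :
  continuous g x -> continuous (fun y => Cconj (g y)) x.
Proof.
  rewrite !continuous_Re_Im; intros [H1 H2]; split.
  - exact H1.
  - exact (continuous_opp _ x H2).
Qed.

Lemma continuous_sqr_norm (g : T -> C) (x : T) :
  continuous (fun y => Re (g y)) x -> continuous (fun y => Im (g y)) x ->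
  continuous (fun y => Re (g y) ^ 2 + Im (g y) ^ 2) x.
Proof.
  assert (forall f : T -> R, continuous f x -> continuous (fun y => f y ^ 2) x) as S.
  { intros f Hf. apply continuous_ext with (fun y => mult (f y) (f y)).
    - intros y; unfold mult; simpl; ring.
    - exact (continuous_mult f f x Hf Hf). }
  intros H1 H2; exact (continuous_plus _ _ x (S _ H1) (S _ H2)).
Qed.

Lemma continuous_Cinv (g : T -> C) (x : T) :
  continuous g x -> g x <> 0 -> continuous (fun y => / g y)%C x.
Proof.
  rewrite !continuous_Re_Im; intros [H1 H2] H0.
  assert (continuous (fun y => / (Re (g y) ^ 2 + Im (g y) ^ 2)) x) as H.
  { apply (continuous_comp (fun y => Re (g y) ^ 2 + Im (g y) ^ 2) Rinv).
    - apply continuous_sqr_norm; auto.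
    - apply continuous_Rinv. intros E; apply H0.
      apply Cmod_eq_0, Rsqr_eq_0. unfold Rsqr; rewrite Cmod_sqr; simpl in E; lra. }
  split.
  - exact (continuous_mult _ _ x H1 H).
  - exact (continuous_mult _ _ x (continuous_opp _ x H2) H).
Qed.

Lemma continuous_Cdiv (g h : T -> C) (x : T) :
  continuous g x -> continuous h x -> h x <> 0 -> continuous (fun y => g y / h y)%C x.
Proof. intros; apply continuous_Cmult; auto; apply continuous_Cinv; auto. Qed.

Lemma continuous_Cmod (g : T -> C) (x : T) :
  continuous g x -> continuous (fun y => Cmod (g y)) x.
Proof.
  rewrite !continuous_Re_Im; intros [H1 H2].
  apply (continuous_comp (fun y => fst (g y) ^ 2 + snd (g y) ^ 2) sqrt).
  - apply continuous_sqr_norm; auto.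
  - apply continuous_sqrt.
Qed.

End ContinuousC.

(* Carathéodory's form of complex differentiability. *)
Definition cdiff (g : C -> C) (z : C) : Prop :=
  exists phi : C -> C, continuous phi z /\ forall w, g w = (g z + phi w * (w - z))%C.

Lemma cdiff_continuous g z : cdiff g z -> continuous g z.
Proof.
  intros [phi [Hp H]].
  apply continuous_ext with (fun w => g z + phi w * (w - z))%C; [intros; symmetry; apply H|].
  apply continuous_Cplus; [apply continuous_const|].
  apply continuous_Cmult; auto.
  apply continuous_Cminus; [apply continuous_id|apply continuous_const].
Qed.

Lemma cdiff_const c z : cdiff (fun _ => c) z.
Proof. exists (fun _ => 0); split; [apply continuous_const|intros; ring]. Qed.

Lemma cdiff_id z : cdiff (fun w => w) z.
Proof. exists (fun _ => 1); split; [apply continuous_const|intros; ring]. Qed.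

Lemma cdiff_plus g h z : cdiff g z -> cdiff h z -> cdiff (fun w => g w + h w)%C z.
Proof.
  intros [p [Hp Ep]] [q [Hq Eq]]; exists (fun w => p w + q w)%C; split.
  - apply continuous_Cplus; auto.
  - intros w; rewrite Ep, Eq; ring.
Qed.

Lemma cdiff_mult g h z : cdiff g z -> cdiff h z -> cdiff (fun w => g w * h w)%C z.
Proof.
  intros Hg Hh; pose proof (cdiff_continuous _ _ Hh) as Ch.
  destruct Hg as [p [Hp Ep]], Hh as [q [Hq Eq]].
  exists (fun w => p w * h w + g z * q w)%C; split.
  - apply continuous_Cplus; apply continuous_Cmult; auto; apply continuous_const.
  - intros w; rewrite (Ep w), (Eq w); ring.
Qed.

Lemma cdiff_opp g z : cdiff g z -> cdiff (fun w => - g w)%C z.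
Proof.
  intros [p [Hp Ep]]; exists (fun w => - p w)%C; split.
  - apply continuous_Copp; auto.
  - intros w; rewrite (Ep w); ring.
Qed.

Lemma cdiff_minus g h z : cdiff g z -> cdiff h z -> cdiff (fun w => g w - h w)%C z.
Proof. intros; apply cdiff_plus; auto; apply cdiff_opp; auto. Qed.

(** The identity in [cdiff] ranges over all [w], so outside the neighbourhood the slope function has
    to be replaced by the difference quotient of [h]. *)
Lemma cdiff_local g h z :
  locally z (fun w => g w = h w) -> cdiff g z -> cdiff h z.
Proof.
  intros L [p [Hp Ep]].
  pose proof (locally_singleton _ _ L) as Ez.
  exists (fun w => if Ceq_dec w z then p w else (h w - h z) / (w - z))%C; split.
  - apply continuous_ext_loc with p; auto.
    generalize L; apply filter_imp; intros w Ew.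
    destruct (Ceq_dec w z) as [|n]; auto.
    rewrite <- Ew, <- Ez, (Ep w). as_C; field. apply Csub_neq_0; auto.
  - intros w; destruct (Ceq_dec w z) as [->|n]; [ring|field; apply Csub_neq_0; auto].
Qed.

(** The slope function of the inverse is [- p w / (g z * g w)], but its identity holds only where
    [g w <> 0], that is near [z]; hence the detour through [cdiff_local]. *)
Lemma cdiff_inv g z : cdiff g z -> g z <> 0 -> cdiff (fun w => / g w)%C z.
Proof.
  intros Hg Hz; pose proof (cdiff_continuous _ _ Hg) as Cg.
  destruct Hg as [p [Hp Ep]].
  assert (locally z (fun w => g w <> 0)) as L.
  { apply Cmod_gt_0 in Hz. apply (proj1 (continuous_C_iff g z) Cg) in Hz.
    apply locally_C_iff. destruct Hz as [d [Hd H]]; exists d; split; auto.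
    intros w Hw E. specialize (H w Hw). rewrite E in H.
    replace (0 - g z)%C with (- g z)%C in H by ring. rewrite Cmod_opp in H; lra. }
  apply cdiff_local with (fun w => / g z + (- p w / (g z * g w)) * (w - z))%C.
  - generalize L; apply filter_imp; intros w Hw.
    replace (p w * (w - z))%C with (g w - g z)%C by (rewrite (Ep w); ring).
    replace (- p w / (g z * g w) * (w - z))%C with (- (p w * (w - z)) / (g z * g w))%C
      by (field; auto).
    replace (p w * (w - z))%C with (g w - g z)%C by (rewrite (Ep w); ring).
    field; auto.
  - exists (fun w => - p w / (g z * g w))%C; split.
    + apply continuous_Cdiv.
      * apply continuous_Copp; auto.
      * apply continuous_Cmult; auto; apply continuous_const.
      * apply Cmult_neq_0; auto.
    + intros w; ring.
Qed.

Lemma cdiff_div g h z : cdiff g z -> cdiff h z -> h z <> 0 -> cdiff (fun w => g w / h w)%C z.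
Proof. intros; apply cdiff_mult; auto; apply cdiff_inv; auto. Qed.

(** The derivative over [C_AbsRing] uses balls of the modulus, continuity the product structure;
    [locally_C] passes between the two. *)
Lemma cdiff_ex_derive (g : C -> C) (z : C) :
  ex_derive (K := C_AbsRing) (V := C_NormedModule) g z <-> cdiff g z.
Proof.
  split.
  - intros [l [_ H]]. specialize (H z (fun P HP => HP)).
    exists (fun w => if Ceq_dec w z then l else (g w - g z) / (w - z))%C; split.
    + apply continuous_C_iff; intros e He.
      assert (0 < e / 2) as He2 by lra.
      specialize (H (mkposreal _ He2)).
      apply locally_C, locally_C_iff in H. destruct H as [d [Hd H]].
      exists d; split; auto. intros w Hw. specialize (H w Hw).
      destruct (Ceq_dec z z) as [_|n]; [|congruence].
      destruct (Ceq_dec w z) as [->|n].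
      * replace (l - l)%C with (RtoC 0) by (as_C; ring). rewrite Cmod_0; auto.
      * replace ((g w - g z) / (w - z) - l)%C with ((g w - g z - (w - z) * l) / (w - z))%C
          by (field; apply Csub_neq_0; auto).
        rewrite Cmod_div by (apply Csub_neq_0; auto).
        pose proof (Cmod_pos_sub _ _ n).
        change (Cmod (g w - g z - (w - z) * l) <= e / 2 * Cmod (w - z)) in H.
        apply Rmult_lt_reg_r with (Cmod (w - z)); auto.
        unfold Rdiv at 1; rewrite Rmult_assoc, Rinv_l by lra. nra.
    + intros w; destruct (Ceq_dec w z) as [->|n]; as_C; [ring|field; apply Csub_neq_0; auto].
  - intros [p [Hp Ep]]. exists (p z). split; [apply is_linear_scal_l|].
    intros x Hx.
    assert (z = x) as <-.
    { apply (is_filter_lim_locally_unique (K := C_AbsRing) (V := AbsRing_NormedModule C_AbsRing)) in Hx; auto. }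
    intros e. apply locally_C, locally_C_iff.
    destruct (proj1 (continuous_C_iff p z) Hp e (cond_pos e)) as [d [Hd H]].
    exists d; split; auto. intros w Hw; specialize (H w Hw).
    change (Cmod (g w - g z - (w - z) * p z) <= e * Cmod (w - z)).
    rewrite (Ep w).
    replace (g z + p w * (w - z) - g z - (w - z) * p z)%C with ((p w - p z) * (w - z))%C
      by (as_C; ring).
    rewrite Cmod_mult. apply Rmult_le_compat_r; [apply Cmod_ge_0|lra].
Qed.

(** * Green's identity on rectangles *)


Lemma nested_intervals_common (a d : nat -> R) :
  (forall n, 0 <= d n) -> (forall n, a n <= a (S n)) ->
  (forall n, a (S n) + d (S n) <= a n + d n) ->
  exists x, forall n, a n <= x <= a n + d n.
Proof.
  intros Hd Ha Hb.
  assert (forall m k, a m <= a (m + k)%nat /\ a (m + k)%nat + d (m + k)%nat <= a m + d m) as M.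
  { intros m k; induction k as [|k IH].
    - rewrite Nat.add_0_r; lra.
    - rewrite Nat.add_succ_r. specialize (Ha (m + k)%nat); specialize (Hb (m + k)%nat); lra. }
  assert (forall m n, a n <= a m + d m) as U.
  { intros m n. destruct (Nat.le_ge_cases m n) as [L|L].
    - destruct (M m (n - m)%nat) as [_ H]. replace (m + (n - m))%nat with n in H by lia.
      specialize (Hd n); lra.
    - destruct (M n (m - n)%nat) as [H _]. replace (n + (m - n))%nat with m in H by lia.
      specialize (Hd m); lra. }
  destruct (completeness (fun x => exists n, x = a n)) as [x [Hx1 Hx2]].
  - exists (a 0%nat + d 0%nat). intros y [n ->]; apply U.
  - exists (a 0%nat); exists 0%nat; reflexivity.
  - exists x; intros n; split.
    + apply Hx1; exists n; reflexivity.
    + apply Hx2. intros y [m ->]; apply U.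
Qed.

(* [P a b t] speaks of the rectangle with lower left corner [(a, b)] and sides
   [t * w0] and [t * h0]. *)
Lemma bisection_principle (P : R -> R -> R -> Prop) (a0 b0 w0 h0 : R) :
  0 < w0 -> 0 < h0 ->
  (forall a b t, 0 < t ->
     P a b (t / 2) -> P (a + t / 2 * w0) b (t / 2) -> P a (b + t / 2 * h0) (t / 2) ->
     P (a + t / 2 * w0) (b + t / 2 * h0) (t / 2) -> P a b t) ->
  (forall x y, a0 <= x <= a0 + w0 -> b0 <= y <= b0 + h0 ->
     exists d, 0 < d /\ forall a b t, 0 < t < d ->
       a <= x <= a + t * w0 -> b <= y <= b + t * h0 -> P a b t) ->
  P a0 b0 1.
Proof.
  intros Hw Hh Hsub Hloc. apply NNPP; intros HP.
  (* Stated as an implication for every state, so that the chosen successor is a total function; a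
     state is a corner with its generation, which fixes the scale. *)
  assert (forall (s : (R * R) * nat), exists s' : R * R,
    ~ P (fst (fst s)) (snd (fst s)) ((/ 2) ^ snd s) ->
    ~ P (fst s') (snd s') ((/ 2) ^ S (snd s)) /\
    fst (fst s) <= fst s' /\ fst s' + (/ 2) ^ S (snd s) * w0 <= fst (fst s) + (/ 2) ^ snd s * w0 /\
    snd (fst s) <= snd s' /\ snd s' + (/ 2) ^ S (snd s) * h0 <= snd (fst s) + (/ 2) ^ snd s * h0)
    as Hstep.
  { intros [[a b] n]; simpl.
    assert (0 < (/ 2) ^ n) as Ht by (apply pow_lt; lra).
    set (t := (/ 2) ^ n) in *.
    replace (/ 2 * t) with (t / 2) by lra.
    assert (0 < t / 2 * w0) by (apply Rmult_lt_0_compat; lra).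
    assert (0 < t / 2 * h0) by (apply Rmult_lt_0_compat; lra).
    destruct (classic (P a b (t / 2))) as [H1|H1];
      [|exists (a, b); simpl; intros; split; auto; repeat split; nra].
    destruct (classic (P (a + t / 2 * w0) b (t / 2))) as [H2|H2];
      [|exists (a + t / 2 * w0, b); simpl; intros; split; auto; repeat split; nra].
    destruct (classic (P a (b + t / 2 * h0) (t / 2))) as [H3|H3];
      [|exists (a, b + t / 2 * h0); simpl; intros; split; auto; repeat split; nra].
    exists (a + t / 2 * w0, b + t / 2 * h0); simpl; intros H4; split.
    - intros H5. apply H4, Hsub; auto.
    - repeat split; nra. }
  set (nx := fun s => proj1_sig (constructive_indefinite_description _ (Hstep s))).
  assert (forall s, ~ P (fst (fst s)) (snd (fst s)) ((/ 2) ^ snd s) ->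
    ~ P (fst (nx s)) (snd (nx s)) ((/ 2) ^ S (snd s)) /\
    fst (fst s) <= fst (nx s) /\
    fst (nx s) + (/ 2) ^ S (snd s) * w0 <= fst (fst s) + (/ 2) ^ snd s * w0 /\
    snd (fst s) <= snd (nx s) /\
    snd (nx s) + (/ 2) ^ S (snd s) * h0 <= snd (fst s) + (/ 2) ^ snd s * h0) as Hnx.
  { intros s; unfold nx; destruct (constructive_indefinite_description _ (Hstep s)); auto. }
  clearbody nx; clear Hstep.
  set (c := fix c n := match n with O => (a0, b0) | S k => nx (c k, k) end).
  assert (forall n, ~ P (fst (c n)) (snd (c n)) ((/ 2) ^ n)) as Hc.
  { induction n as [|n IH]; [exact HP|]. apply (Hnx (c n, n) IH). }
  assert (forall n, fst (c n) <= fst (c (S n)) /\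
    fst (c (S n)) + (/ 2) ^ S n * w0 <= fst (c n) + (/ 2) ^ n * w0 /\
    snd (c n) <= snd (c (S n)) /\
    snd (c (S n)) + (/ 2) ^ S n * h0 <= snd (c n) + (/ 2) ^ n * h0) as Hm.
  { intros n. apply (Hnx (c n, n) (Hc n)). }
  assert (forall n, 0 < (/ 2) ^ n) as Hp by (intros; apply pow_lt; lra).
  destruct (nested_intervals_common (fun n => fst (c n)) (fun n => (/ 2) ^ n * w0)) as [x Hx].
  { intros n; specialize (Hp n); nra. }
  { intros n; apply Hm. }
  { intros n; apply Hm. }
  destruct (nested_intervals_common (fun n => snd (c n)) (fun n => (/ 2) ^ n * h0)) as [y Hy].
  { intros n; specialize (Hp n); nra. }
  { intros n; apply Hm. }
  { intros n; apply Hm. }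
  destruct (Hloc x y) as [d [Hd Hl]].
  { specialize (Hx 0%nat); simpl in Hx; lra. }
  { specialize (Hy 0%nat); simpl in Hy; lra. }
  destruct (pow_lt_1_zero (/ 2)) with (y := d) as [n Hn]; auto.
  { rewrite Rabs_pos_eq; lra. }
  apply (Hc n), Hl; auto.
  specialize (Hn n (le_n n)); rewrite Rabs_pos_eq in Hn; [|apply Rlt_le, Hp].
  split; auto.
Qed.

Lemma ex_RInt_cont (phi : R -> R) (a b : R) :
  a <= b -> (forall x, a <= x <= b -> continuous phi x) -> ex_RInt phi a b.
Proof.
  intros Hab H. apply (ex_RInt_continuous (V := R_CompleteNormedModule)).
  rewrite Rmin_left, Rmax_right; auto.
Qed.

Lemma RInt_near_const (phi : R -> R) (a b k e : R) :
  a <= b -> (forall x, a <= x <= b -> continuous phi x) ->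
  (forall x, a <= x <= b -> Rabs (phi x - k) <= e) ->
  Rabs (RInt phi a b - k * (b - a)) <= e * (b - a).
Proof.
  intros Hab Hc He.
  pose proof (ex_RInt_cont phi a b Hab Hc) as Hex.
  assert (forall c, RInt (fun _ => c) a b = (b - a) * c) as RC.
  { intros c; apply (RInt_const (V := R_CompleteNormedModule)). }
  assert (RInt phi a b <= RInt (fun _ => k + e) a b) as H1.
  { apply RInt_le; auto; [apply ex_RInt_const|]. intros x Hx.
    assert (a <= x <= b) as Hx' by lra.
    specialize (He x Hx'); apply Rabs_le_between in He; lra. }
  assert (RInt (fun _ => k - e) a b <= RInt phi a b) as H2.
  { apply RInt_le; auto; [apply ex_RInt_const|]. intros x Hx.
    assert (a <= x <= b) as Hx' by lra.
    specialize (He x Hx'); apply Rabs_le_between in He; lra. }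
  rewrite RC in H1, H2. apply Rabs_le; lra.
Qed.

Lemma continuous_Rminus (f g : R -> R) (x : R) :
  continuous f x -> continuous g x -> continuous (fun t => f t - g t) x.
Proof. intros Hf Hg. exact (continuous_minus f g x Hf Hg). Qed.

Lemma differentiable_continuous_slice (u : R -> R -> R) (x y A B : R) :
  differentiable_pt_lim u x y A B -> continuous (u x) y.
Proof.
  intros H. apply (ex_derive_continuous (K := R_AbsRing) (V := R_NormedModule)).
  exists (A * 0 + B * 1). apply is_derive_Reals.
  apply (derivable_pt_lim_comp_2d u (fun _ => x) (fun t => t)); auto.
  - apply derivable_pt_lim_const.
  - apply derivable_pt_lim_id.
Qed.

Lemma differentiable_pt_lim_swap (u : R -> R -> R) (x y A B : R) :
  differentiable_pt_lim u x y A B -> differentiable_pt_lim (fun s t => u t s) y x B A.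
Proof.
  intros H e. destruct (H e) as [d Hd]. exists d. intros s t Hs Ht.
  rewrite Rmax_comm. specialize (Hd t s Ht Hs).
  replace (B * (s - y) + A * (t - x)) with (A * (t - x) + B * (s - y)) by ring. exact Hd.
Qed.

(** Stands for the integral of the [x]-derivative of [u] over the rectangle, without requiring that
    derivative to be integrable. *)
Definition side_integral (u : R -> R -> R) (x1 x2 y1 y2 : R) : R :=
  RInt (fun y => u x2 y - u x1 y) y1 y2.

Lemma side_integral_split (u : R -> R -> R) (x1 x2 x3 y1 y2 y3 : R) :
  y1 <= y2 <= y3 ->
  (forall y, y1 <= y <= y3 -> continuous (u x1) y) ->
  (forall y, y1 <= y <= y3 -> continuous (u x2) y) ->
  (forall y, y1 <= y <= y3 -> continuous (u x3) y) ->
  side_integral u x1 x3 y1 y3 =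
    side_integral u x1 x2 y1 y2 + side_integral u x2 x3 y1 y2
    + side_integral u x1 x2 y2 y3 + side_integral u x2 x3 y2 y3.
Proof.
  intros Hy H1 H2 H3; unfold side_integral.
  assert (forall f g a b, (forall y, y1 <= y <= y3 -> continuous f y) ->
    (forall y, y1 <= y <= y3 -> continuous g y) -> y1 <= a -> a <= b -> b <= y3 ->
    ex_RInt (fun t => f t - g t) a b) as X.
  { intros f g a b Hf Hg Ha Hab Hb; apply ex_RInt_cont; auto. intros t Ht.
    assert (y1 <= t <= y3) by lra.
    apply continuous_Rminus; auto. }
  assert (RInt (fun y => u x3 y - u x1 y) y1 y3 =
    RInt (fun y => u x3 y - u x1 y) y1 y2 + RInt (fun y => u x3 y - u x1 y) y2 y3) as ->.
  { symmetry; apply (RInt_Chasles (V := R_CompleteNormedModule)); apply X; auto; lra. }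
  assert (forall a b, y1 <= a -> a <= b -> b <= y3 -> RInt (fun y => u x3 y - u x1 y) a b =
    RInt (fun y => u x2 y - u x1 y) a b + RInt (fun y => u x3 y - u x2 y) a b) as E.
  { intros a b Ha Hab Hb.
    transitivity (RInt (fun y => (u x2 y - u x1 y) + (u x3 y - u x2 y)) a b).
    - apply RInt_ext; intros t _. change (u x3 t - u x1 t = (u x2 t - u x1 t) + (u x3 t - u x2 t)). ring.
    - apply (RInt_plus (V := R_CompleteNormedModule)); apply X; auto. }
  rewrite !E by lra. ring.
Qed.

(** The [B] terms of the first-order expansion cancel between the two sides at equal height, which
    leaves [A] times the area and an error of [e] times a quadratic quantity. *)
Lemma side_integral_bound (u : R -> R -> R) (x y A B x1 x2 y1 y2 e d : R) :
  x1 <= x <= x2 -> y1 <= y <= y2 ->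
  (forall t, y1 <= t <= y2 -> continuous (u x1) t) ->
  (forall t, y1 <= t <= y2 -> continuous (u x2) t) ->
  (forall s t, Rabs (s - x) < d -> Rabs (t - y) < d ->
    Rabs (u s t - u x y - (A * (s - x) + B * (t - y))) <= e * Rmax (Rabs (s - x)) (Rabs (t - y))) ->
  0 <= e -> x2 - x1 < d -> y2 - y1 < d ->
  Rabs (side_integral u x1 x2 y1 y2 - A * (x2 - x1) * (y2 - y1))
    <= 2 * e * ((x2 - x1) + (y2 - y1)) * (y2 - y1).
Proof.
  intros Hx Hy C1 C2 Hu He Hdx Hdy. unfold side_integral.
  apply RInt_near_const; [lra| |].
  - intros t Ht. apply continuous_Rminus; auto.
  - intros t Ht.
    assert (forall s, x1 <= s <= x2 -> Rabs (u s t - u x y - (A * (s - x) + B * (t - y)))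
      <= e * ((x2 - x1) + (y2 - y1))) as Hs.
    { intros s Hs. eapply Rle_trans; [apply Hu|].
      - apply Rabs_def1; lra.
      - apply Rabs_def1; lra.
      - apply Rmult_le_compat_l; auto. apply Rmax_lub; apply Rabs_le; lra. }
    assert (x1 <= x1 <= x2) as B1 by lra. assert (x1 <= x2 <= x2) as B2 by lra.
    pose proof (Hs _ B1) as K1; pose proof (Hs _ B2) as K2.
    apply Rabs_le_between in K1; apply Rabs_le_between in K2.
    apply Rabs_le; lra.
Qed.

(* Goursat's argument: only pointwise differentiability is available, so the
   identity is obtained by subdivision rather than by integrating derivatives. *)
Lemma green_rectangle (u v : R -> R -> R) (a0 b0 w0 h0 : R) :
  0 < w0 -> 0 < h0 ->
  (forall x y, x <= a0 + w0 -> exists A B C,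
     differentiable_pt_lim u x y A B /\ differentiable_pt_lim v x y C A) ->
  RInt (fun y => u (a0 + w0) y - u a0 y) b0 (b0 + h0) =
  RInt (fun x => v x (b0 + h0) - v x b0) a0 (a0 + w0).
Proof.
  intros Hw Hh Hd.
  set (vT := fun s r => v r s).
  set (J := fun a b t => side_integral u a (a + t * w0) b (b + t * h0)
    - side_integral vT b (b + t * h0) a (a + t * w0)).
  assert (forall x y, x <= a0 + w0 -> continuous (u x) y) as Cu.
  { intros x y Hx; destruct (Hd x y Hx) as (A & B & C & H & _).
    eapply differentiable_continuous_slice; eauto. }
  assert (forall x y, x <= a0 + w0 -> continuous (vT y) x) as Cv.
  { intros x y Hx; destruct (Hd x y Hx) as (A & B & C & _ & H).
    apply differentiable_pt_lim_swap, differentiable_continuous_slice in H; auto. }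
  assert (forall e, 0 < e -> Rabs (J a0 b0 1) <= e) as HJ.
  { intros e He.
    (* The bound [e * t^2] is additive over four quarters of scale [t / 2]. The premise keeps the
       rectangle left of [a0 + w0], where differentiability is available. *)
    enough (a0 + 1 * w0 <= a0 + w0 -> Rabs (J a0 b0 1) <= e * (1 * 1)) as H.
    { rewrite !Rmult_1_l, Rmult_1_r in H; apply H; lra. }
    apply (bisection_principle (fun a b t => a + t * w0 <= a0 + w0 -> Rabs (J a b t) <= e * (t * t))
       a0 b0 w0 h0 Hw Hh).
    - intros a b t Ht H1 H2 H3 H4 Ha.
      assert (0 < t * w0) by (apply Rmult_lt_0_compat; lra).
      assert (0 < t * h0) by (apply Rmult_lt_0_compat; lra).
      replace (t / 2 * w0) with (t * w0 / 2) in * by field.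
      replace (t / 2 * h0) with (t * h0 / 2) in * by field.
      specialize (H1 ltac:(lra)); specialize (H2 ltac:(lra));
      specialize (H3 ltac:(lra)); specialize (H4 ltac:(lra)).
      unfold J in *.
      replace (t / 2 * w0) with (t * w0 / 2) in * by field.
      replace (t / 2 * h0) with (t * h0 / 2) in * by field.
      replace (a + t * w0 / 2 + t * w0 / 2) with (a + t * w0) in * by field.
      replace (b + t * h0 / 2 + t * h0 / 2) with (b + t * h0) in * by field.
      rewrite (side_integral_split u a (a + t * w0 / 2) (a + t * w0)
        b (b + t * h0 / 2) (b + t * h0)) by (try lra; intros; apply Cu; lra).
      rewrite (side_integral_split vT b (b + t * h0 / 2) (b + t * h0)
        a (a + t * w0 / 2) (a + t * w0)) by (try lra; intros; apply Cv; lra).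
      apply Rabs_le_between in H1; apply Rabs_le_between in H2;
      apply Rabs_le_between in H3; apply Rabs_le_between in H4.
      apply Rabs_le; lra.
    - intros x y Hx Hy.
      destruct (Hd x y) as (A & B & C & H1 & H2); [lra|].
      apply differentiable_pt_lim_swap in H2; fold vT in H2.
      set (S := w0 + h0). assert (0 < S) by (unfold S; lra).
      (* The two local errors add up to [2 * k * (t * S)^2], which for this [k] is exactly
         [e * t^2]. *)
      assert (0 < e / (2 * (S * S))) as Hk.
      { apply Rdiv_lt_0_compat; auto. nra. }
      set (k := mkposreal _ Hk).
      destruct (H1 k) as [d1 L1], (H2 k) as [d2 L2].
      pose proof (cond_pos d1); pose proof (cond_pos d2).
      set (d := Rmin d1 d2). assert (0 < d) by (unfold d; apply Rmin_glb_lt; auto).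
      exists (d / S); split; [apply Rdiv_lt_0_compat; auto|].
      intros a b t [Ht1 Ht2] Ha Hb Hc.
      assert (t * S < d) as Ht3.
      { apply Rmult_lt_reg_r with (/ S); [apply Rinv_0_lt_compat; auto|].
        rewrite Rmult_assoc, Rinv_r by lra. unfold Rdiv in Ht2; lra. }
      assert (0 < t * w0) by (apply Rmult_lt_0_compat; lra).
      assert (0 < t * h0) by (apply Rmult_lt_0_compat; lra).
      assert (t * S = t * w0 + t * h0) as ES by (unfold S; ring).
      pose proof (Rmin_l d1 d2) as M1; pose proof (Rmin_r d1 d2) as M2; fold d in M1, M2.
      assert (0 <= k) by apply Rlt_le, cond_pos.
      pose proof (side_integral_bound u x y A B a (a + t * w0) b (b + t * h0) k d1
        ltac:(lra) ltac:(lra) ltac:(intros; apply Cu; lra) ltac:(intros; apply Cu; lra)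
        L1 ltac:(lra) ltac:(lra) ltac:(lra)) as B1.
      pose proof (side_integral_bound vT y x A C b (b + t * h0) a (a + t * w0) k d2
        ltac:(lra) ltac:(lra) ltac:(intros; apply Cv; lra) ltac:(intros; apply Cv; lra)
        L2 ltac:(lra) ltac:(lra) ltac:(lra)) as B2.
      unfold J.
      replace (a + t * w0 - a) with (t * w0) in * by ring.
      replace (b + t * h0 - b) with (t * h0) in * by ring.
      apply Rabs_le_between in B1; apply Rabs_le_between in B2.
      assert (2 * k * (t * w0 + t * h0) * (t * h0) + 2 * k * (t * h0 + t * w0) * (t * w0)
        = e * (t * t)) as EE.
      { unfold k; simpl; unfold S; field. unfold S in *; lra. }
      apply Rabs_le; lra. }
  assert (J a0 b0 1 = 0) as E.
  { destruct (Req_dec (J a0 b0 1) 0) as [|N]; auto.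
    apply Rabs_pos_lt in N. specialize (HJ (Rabs (J a0 b0 1) / 2)). lra. }
  unfold J, side_integral, vT in E. rewrite !Rmult_1_l in E. lra.
Qed.

(** * The mean value property *)


Lemma cdiff_cauchy_riemann (g : C -> C) (x y : R) :
  cdiff g (x, y) -> exists A B,
    differentiable_pt_lim (fun s t => Re (g (s, t))) x y A (- B) /\
    differentiable_pt_lim (fun s t => Im (g (s, t))) x y B A.
Proof.
  intros [p [Hp Ep]]. exists (Re (p (x, y))), (Im (p (x, y))).
  assert (forall e : posreal, exists d : posreal, forall s t,
    Rabs (s - x) < d -> Rabs (t - y) < d ->
    Cmod (g (s, t) - g (x, y) - p (x, y) * ((s, t) - (x, y)))%C
      <= e * Rmax (Rabs (s - x)) (Rabs (t - y))) as H.
  { intros e. assert (0 < e / 2) as He by (generalize (cond_pos e); lra).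
    destruct (proj1 (continuous_C_iff p (x, y)) Hp _ He) as [d [Hd H]].
    assert (0 < d / 2) as Hd2 by lra. exists (mkposreal _ Hd2); simpl.
    intros s t Hs Ht.
    assert (Cmod ((s, t) - (x, y))%C <= 2 * Rmax (Rabs (s - x)) (Rabs (t - y))) as K.
    { eapply Rle_trans; [apply Cmod_le_Rabs|].
      change (Rabs (s - x) + Rabs (t - y) <= 2 * Rmax (Rabs (s - x)) (Rabs (t - y))).
      pose proof (Rmax_l (Rabs (s - x)) (Rabs (t - y)));
      pose proof (Rmax_r (Rabs (s - x)) (Rabs (t - y))); lra. }
    rewrite (Ep (s, t)).
    replace (g (x, y) + p (s, t) * ((s, t) - (x, y)) - g (x, y) - p (x, y) * ((s, t) - (x, y)))%C
      with ((p (s, t) - p (x, y)) * ((s, t) - (x, y)))%C by ring.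
    rewrite Cmod_mult.
    assert (Cmod (p (s, t) - p (x, y)) <= e / 2) as K2.
    { apply Rlt_le, H. eapply Rle_lt_trans; [exact K|].
      assert (Rmax (Rabs (s - x)) (Rabs (t - y)) < d / 2) by (apply Rmax_lub_lt; auto). lra. }
    replace (e * Rmax (Rabs (s - x)) (Rabs (t - y)))
      with (e / 2 * (2 * Rmax (Rabs (s - x)) (Rabs (t - y)))) by field.
    apply Rmult_le_compat; auto; apply Cmod_ge_0. }
  split; intros e; destruct (H e) as [d Hd]; exists d; intros s t Hs Ht;
    (eapply Rle_trans; [|apply (Hd s t Hs Ht)]).
  - eapply Rle_trans; [|apply re_le_Cmod]. apply Req_le; f_equal; unfold Re, Im; simpl; ring.
  - eapply Rle_trans; [|apply im_le_Cmod]. apply Req_le; f_equal; unfold Re, Im; simpl; ring.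
Qed.

(** With [c] equal to [cos] and [sin] these are the two coordinates of a constant plus
    [exp (s + i t)]. *)
Lemma differentiable_pt_lim_exp_mult (c dc : R -> R) (k x y : R) :
  (forall t, is_derive c t (dc t)) ->
  differentiable_pt_lim (fun s t => k + exp s * c t) x y (exp x * c y) (exp x * dc y).
Proof.
  intros Hc. apply filterdiff_differentiable_pt_lim.
  apply (is_derive_filterdiff (fun s t => k + exp s * c t) x y (fun s t => exp s * c t)).
  - apply filter_forall. intros [s t]; simpl. auto_derive; auto; ring.
  - specialize (Hc y). auto_derive; [exists (dc y); exact Hc|].
    replace (Derive (fun t => c t) y) with (dc y) by (symmetry; apply is_derive_unique, Hc); ring.
  - apply (continuous_mult (K := R_AbsRing) (fun u : R * R => exp (fst u)) (fun u : R * R => c (snd u))).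
    + apply (continuous_comp (fun u : R * R => fst u) exp); [apply continuous_fst|].
      apply (ex_derive_continuous (K := R_AbsRing) (V := R_NormedModule)).
      exists (exp x); apply is_derive_exp.
    + apply (continuous_comp (fun u : R * R => snd u) c); [apply continuous_snd|].
      apply (ex_derive_continuous (K := R_AbsRing) (V := R_NormedModule)).
      exists (dc y); apply Hc.
Qed.

Definition polar (r t : R) : C := (r * cos t, r * sin t).

Lemma Cmod_polar (r t : R) : 0 <= r -> Cmod (polar r t) = r.
Proof.
  intros Hr. apply Rsqr_inj; auto; [apply Cmod_ge_0|].
  unfold Rsqr; rewrite Cmod_sqr; unfold polar; simpl.
  generalize (sin2_cos2 t); unfold Rsqr; nra.
Qed.

Lemma continuous_polar (r t : R) : continuous (polar r) t.
Proof.
  apply continuous_Re_Im; split;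
    apply (ex_derive_continuous (K := R_AbsRing) (V := R_NormedModule)); simpl; auto_derive; auto.
Qed.

(* In the coordinates [z0 + exp (x + i y)] the punctured disc becomes a half
   plane, on which Green's identity shows that the mean over [y] does not depend on [x];
   only continuity is needed at the centre. *)
Lemma mean_value_circle (g : C -> C) (z0 : C) (rho r : R) :
  0 < r < rho -> continuous g z0 ->
  (forall w, 0 < Cmod (w - z0) < rho -> cdiff g w) ->
  RInt (fun t => Re (g (z0 + polar r t)%C)) 0 (2 * PI) = 2 * PI * Re (g z0).
Proof.
  intros Hr Hg Hd.
  pose proof PI_RGT_0 as HPI.
  set (q := fun x y : R => (Re z0 + exp x * cos y, Im z0 + exp x * sin y)).
  assert (forall x y, q x y = (z0 + polar (exp x) y)%C) as Eq.
  { intros x y; apply C_eq; reflexivity. }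
  set (U := fun x y => Re (g (q x y))). set (V := fun x y => Im (g (q x y))).
  assert (forall x y, Cmod (q x y - z0) = exp x) as Hq.
  { intros x y. rewrite Eq. replace (z0 + polar (exp x) y - z0)%C with (polar (exp x) y) by ring.
    apply Cmod_polar, Rlt_le, exp_pos. }
  assert (forall x y, x <= ln r -> exists A B C,
     differentiable_pt_lim U x y A B /\ differentiable_pt_lim V x y C A) as HUV.
  { intros x y Hx.
    assert (cdiff g (q x y)) as Hc.
    { apply Hd. rewrite Hq. split; [apply exp_pos|].
      apply Rle_lt_trans with r; [|lra]. rewrite <- (exp_ln r) by lra.
      destruct Hx as [Hx| ->]; [apply Rlt_le, exp_increasing; auto|lra]. }
    apply cdiff_cauchy_riemann in Hc. destruct Hc as (A & B & H1 & H2).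
    pose proof (differentiable_pt_lim_exp_mult cos (fun t => - sin t) (Re z0) x y
      (fun t => is_derive_cos t)) as E1.
    pose proof (differentiable_pt_lim_exp_mult sin cos (Im z0) x y
      (fun t => is_derive_sin t)) as E2.
    pose proof (differentiable_pt_lim_comp _ _ _ _ _ _ _ _ _ _ _ H1 E1 E2) as D1.
    pose proof (differentiable_pt_lim_comp _ _ _ _ _ _ _ _ _ _ _ H2 E1 E2) as D2.
    cbv beta in D1, D2.
    replace (B * (exp x * - sin y) + A * (exp x * cos y))
      with (A * (exp x * cos y) + - B * (exp x * sin y)) in D2 by ring.
    eexists; eexists; eexists; split; [exact D1|exact D2]. }
  assert (forall x y, x <= ln r -> continuous (U x) y) as CU.
  { intros x y Hx; destruct (HUV x y Hx) as (A & B & C & H & _).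
    eapply differentiable_continuous_slice; eauto. }
  assert (forall x, x < ln r -> RInt (fun y => U (ln r) y - U x y) 0 (2 * PI) = 0) as HG.
  { intros x Hx.
    pose proof (green_rectangle U V x 0 (ln r - x) (2 * PI) ltac:(lra) ltac:(lra)) as G.
    replace (x + (ln r - x)) with (ln r) in G by ring. rewrite Rplus_0_l in G.
    rewrite (G HUV).
    (* The other side of Green's identity compares [V] at heights 0 and [2 * PI], where [q] takes
       the same value. *)
    rewrite RInt_ext with (g := fun _ => 0).
    - rewrite (RInt_const (V := R_CompleteNormedModule)); unfold scal; simpl; unfold mult; simpl; ring.
    - intros s _. unfold V, q. rewrite cos_2PI, sin_2PI, cos_0, sin_0.
      apply Rminus_diag_eq; reflexivity. }
  assert (forall x, x <= ln r -> ex_RInt (U x) 0 (2 * PI)) as XU.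
  { intros x Hx; apply ex_RInt_cont; [lra|]; intros; apply CU; auto. }
  assert (RInt (U (ln r)) 0 (2 * PI) = 2 * PI * Re (g z0)) as E.
  { apply cond_eq. intros e He.
    assert (0 < e / (4 * PI)) as He' by (apply Rdiv_lt_0_compat; lra).
    destruct (proj1 (continuous_C_iff g z0) Hg _ He') as [d [Hd0 H]].
    (* Below [ln r], so that the mean is the same as on the given circle, and below [ln d], so that
       the circle of radius [exp x] lies where [g] is close to [g z0]. *)
    set (x := Rmin (ln r - 1) (ln d - 1)).
    assert (x < ln r) as Hx1 by (unfold x; generalize (Rmin_l (ln r - 1) (ln d - 1)); lra).
    assert (x < ln d) as Hx2 by (unfold x; generalize (Rmin_r (ln r - 1) (ln d - 1)); lra).
    pose proof (RInt_near_const (U x) 0 (2 * PI) (Re (g z0)) (e / (4 * PI)) ltac:(lra)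
      ltac:(intros; apply CU; lra)) as B.
    assert (RInt (U (ln r)) 0 (2 * PI) = RInt (U x) 0 (2 * PI)) as ->.
    { specialize (HG x Hx1).
      pose proof (RInt_minus (V := R_CompleteNormedModule) (U (ln r)) (U x) 0 (2 * PI)
        (XU _ (Rle_refl _)) (XU x ltac:(lra))) as S.
      change (RInt (fun y => U (ln r) y - U x y) 0 (2 * PI)
        = RInt (U (ln r)) 0 (2 * PI) - RInt (U x) 0 (2 * PI)) in S. lra. }
    rewrite Rminus_0_r, (Rmult_comm (Re (g z0))) in B.
    eapply Rle_lt_trans; [apply B|].
    - intros t _. unfold U. change (Rabs (Re (g (q x t) - g z0)%C) <= e / (4 * PI)).
      eapply Rle_trans; [apply re_le_Cmod|]. apply Rlt_le, H. rewrite Hq.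
      rewrite <- (exp_ln d) by auto. apply exp_increasing; auto.
    - replace (e / (4 * PI) * (2 * PI)) with (e / 2) by (field; lra). lra. }
  rewrite <- E. apply RInt_ext. intros t _. unfold U. rewrite Eq, exp_ln by lra. reflexivity.
Qed.

(** * The maximum principle *)


Lemma continuous_R_iff (Phi : C -> R) (z : C) :
  continuous Phi z ->
  forall e, 0 < e -> exists d, 0 < d /\ forall w, Cmod (w - z) < d -> Rabs (Phi w - Phi z) < e.
Proof.
  intros H e He. specialize (H (fun y => Rabs (y - Phi z) < e)).
  apply locally_C_iff, H. exists (mkposreal e He). intros y Hy; exact Hy.
Qed.

(** If no point is maximal, then near each point of the disc a single larger value beats all values
    by continuity. The best of four such witnesses serves the union of four squares, so bisection
    gives one witness for the whole disc, which is then maximal. *)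
Lemma disc_maximum (Phi : C -> R) (r : R) :
  0 < r -> (forall z, Cmod z <= r -> continuous Phi z) ->
  exists z0, Cmod z0 <= r /\ forall z, Cmod z <= r -> Phi z <= Phi z0.
Proof.
  intros Hr Hc. apply NNPP; intros HN.
  assert (forall z0, Cmod z0 <= r -> exists z, Cmod z <= r /\ Phi z0 < Phi z) as H.
  { intros z0 H0. apply NNPP; intros H1. apply HN. exists z0; split; auto.
    intros z Hz. apply Rnot_lt_le; intros H2. apply H1; exists z; auto. }
  assert (exists z1, Cmod z1 <= r /\ forall z, - r <= Re z <= - r + 1 * (2 * r) ->
    - r <= Im z <= - r + 1 * (2 * r) -> Cmod z <= r -> Phi z <= Phi z1) as (z1 & H1 & H2).
  { apply (bisection_principle (fun a b t => exists z1, Cmod z1 <= r /\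
      forall z, a <= Re z <= a + t * (2 * r) -> b <= Im z <= b + t * (2 * r) ->
        Cmod z <= r -> Phi z <= Phi z1) (- r) (- r) (2 * r) (2 * r)); try lra.
    - intros a b t Ht (z1 & A1 & B1) (z2 & A2 & B2) (z3 & A3 & B3) (z4 & A4 & B4).
      assert (forall u v, Cmod u <= r -> Cmod v <= r -> exists z, Cmod z <= r /\
        Phi u <= Phi z /\ Phi v <= Phi z) as Hm.
      { intros u v Hu Hv. destruct (Rle_dec (Phi u) (Phi v)); [exists v|exists u]; repeat split; lra. }
      destruct (Hm z1 z2 A1 A2) as (u & Du & U1 & U2).
      destruct (Hm z3 z4 A3 A4) as (v & Dv & V1 & V2).
      destruct (Hm u v Du Dv) as (w & Dw & W1 & W2).
      exists w; split; auto. intros z Hz1 Hz2 Hz.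
      destruct (Rle_dec (Re z) (a + t / 2 * (2 * r))), (Rle_dec (Im z) (b + t / 2 * (2 * r))).
      + specialize (B1 z ltac:(lra) ltac:(lra) Hz); lra.
      + specialize (B3 z ltac:(lra) ltac:(lra) Hz); lra.
      + specialize (B2 z ltac:(lra) ltac:(lra) Hz); lra.
      + specialize (B4 z ltac:(lra) ltac:(lra) Hz); lra.
    - intros x y _ _.
      assert (forall d a b t (z : C), 0 < t < d / (4 * r) -> a <= x <= a + t * (2 * r) ->
        b <= y <= b + t * (2 * r) -> a <= Re z <= a + t * (2 * r) ->
        b <= Im z <= b + t * (2 * r) -> Cmod (z - (x, y)) < d) as Hsmall.
      { intros d a b t z Ht Ha Hb Hz1 Hz2. eapply Rle_lt_trans; [apply Cmod_le_Rabs|].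
        change (Rabs (Re z - x) + Rabs (Im z - y) < d).
        assert (Rabs (Re z - x) <= t * (2 * r)) by (apply Rabs_le; lra).
        assert (Rabs (Im z - y) <= t * (2 * r)) by (apply Rabs_le; lra).
        assert (t * (4 * r) < d); [|lra].
        apply Rmult_lt_reg_r with (/ (4 * r)); [apply Rinv_0_lt_compat; lra|].
        rewrite Rmult_assoc, Rinv_r by lra. unfold Rdiv in Ht; lra. }
      destruct (Rle_dec (Cmod (x, y)) r) as [L|L].
      + destruct (H _ L) as (z1 & D1 & L1).
        destruct (continuous_R_iff _ _ (Hc _ L) (Phi z1 - Phi (x, y)) ltac:(lra)) as (d & Hd & Hd').
        exists (d / (4 * r)); split; [apply Rdiv_lt_0_compat; lra|].
        intros a b t Ht Ha Hb. exists z1; split; auto. intros z Hz1 Hz2 _.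
        specialize (Hd' z (Hsmall d a b t z Ht Ha Hb Hz1 Hz2)).
        apply Rabs_lt_between in Hd'; lra.
      (* Small squares around a point outside the disc miss the disc, so any witness works there. *)
      + exists ((Cmod (x, y) - r) / (4 * r)); split; [apply Rdiv_lt_0_compat; lra|].
        intros a b t Ht Ha Hb. exists 0; split; [rewrite Cmod_0; lra|]. intros z Hz1 Hz2 Hz.
        pose proof (Hsmall _ a b t z Ht Ha Hb Hz1 Hz2) as Hs.
        pose proof (Cmod_triangle_sub (x, y) z) as T. rewrite Cmod_sub_sym in T. lra. }
  destruct (H z1 H1) as (z & Hz & L).
  pose proof (Cmod_re_bound z); pose proof (Cmod_im_bound z).
  specialize (H2 z ltac:(lra) ltac:(lra) Hz); lra.
Qed.

(* Isolated points where only continuity is known do no harm to the maximum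
   principle, so removable singularities never need to be removed. *)
Definition cdiff_near (g : C -> C) (z : C) : Prop :=
  exists rho, 0 < rho /\ forall w, 0 < Cmod (w - z) < rho -> cdiff g w.

(** Adding [e * |z|^2] makes the mean over a small circle exceed the value at the centre strictly,
    so a maximum of the sum cannot be interior; this avoids any connectedness argument. *)
Lemma max_principle_re (g : C -> C) (r M : R) :
  0 < r -> (forall z, Cmod z <= r -> continuous g z) ->
  (forall z, Cmod z < r -> cdiff_near g z) ->
  (forall z, Cmod z = r -> Re (g z) <= M) ->
  forall z, Cmod z <= r -> Re (g z) <= M.
Proof.
  intros Hr Hc Hd HM z1 Hz1. apply Rnot_lt_le; intros HL.
  (* Then [e * r^2] is half the excess at [z1], and the perturbed function stays below [Re (g z1)]
     on the boundary circle. *)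
  set (e := (Re (g z1) - M) / (2 * (r * r))).
  assert (0 < r * r) as Hrr by nra.
  assert (0 < e) as He by (apply Rdiv_lt_0_compat; lra).
  assert (e * (r * r) = (Re (g z1) - M) / 2) as Ee by (unfold e; field; lra).
  destruct (disc_maximum (fun z => Re (g z) + e * (Re z * Re z + Im z * Im z)) r Hr) as (z0 & D0 & H0).
  { intros z Hz. apply (continuous_plus (V := R_NormedModule) (fun z : C => Re (g z))
      (fun z : C => e * (Re z * Re z + Im z * Im z))).
    - apply (proj1 (continuous_Re_Im g z)); auto.
    - apply continuous_ext with (fun z : C => Re (e * (z * Cconj z))%C).
      { intros w; unfold Re, Im; simpl; ring. }
      refine (proj1 (proj1 (continuous_Re_Im _ z) _)).
      apply continuous_Cmult; [apply continuous_const|].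
      apply continuous_Cmult; [apply continuous_id|apply continuous_Cconj, continuous_id]. }
  pose proof (H0 z1 Hz1) as K1. cbv beta in K1.
  pose proof (Cmod_sqr z0) as S0. pose proof (Cmod_sqr z1) as S1.
  pose proof (Cmod_ge_0 z0) as G0. pose proof (Cmod_ge_0 z1) as G1.
  destruct (Req_dec (Cmod z0) r) as [E|NE].
  { specialize (HM z0 E). rewrite <- S0, <- S1, E in K1. nra. }
  destruct (Hd z0) as (rho & Hrho & Hdz); [lra|].
  set (s := Rmin (rho / 2) ((r - Cmod z0) / 2)).
  assert (0 < s) as Hs by (apply Rmin_glb_lt; lra).
  assert (s < rho) as Hs1 by (unfold s; generalize (Rmin_l (rho / 2) ((r - Cmod z0) / 2)); lra).
  assert (s + Cmod z0 < r) as Hs2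
    by (unfold s; generalize (Rmin_r (rho / 2) ((r - Cmod z0) / 2)); lra).
  pose proof (mean_value_circle g z0 rho s ltac:(lra) (Hc z0 D0) Hdz) as MV.
  pose proof PI_RGT_0 as HPI.
  assert (forall t, Cmod (z0 + polar s t) <= r) as Hin.
  { intros t. eapply Rle_trans; [apply Cmod_triangle|]. rewrite Cmod_polar; lra. }
  (* The bound for [Re g] on the circle that maximality at [z0] yields: [e * |z|^2] grows by
     [e * s^2] plus a trigonometric term of mean zero. *)
  set (B := fun t => Re (g z0) - e * (s * s) - 2 * e * s * (Re z0 * cos t + Im z0 * sin t)).
  assert (is_RInt B 0 (2 * PI) (2 * PI * (Re (g z0) - e * (s * s)))) as IB.
  { set (F := fun t => (Re (g z0) - e * (s * s)) * t - 2 * e * s * (Re z0 * sin t - Im z0 * cos t)).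
    replace (2 * PI * (Re (g z0) - e * (s * s))) with (minus (F (2 * PI)) (F 0)).
    2: { unfold F, minus, plus, opp; simpl. rewrite cos_2PI, sin_2PI, cos_0, sin_0. ring. }
    apply (is_RInt_derive (V := R_CompleteNormedModule) F B).
    - intros t _. unfold F, B. auto_derive; auto; ring.
    - intros t _. apply (ex_derive_continuous (K := R_AbsRing) (V := R_NormedModule)).
      unfold B; auto_derive; auto. }
  assert (RInt (fun t => Re (g (z0 + polar s t)%C)) 0 (2 * PI) <= RInt B 0 (2 * PI)) as L.
  { apply RInt_le; [lra| |eexists; exact IB|].
    - apply ex_RInt_cont; [lra|]. intros t _.
      refine (proj1 (proj1 (continuous_Re_Im (fun t => g (z0 + polar s t)%C) t) _)).
      apply (continuous_comp (fun t => (z0 + polar s t)%C) g); [|apply Hc, Hin].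
      apply continuous_Cplus; [apply continuous_const|apply continuous_polar].
    - intros t _. specialize (H0 (z0 + polar s t)%C (Hin t)). cbv beta in H0.
      unfold B. unfold polar in *. rewrite !re_plus, !im_plus in H0. simpl in H0.
      pose proof (sin2_cos2 t) as SC; unfold Rsqr in SC.
      change (fst z0) with (Re z0) in *; change (snd z0) with (Im z0) in *.
      assert (e * (s * s) = e * (s * s) * (sin t * sin t + cos t * cos t)) by (rewrite SC; ring).
      lra. }
  rewrite MV, (is_RInt_unique _ _ _ _ IB) in L.
  assert (0 < e * (s * s)) by (apply Rmult_lt_0_compat; nra). nra.
Qed.

(** A unimodular factor [c] turns the value at the point in question into its modulus; the version
    for real parts then applies to [c * g]. *)
Lemma max_principle (g : C -> C) (r M : R) :
  0 < r -> (forall z, Cmod z <= r -> continuous g z) ->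
  (forall z, Cmod z < r -> cdiff_near g z) ->
  (forall z, Cmod z = r -> Cmod (g z) <= M) ->
  forall z, Cmod z <= r -> Cmod (g z) <= M.
Proof.
  intros Hr Hc Hd HM z Hz.
  assert (0 <= M) as HM0.
  { eapply Rle_trans; [|apply (HM (RtoC r))]; [apply Cmod_ge_0|].
    rewrite Cmod_R; apply Rabs_pos_eq; lra. }
  destruct (Ceq_dec (g z) 0) as [E|NE]; [rewrite E, Cmod_0; auto|].
  pose proof (proj1 (Cmod_gt_0 _) NE) as Hp.
  set (c := (Cconj (g z) / Cmod (g z))%C).
  assert (RtoC (Cmod (g z)) <> 0) as NE'.
  { intros E; apply RtoC_inj in E; lra. }
  assert (Cmod c = 1) as Ec.
  { unfold c. rewrite Cmod_div, Cmod_conj, Cmod_R, Rabs_pos_eq by (auto; lra). field; lra. }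
  assert (Re (c * g z)%C = Cmod (g z)) as <-.
  { replace (c * g z)%C with (RtoC (Cmod (g z))); [reflexivity|].
    unfold c. replace (Cconj (g z) / Cmod (g z) * g z)%C with ((g z * Cconj (g z)) / Cmod (g z))%C
      by (field; auto).
    rewrite <- Cmod2_conj. simpl. rewrite !RtoC_mult. field; auto. }
  apply (max_principle_re (fun w => c * g w)%C r M); auto.
  - intros w Hw. apply continuous_Cmult; [apply continuous_const|auto].
  - intros w Hw. destruct (Hd w Hw) as (rho & H1 & H2). exists rho; split; auto.
    intros v Hv. apply cdiff_mult; [apply cdiff_const|auto].
  - intros w Hw. eapply Rle_trans; [apply Cmod_re_bound|]. rewrite Cmod_mult, Ec, Rmult_1_l. auto.
Qed.

(** * Divided differences *)


(** Two exceptional points suffice below: base points of divided differences, or one base point and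
    the point where [g] is merely continuous. *)
Lemma cdiff_near_punctured (g : C -> C) (a b z : C) :
  (forall w, Cmod w < 1 -> w <> a -> w <> b -> cdiff g w) -> Cmod z < 1 -> cdiff_near g z.
Proof.
  intros H Hz.
  assert (forall c, exists r, 0 < r /\ forall w, 0 < Cmod (w - z) < r -> w <> c) as Hc.
  { intros c. destruct (Ceq_dec c z) as [->|N].
    - exists 1; split; [lra|]. intros w Hw ->.
      replace (z - z)%C with (RtoC 0) in Hw by ring. rewrite Cmod_0 in Hw; lra.
    - exists (Cmod (c - z)); split; [apply Cmod_pos_sub; auto|]. intros w Hw ->; lra. }
  destruct (Hc a) as (r1 & P1 & Q1), (Hc b) as (r2 & P2 & Q2).
  exists (Rmin (1 - Cmod z) (Rmin r1 r2)); split.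
  - repeat apply Rmin_glb_lt; auto; lra.
  - intros w Hw.
    pose proof (Rmin_l (1 - Cmod z) (Rmin r1 r2)); pose proof (Rmin_r (1 - Cmod z) (Rmin r1 r2)).
    pose proof (Rmin_l r1 r2); pose proof (Rmin_r r1 r2).
    apply H; [|apply Q1; lra|apply Q2; lra].
    pose proof (Cmod_triangle_sub w z); lra.
Qed.

(* [slope h b w] is the divided difference of [h] at [b] and [w], and the derivative when [w = b]. *)
Definition slope (h : C -> C) (b : C) : C -> C :=
  epsilon (inhabits (fun w : C => w))
    (fun phi => continuous phi b /\ forall w, h w = (h b + phi w * (w - b))%C).

Lemma slope_spec (h : C -> C) (b : C) : cdiff h b ->
  continuous (slope h b) b /\ forall w, h w = (h b + slope h b w * (w - b))%C.
Proof. intros H. unfold slope. apply epsilon_spec; auto. Qed.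

Lemma slope_eq (h : C -> C) (b w : C) :
  cdiff h b -> w <> b -> slope h b w = ((h w - h b) / (w - b))%C.
Proof.
  intros H N. destruct (slope_spec h b H) as [_ E]. rewrite (E w).
  field. apply Csub_neq_0; auto.
Qed.

Lemma slope_sym (h : C -> C) (b w : C) :
  cdiff h b -> cdiff h w -> slope h b w = slope h w b.
Proof.
  intros Hb Hw. destruct (Ceq_dec w b) as [->|N]; auto.
  rewrite !slope_eq by auto. field; split; apply Csub_neq_0; auto.
Qed.

Lemma slope_cdiff (h : C -> C) (b w : C) :
  cdiff h b -> cdiff h w -> w <> b -> cdiff (slope h b) w.
Proof.
  intros Hb Hw N.
  apply cdiff_local with (fun v => (h v - h b) / (v - b))%C.
  - apply locally_C_iff. exists (Cmod (w - b)); split; [apply Cmod_pos_sub; auto|].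
    intros v Hv. rewrite slope_eq; auto. intros ->. rewrite Cmod_sub_sym in Hv; lra.
  - apply cdiff_div; [|apply cdiff_minus; [apply cdiff_id|apply cdiff_const]|apply Csub_neq_0; auto].
    apply cdiff_minus; [auto|apply cdiff_const].
Qed.

Lemma slope_continuous (h : C -> C) (b w : C) :
  cdiff h b -> cdiff h w -> continuous (slope h b) w.
Proof.
  intros Hb Hw. destruct (Ceq_dec w b) as [->|N].
  - apply slope_spec; auto.
  - apply cdiff_continuous, slope_cdiff; auto.
Qed.

(** The maximum principle moves both bounds to the circle of radius [r], where denominators are at
    least [d = r - s]. For the second one, symmetry of divided differences turns the change of
    argument into a change of base point, and on the circle the difference is an explicit multiple
    of [a - b]. This gives Lipschitz bounds for [h] and for its derivative [slope h b b]. *)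
Lemma slope_bounds (h : C -> C) (s : R) :
  (forall z, Cmod z < 1 -> cdiff h z) -> 0 <= s < 1 ->
  exists K, 0 <= K /\ forall a b, Cmod a <= s -> Cmod b <= s ->
    Cmod (slope h b a) <= K /\ Cmod (slope h b a - slope h b b) <= K * Cmod (a - b).
Proof.
  intros Hh Hs.
  set (r := (1 + s) / 2). set (d := r - s).
  assert (0 < r < 1) as Hr by (unfold r; lra).
  assert (s < r) as Hsr by (unfold r; lra).
  assert (0 < d) as Hd by (unfold d; lra).
  destruct (disc_maximum (fun z => Cmod (h z)) r ltac:(lra)) as (z0 & _ & HM).
  { intros z Hz. apply continuous_Cmod, cdiff_continuous, Hh; lra. }
  set (M := Cmod (h z0)) in HM.
  assert (0 <= M) as M0 by apply Cmod_ge_0.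
  assert (forall z b, Cmod z = r -> Cmod b <= s -> d <= Cmod (z - b) /\ z <> b) as Hfar.
  { intros z b Hz Hb. pose proof (Cmod_triangle_sub z b). unfold d.
    split; [lra|]. intros ->; lra. }
  assert (forall a b, Cmod a <= r -> Cmod b <= s -> Cmod (slope h b a) <= 2 * M / d) as B1.
  { intros a b Ha Hb.
    apply (max_principle (slope h b) r); auto; try lra.
    - intros z Hz; apply slope_continuous; apply Hh; lra.
    - intros z Hz; apply (cdiff_near_punctured _ b b); [|lra].
      intros w Hw N _. apply slope_cdiff; auto. apply Hh; lra.
    - intros z Hz. destruct (Hfar z b Hz Hb) as [F N].
      rewrite slope_eq, Cmod_div by (auto; try apply Csub_neq_0; auto; apply Hh; lra).
      apply Rle_trans with (2 * M / Cmod (z - b)).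
      + apply Rmult_le_compat_r; [apply Rlt_le, Rinv_0_lt_compat; lra|].
        eapply Rle_trans; [apply Cmod_minus_le|].
        pose proof (HM z ltac:(lra)); pose proof (HM b ltac:(unfold r; lra)); lra.
      + apply Rmult_le_compat_l; [lra|]. apply Rinv_le_contravar; lra. }
  (* The first summand bounds the divided difference; the second bounds
     [(2 * M + 2 * M / d * y) / (x * y)] for [x, y >= d]. *)
  set (K := 2 * M / d + 4 * M / (d * d)).
  assert (0 <= 2 * M / d) as K1 by (apply Rdiv_le_0_compat; lra).
  assert (0 <= 4 * M / (d * d)) as K2 by (apply Rdiv_le_0_compat; nra).
  exists K; split; [unfold K; lra|]. intros a b Ha Hb.
  assert (cdiff h a) as Ca by (apply Hh; lra). assert (cdiff h b) as Cb by (apply Hh; lra).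
  split; [apply Rle_trans with (2 * M / d); [apply B1; unfold r; lra|unfold K; lra]|].
  rewrite (slope_sym h b a) by auto.
  apply Rle_trans with (4 * M / (d * d) * Cmod (a - b)).
  2:{ apply Rmult_le_compat_r; [apply Cmod_ge_0|unfold K; lra]. }
  apply (max_principle (fun z => slope h a z - slope h b z)%C r); try lra.
  - intros z Hz; apply continuous_Cminus; apply slope_continuous; auto; apply Hh; lra.
  - intros z Hz; apply (cdiff_near_punctured _ a b); [|lra].
    intros w Hw N N'. apply cdiff_minus; apply slope_cdiff; auto.
  - intros z Hz. destruct (Hfar z b Hz Hb) as [F N]. destruct (Hfar z a Hz Ha) as [F' N'].
    assert (h a = h b + slope h b a * (a - b))%C as E by apply (slope_spec h b Cb).
    assert (slope h a z - slope h b z =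
      ((h z - h b) - slope h b a * (z - b)) * (a - b) / ((z - a) * (z - b)))%C as ->.
    { rewrite !slope_eq with (w := z) by auto. rewrite E.
      field; split; apply Csub_neq_0; auto. }
    rewrite Cmod_div, !Cmod_mult by (apply Cmult_neq_0; apply Csub_neq_0; auto).
    assert (Cmod (h z - h b - slope h b a * (z - b)) <= 2 * M + 2 * M / d * Cmod (z - b)) as X.
    { eapply Rle_trans; [apply Cmod_minus_le|]. apply Rplus_le_compat.
      - eapply Rle_trans; [apply Cmod_minus_le|].
        pose proof (HM z ltac:(lra)); pose proof (HM b ltac:(unfold r; lra)); lra.
      - rewrite Cmod_mult. apply Rmult_le_compat_r; [apply Cmod_ge_0|].
        apply B1; unfold r; lra. }
    set (y := Cmod (z - b)) in *. set (x := Cmod (z - a)) in *.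
    set (c := Cmod (a - b)) in *. assert (0 <= c) as C0 by apply Cmod_ge_0.
    assert (0 < x * y) as XY by nra.
    apply Rle_trans with ((2 * M + 2 * M / d * y) * c / (x * y)).
    { apply Rmult_le_compat_r; [apply Rlt_le, Rinv_0_lt_compat; auto|].
      apply Rmult_le_compat_r; auto. }
    assert (2 * M + 2 * M / d * y <= 4 * M / (d * d) * (x * y)) as Y.
    { replace (2 * M + 2 * M / d * y) with (M / (d * d) * (2 * (d * d) + 2 * (d * y)))
        by (field; lra).
      replace (4 * M / (d * d) * (x * y)) with (M / (d * d) * (4 * (x * y))) by (field; lra).
      apply Rmult_le_compat_l; [apply Rdiv_le_0_compat; nra|]. nra. }
    apply Rmult_le_reg_r with (x * y); auto.
    replace ((2 * M + 2 * M / d * y) * c / (x * y) * (x * y)) with ((2 * M + 2 * M / d * y) * c)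
      by (field; split; lra).
    nra.
Qed.

(** * Schwarz, Schwarz-Pick and Julia *)


Lemma continuous_le_left (f : R -> R) (a b y : R) :
  a < b -> continuous f b -> (forall r, a < r < b -> f r <= y) -> f b <= y.
Proof.
  intros Ha Hf H. apply Rnot_lt_le; intros L.
  assert (0 < f b - y) as He by lra.
  destruct (proj1 (filterlim_locally f (f b)) Hf (mkposreal _ He)) as [d Hd].
  set (r := Rmax ((a + b) / 2) (b - d / 2)). pose proof (cond_pos d).
  assert (a < r < b) as Hr.
  { unfold r; split; [eapply Rlt_le_trans; [|apply Rmax_l]; lra|apply Rmax_lub_lt; lra]. }
  pose proof (Rmax_r ((a + b) / 2) (b - d / 2)) as Hr'; fold r in Hr'.
  assert (Rabs (r - b) < d) as Hrd by (apply Rabs_def1; lra).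
  specialize (Hd r Hrd). change (Rabs (f r - f b) < f b - y) in Hd.
  apply Rabs_lt_between in Hd. specialize (H r Hr). lra.
Qed.

Lemma schwarz_lemma (g : C -> C) :
  (forall z, Cmod z < 1 -> cdiff g z) -> (forall z, Cmod z < 1 -> Cmod (g z) <= 1) ->
  g 0 = 0 -> forall z, Cmod z < 1 -> Cmod (g z) <= Cmod z.
Proof.
  intros Hg H1 H0 z Hz.
  assert (Cmod 0 < 1) as Z0 by (rewrite Cmod_0; lra).
  destruct (slope_spec g 0 (Hg _ Z0)) as [_ E].
  enough (Cmod (slope g 0 z) <= 1) as K.
  { rewrite (E z), H0. replace (0 + slope g 0 z * (z - 0))%C with (slope g 0 z * z)%C by ring.
    rewrite Cmod_mult. pose proof (Cmod_ge_0 z). nra. }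
  (* On the circle of radius [r] the bound is [1 / r]; in product form it passes to the limit
     [r = 1] by continuity. *)
  assert (1 * Cmod (slope g 0 z) <= 1) as K; [|lra].
  apply (continuous_le_left (fun r => r * Cmod (slope g 0 z)) (Cmod z)); auto.
  { apply (ex_derive_continuous (K := R_AbsRing) (V := R_NormedModule)). auto_derive; auto. }
  intros r Hr. pose proof (Cmod_ge_0 z).
  apply Rmult_le_reg_l with (/ r); [apply Rinv_0_lt_compat; lra|].
  rewrite <- Rmult_assoc, Rinv_l, Rmult_1_l, Rmult_1_r by lra.
  apply (max_principle (slope g 0) r); try lra.
  - intros w Hw; apply slope_continuous; apply Hg; auto; lra.
  - intros w Hw; apply (cdiff_near_punctured _ 0 0); [|lra].
    intros v Hv N _. apply slope_cdiff; auto.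
  - intros w Hw.
    assert (w <> 0) as N by (intros ->; rewrite Cmod_0 in Hw; lra).
    rewrite slope_eq, H0 by auto. replace (g w - 0)%C with (g w) by ring.
    replace (w - 0)%C with w by ring. rewrite Cmod_div, Hw by auto.
    assert (Cmod (g w) <= 1) by (apply H1; lra).
    pose proof (Rinv_0_lt_compat r ltac:(lra)). unfold Rdiv; nra.
Qed.

Lemma moebius_identity (z w : C) :
  Cmod (1 - Cconj w * z) * Cmod (1 - Cconj w * z) - Cmod (z - w) * Cmod (z - w)
  = (1 - Cmod z * Cmod z) * (1 - Cmod w * Cmod w).
Proof. rewrite !Cmod_sqr. destruct z, w; unfold Re, Im; simpl; ring. Qed.

Lemma half_plane_identity (p q : C) :
  Cmod (p + Cconj q) * Cmod (p + Cconj q) - Cmod (p - q) * Cmod (p - q) = 4 * Re p * Re q.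
Proof. rewrite !Cmod_sqr. destruct p, q; unfold Re, Im; simpl; ring. Qed.

Lemma moebius_denominator_pos (z w : C) :
  Cmod z < 1 -> Cmod w < 1 -> Cmod (z - w) < Cmod (1 - Cconj w * z).
Proof.
  intros Hz Hw. pose proof (moebius_identity z w) as E.
  pose proof (Cmod_ge_0 z); pose proof (Cmod_ge_0 w).
  pose proof (Cmod_ge_0 (z - w)); pose proof (Cmod_ge_0 (1 - Cconj w * z)).
  assert (0 < (1 - Cmod z * Cmod z) * (1 - Cmod w * Cmod w)) by (apply Rmult_lt_0_compat; nra).
  nra.
Qed.

(** The function [k] is the Cayley transform [(g - g w) / (g + conj (g w))] divided by the Möbius
    factor with zero [w], and the claim is [|k| <= 1]. Strict positivity keeps the denominator [D]
    away from 0, and [w <> a] makes the divided difference at [w] available. *)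
Lemma schwarz_pick_strict (g : C -> C) (a z w : C) :
  (forall z, Cmod z < 1 -> continuous g z) ->
  (forall z, Cmod z < 1 -> z <> a -> cdiff g z) ->
  (forall z, Cmod z < 1 -> 0 < Re (g z)) ->
  Cmod z < 1 -> Cmod w < 1 -> w <> a ->
  Cmod (g z - g w) * Cmod (1 - Cconj w * z) <= Cmod (z - w) * Cmod (g z + Cconj (g w)).
Proof.
  intros Hc Hd Hp Hz Hw Na.
  set (D := fun v => (g v + Cconj (g w))%C).
  assert (forall v, Cmod v < 1 -> D v <> 0) as HD.
  { intros v Hv E. pose proof (Hp v Hv); pose proof (Hp w Hw).
    assert (Re (D v) = Re (g v) + Re (g w)) as E' by (unfold D; rewrite re_plus; reflexivity).
    rewrite E in E'; simpl in E'; lra. }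
  pose proof (Hd w Hw Na) as Cw.
  destruct (slope_spec g w Cw) as [Sc Se].
  assert (forall v, Cmod v < 1 -> continuous (slope g w) v) as Sc'.
  { intros v Hv. destruct (Ceq_dec v w) as [->|N]; auto.
    apply continuous_ext_loc with (fun u => (g u - g w) / (u - w))%C.
    - apply locally_C_iff. exists (Cmod (v - w)); split; [apply Cmod_pos_sub; auto|].
      intros u Hu. rewrite slope_eq; auto. intros ->. rewrite Cmod_sub_sym in Hu; lra.
    - apply continuous_Cdiv; [| |apply Csub_neq_0; auto]; apply continuous_Cminus;
        auto using continuous_const, continuous_id. }
  set (k := fun v => (slope g w v * (1 - Cconj w * v) / D v)%C).
  assert (forall v, Cmod v < 1 -> D v <> 0 ->
    Cmod (g v - g w) * Cmod (1 - Cconj w * v) = Cmod (k v) * (Cmod (v - w) * Cmod (D v))) as Ek.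
  { intros v Hv Dv. rewrite <- !Cmod_mult. f_equal. rewrite (Se v). unfold k. field; auto. }
  assert (forall v, Cmod v < 1 -> continuous D v) as CD.
  { intros v Hv; apply continuous_Cplus; auto using continuous_const. }
  assert (Cmod (k z) <= 1) as K.
  2:{ rewrite Ek; auto. fold (D z). pose proof (Cmod_ge_0 (z - w)); pose proof (Cmod_ge_0 (D z)).
      assert (0 <= Cmod (z - w) * Cmod (D z)) by nra. nra. }
  set (o := Cmod w) in *.
  (* On [|v| = r] the Cayley transform has modulus at most 1, and by [moebius_identity] and
     [|v - w| >= r - o] the inverse square of the Möbius factor exceeds 1 by at most this fraction,
     which vanishes as [r] tends to 1. *)
  assert (forall r, 0 < r < 1 -> o < r -> Cmod z < r -> Cmod (k z) <= 1 + (1 - r * r) / ((r - o) * (r - o)))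
    as Kr.
  { intros r Hr Ho Hzr.
    apply (max_principle k r); try lra.
    - intros v Hv. apply continuous_Cdiv; [|apply CD; lra|apply HD; lra].
      apply continuous_Cmult; [apply Sc'; lra|].
      apply continuous_Cminus; [apply continuous_const|].
      apply continuous_Cmult; [apply continuous_const|apply continuous_id].
    - intros v Hv. apply (cdiff_near_punctured _ a w); [|lra].
      intros u Hu N1 N2. apply cdiff_div; [| |apply HD; auto].
      + apply cdiff_mult; [apply slope_cdiff; auto|].
        apply cdiff_minus; [apply cdiff_const|].
        apply cdiff_mult; [apply cdiff_const|apply cdiff_id].
      + apply cdiff_plus; [auto|apply cdiff_const].
    - intros v Hv. assert (Cmod v < 1) as Hv1 by lra.
      pose proof (Ek v Hv1 (HD v Hv1)) as E.
      pose proof (half_plane_identity (g v) (g w)) as I1; fold (D v) in I1.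
      pose proof (moebius_identity v w) as I2; fold o in I2; rewrite Hv in I2.
      pose proof (Hp v Hv1); pose proof (Hp w Hw).
      assert (0 < 4 * Re (g v) * Re (g w)) by (apply Rmult_lt_0_compat; lra).
      pose proof (Cmod_triangle_sub v w) as T; fold o in T; rewrite Hv in T.
      assert (0 <= o) by apply Cmod_ge_0.
      pose proof (Cmod_ge_0 (g v - g w)). pose proof (Cmod_ge_0 (1 - Cconj w * v)).
      pose proof (proj1 (Cmod_gt_0 _) (HD v Hv1)) as DP.
      assert (Cmod (g v - g w) <= Cmod (D v)) as L by nra.
      pose proof (Cmod_ge_0 (k v)).
      set (X := Cmod (1 - Cconj w * v)) in *. set (Y := Cmod (v - w)) in *.
      assert (Cmod (k v) * Y <= X) as L1.
      { apply Rmult_le_reg_r with (Cmod (D v)); auto.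
        rewrite Rmult_assoc, <- E. nra. }
      assert (0 < Y) as YP by lra.
      assert (0 <= Cmod (k v) * Y) as KY by (apply Rmult_le_pos; lra).
      assert ((Cmod (k v) * Y) * (Cmod (k v) * Y) <= X * X) as L2
        by (apply Rmult_le_compat; auto).
      set (e := (1 - r * r) / ((r - o) * (r - o))).
      assert (0 < (r - o) * (r - o)) as RO by nra.
      assert (e * ((r - o) * (r - o)) = 1 - r * r) as Ee by (unfold e; field; lra).
      assert (0 <= e) as E0 by (apply Rdiv_le_0_compat; nra).
      assert (X * X <= (1 + e) * (Y * Y)) as L3.
      { assert (e * ((r - o) * (r - o)) <= e * (Y * Y))
          by (apply Rmult_le_compat_l; auto; apply Rmult_le_compat; lra).
        assert (0 <= (1 - r * r) * (o * o)) by (apply Rmult_le_pos; nra). lra. }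
      assert (Cmod (k v) * Cmod (k v) <= 1 + e) as L4.
      { apply Rmult_le_reg_r with (Y * Y); nra. }
      nra. }
  assert (- (1 + (1 - 1 * 1) / ((1 - o) * (1 - o))) <= - Cmod (k z)) as F.
  { pose proof (Cmod_ge_0 z).
    apply (continuous_le_left (fun r => - (1 + (1 - r * r) / ((r - o) * (r - o)))) (Rmax o (Cmod z))).
    - apply Rmax_lub_lt; auto.
    - apply (ex_derive_continuous (K := R_AbsRing) (V := R_NormedModule)). auto_derive. nra.
    - intros r [Hr1 Hr2].
      pose proof (Rmax_l o (Cmod z)); pose proof (Rmax_r o (Cmod z)).
      apply Ropp_le_contravar, Kr; lra. }
  replace ((1 - 1 * 1) / ((1 - o) * (1 - o))) with 0 in F by (field; lra). lra.
Qed.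

Lemma le_of_le_add_eps (x y c : R) : (forall e, 0 < e -> x <= y + c * e) -> x <= y.
Proof.
  intros H. apply Rnot_lt_le; intros L.
  pose proof (Rabs_pos c) as P.
  assert (0 < (x - y) / (2 * (Rabs c + 1))) as He by (apply Rdiv_lt_0_compat; lra).
  specialize (H _ He). pose proof (Rle_abs c) as Q.
  set (e := (x - y) / (2 * (Rabs c + 1))) in *.
  assert (e * (2 * (Rabs c + 1)) = x - y) by (unfold e; field; lra). nra.
Qed.

(** Adding a small [e > 0] to [g] gives strict positivity, and the inequality is symmetric in [z]
    and [w], which settles [w = a]. *)
Lemma schwarz_pick (g : C -> C) (a z w : C) :
  (forall z, Cmod z < 1 -> continuous g z) ->
  (forall z, Cmod z < 1 -> z <> a -> cdiff g z) ->
  (forall z, Cmod z < 1 -> 0 <= Re (g z)) ->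
  Cmod z < 1 -> Cmod w < 1 ->
  Cmod (g z - g w) * Cmod (1 - Cconj w * z) <= Cmod (z - w) * Cmod (g z + Cconj (g w)).
Proof.
  intros Hc Hd Hp.
  assert (forall z w, Cmod z < 1 -> Cmod w < 1 -> w <> a ->
    Cmod (g z - g w) * Cmod (1 - Cconj w * z) <= Cmod (z - w) * Cmod (g z + Cconj (g w))) as H.
  { intros u v Hu Hv N. apply le_of_le_add_eps with (c := 2 * Cmod (u - v)). intros e He.
    pose proof (schwarz_pick_strict (fun t => g t + e)%C a u v) as S; cbv beta in S.
    assert ((g u + e - (g v + e))%C = (g u - g v)%C) as E1 by ring.
    assert ((g u + e + Cconj (g v + e))%C = (g u + Cconj (g v) + RtoC (2 * e))%C) as E2.
    { apply C_eq; unfold Re, Im; simpl; ring. }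
    rewrite E1, E2 in S.
    eapply Rle_trans; [apply S|]; auto.
    - intros t Ht; apply continuous_Cplus; auto using continuous_const.
    - intros t Ht Na; apply cdiff_plus; auto using cdiff_const.
    - intros t Ht; rewrite re_plus. specialize (Hp t Ht); simpl; lra.
    - replace (Cmod (u - v) * Cmod (g u + Cconj (g v)) + 2 * Cmod (u - v) * e)
        with (Cmod (u - v) * (Cmod (g u + Cconj (g v)) + 2 * e)) by ring.
      apply Rmult_le_compat_l; [apply Cmod_ge_0|].
      eapply Rle_trans; [apply Cmod_triangle|]. rewrite Cmod_R, Rabs_pos_eq; lra. }
  intros Hz Hw. destruct (Ceq_dec w a) as [->|N]; auto.
  destruct (Ceq_dec z a) as [->|N].
  - replace (g a - g a)%C with (RtoC 0) by ring. rewrite Cmod_0, Rmult_0_l.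
    apply Rmult_le_pos; apply Cmod_ge_0.
  - rewrite (Cmod_sub_sym z a), (Cmod_sub_sym (g z)).
    replace (Cmod (1 - Cconj a * z)) with (Cmod (1 - Cconj z * a)).
    2:{ rewrite <- Cmod_conj; f_equal. apply C_eq; unfold Re, Im; simpl; ring. }
    replace (Cmod (g z + Cconj (g a))) with (Cmod (g a + Cconj (g z))).
    2:{ rewrite <- Cmod_conj; f_equal. apply C_eq; unfold Re, Im; simpl; ring. }
    auto.
Qed.

Section PositiveRealPart.
Variables (g : C -> C) (a : C).
Hypothesis Hc : forall z, Cmod z < 1 -> continuous g z.
Hypothesis Hd : forall z, Cmod z < 1 -> z <> a -> cdiff g z.
Hypothesis Hp : forall z, Cmod z < 1 -> 0 <= Re (g z).

(** For [g w = 0] both sides of Schwarz-Pick carry the factor [|g z|], while the Möbius factor is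
    strictly less than 1. *)
Lemma re_nonneg_zero (z w : C) : Cmod z < 1 -> Cmod w < 1 -> g w = 0 -> g z = 0.
Proof.
  intros Hz Hw E. pose proof (schwarz_pick g a z w Hc Hd Hp Hz Hw) as S.
  pose proof (moebius_denominator_pos z w Hz Hw) as M.
  rewrite E in S. replace (g z - 0)%C with (g z) in S by ring.
  replace (g z + Cconj 0)%C with (g z) in S by (apply C_eq; unfold Re, Im; simpl; ring).
  apply Cmod_eq_0. pose proof (Cmod_ge_0 (g z)). nra.
Qed.

(** Schwarz-Pick against the origin gives [|g z| - |g 0| <= |z| * (|g z| + |g 0|)]. *)
Lemma re_nonneg_growth (z : C) : Cmod z < 1 -> Cmod (g z) * (1 - Cmod z) <= 2 * Cmod (g 0).
Proof.
  intros Hz.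
  assert (Cmod 0 < 1) as Z0 by (rewrite Cmod_0; lra).
  pose proof (schwarz_pick g a z 0 Hc Hd Hp Hz Z0) as S.
  replace (1 - Cconj 0 * z)%C with (RtoC 1) in S by (apply C_eq; unfold Re, Im; simpl; ring).
  replace (z - 0)%C with z in S by ring.
  rewrite Cmod_1, Rmult_1_r in S.
  pose proof (Cmod_triangle_sub (g z) (g 0)).
  pose proof (Cmod_triangle (g z) (Cconj (g 0))) as T. rewrite Cmod_conj in T.
  pose proof (Cmod_ge_0 z). pose proof (Cmod_ge_0 (g 0)). nra.
Qed.

(* Schwarz-Pick between [z] and [s * zeta], renormalised by [1 - s] as [s -> 1]. *)
Lemma julia_half_plane (zeta z : C) (L : R) :
  Cmod zeta = 1 -> 0 <= L ->
  (forall e, 0 < e -> exists d, 0 < d /\ forall s, 1 - d < s < 1 ->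
     Cmod ((1 - s) * g (s * zeta) - L)%C < e) ->
  Cmod z < 1 ->
  L * (1 - Cmod z * Cmod z) <= 2 * Re (g z) * (Cmod (zeta - z) * Cmod (zeta - z)).
Proof.
  intros Hzeta HL Hlim Hz.
  destruct HL as [HL| <-].
  2:{ rewrite Rmult_0_l. pose proof (Hp z Hz). pose proof (Cmod_ge_0 (zeta - z)).
      apply Rmult_le_pos; nra. }
  (* Putting the limit [L] in from [s = 1] on makes [m] continuous at 1, so the passage to the limit
     becomes an evaluation. *)
  set (m := fun s : R => if Rlt_dec s 1 then ((1 - s) * g (s * zeta))%C else RtoC L).
  assert (m 1 = L) as M1 by (unfold m; destruct (Rlt_dec 1 1); [lra|reflexivity]).
  assert (continuous m 1) as Cm.
  { unfold continuous. rewrite filterlim_C_iff by apply locally_filter.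
    intros e He. destruct (Hlim e He) as (d & Hd0 & H).
    exists (mkposreal d Hd0). intros s Hs. change (Rabs (s - 1) < d) in Hs.
    apply Rabs_lt_between in Hs. rewrite M1. unfold m. destruct (Rlt_dec s 1).
    - apply H; lra.
    - replace (RtoC L - RtoC L)%C with (RtoC 0) by ring. rewrite Cmod_0; auto. }
  assert (continuous (fun s : R => RtoC s) 1) as Cs.
  { apply continuous_Re_Im; split; [apply continuous_id|apply continuous_const]. }
  set (W := fun s : R => ((1 - s) * g z + Cconj (m s))%C).
  set (X := fun s : R => (1 - Cconj (s * zeta) * z)%C).
  (* For [s < 1] this is [1 - s] times the difference of the squared sides of Schwarz-Pick,
     rewritten by the two identities. At [s = 1] both terms contain the factor [2 * L], which is
     divided out; hence the separate case [L = 0]. *)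
  set (f := fun s : R => (1 - Cmod z * Cmod z) * (1 + s) * (Cmod (W s) * Cmod (W s))
    - 4 * Re (g z) * Re (m s) * (Cmod (X s) * Cmod (X s))).
  assert (f 1 <= 0) as F.
  { apply (continuous_le_left f 0 1); [lra| |].
    - assert (forall p q : R -> R, continuous p 1 -> continuous q 1 ->
        continuous (fun s => p s * q s) 1) as Mu.
      { intros p q P1 P2; exact (continuous_mult p q 1 P1 P2). }
      assert (continuous W 1) as CW.
      { apply continuous_Cplus; [apply continuous_Cmult|apply continuous_Cconj; auto].
        - apply continuous_Cminus; auto using continuous_const.
        - apply continuous_const. }
      assert (continuous X 1) as CX.
      { apply continuous_Cminus; [apply continuous_const|].
        apply continuous_Cmult; [|apply continuous_const].
        apply continuous_Cconj, continuous_Cmult; auto using continuous_const. }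
      apply continuous_Rminus.
      + apply (Mu (fun s => (1 - Cmod z * Cmod z) * (1 + s)) (fun s => Cmod (W s) * Cmod (W s))).
        * apply (ex_derive_continuous (K := R_AbsRing) (V := R_NormedModule)). auto_derive; auto.
        * apply Mu; apply continuous_Cmod; auto.
      + apply (Mu (fun s => 4 * Re (g z) * Re (m s)) (fun s => Cmod (X s) * Cmod (X s))).
        * apply (Mu (fun _ => 4 * Re (g z)) (fun s => Re (m s))); [apply continuous_const|].
          apply (proj1 (continuous_Re_Im m 1) Cm).
        * apply Mu; apply continuous_Cmod; auto.
    - intros s Hs.
      assert (Cmod (s * zeta)%C = s) as Hsz.
      { rewrite Cmod_mult, Hzeta, Cmod_R, Rabs_pos_eq; lra. }
      assert (Cmod (s * zeta)%C < 1) as Hsz' by lra.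
      pose proof (schwarz_pick g a z (s * zeta) Hc Hd Hp Hz Hsz') as S.
      pose proof (moebius_identity z (s * zeta)) as I2. fold (X s) in S, I2. rewrite Hsz in I2.
      pose proof (half_plane_identity (g z) (g (s * zeta)%C)) as I1.
      set (D := (g z + Cconj (g (s * zeta)))%C) in *.
      assert (W s = RtoC (1 - s) * D)%C as EW.
      { unfold W, D, m. destruct (Rlt_dec s 1); [|lra].
        apply C_eq; unfold Re, Im; simpl; ring. }
      assert (Re (m s) = (1 - s) * Re (g (s * zeta)%C)) as Em.
      { unfold m. destruct (Rlt_dec s 1); [|lra]. unfold Re, Im; simpl; ring. }
      unfold f. rewrite EW, Em, Cmod_mult, Cmod_R, Rabs_pos_eq by lra.
      set (x := Cmod (X s)) in *. set (n := Cmod (g z - g (s * zeta))) in *.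
      set (y := Cmod (z - s * zeta)) in *. set (dd := Cmod D) in *.
      assert (0 <= n) by apply Cmod_ge_0. assert (0 <= x) by apply Cmod_ge_0.
      assert (0 <= y) by apply Cmod_ge_0. assert (0 <= dd) by apply Cmod_ge_0.
      assert ((n * x) * (n * x) <= (y * dd) * (y * dd)) as Q.
      { assert (0 <= n * x) by (apply Rmult_le_pos; auto). nra. }
      set (b := Re (g (s * zeta)%C)) in *. set (c := Re (g z)) in *.
      set (Y := 1 - Cmod z * Cmod z) in *.
      assert (Y * (1 - s * s) * (dd * dd) <= 4 * c * b * (x * x)) as R1.
      { assert (n * n = dd * dd - 4 * c * b) as En by lra.
        assert (y * y = x * x - Y * (1 - s * s)) as Ey by lra.
        replace ((n * x) * (n * x)) with ((n * n) * (x * x)) in Q by ring.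
        replace ((y * dd) * (y * dd)) with ((y * y) * (dd * dd)) in Q by ring.
        rewrite En, Ey in Q. lra. }
      assert (0 <= 1 - s) as P by lra.
      apply (Rmult_le_compat_l _ _ _ P) in R1. lra. }
  unfold f, W, X in F. rewrite M1 in F.
  replace ((1 - 1) * g z + Cconj L)%C with (RtoC L) in F
    by (apply C_eq; unfold Re, Im; simpl; ring).
  rewrite Cmod_R, Rabs_pos_eq in F by lra. change (Re L) with L in F.
  assert (Cmod (1 - Cconj (1 * zeta) * z) * Cmod (1 - Cconj (1 * zeta) * z)
    = Cmod (zeta - z) * Cmod (zeta - z)) as EX.
  { pose proof (Cmod_sqr zeta) as Z. rewrite Hzeta in Z.
    rewrite !Cmod_sqr. destruct z as [x y], zeta as [p q]; unfold Re, Im in *; simpl in *.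
    replace (p * p) with (1 - q * q) by lra.
    assert ((p*p + q*q) * (x*x+y*y) = x * x + y * y) by (rewrite <- Z; ring). lra. }
  rewrite EX in F. set (V := Cmod (zeta - z) * Cmod (zeta - z)) in *.
  apply Rmult_le_reg_l with (2 * L); [lra|]. lra.
Qed.

End PositiveRealPart.

(** * Ordinary differential equations *)


Definition cderiv (u : R -> C) (t : R) (d : C) : Prop :=
  is_derive (fun s => Re (u s)) t (Re d) /\ is_derive (fun s => Im (u s)) t (Im d).

Lemma cderiv_continuous (u : R -> C) (t : R) (d : C) : cderiv u t d -> continuous u t.
Proof.
  intros [H1 H2]. apply continuous_Re_Im; split;
    apply (ex_derive_continuous (K := R_AbsRing) (V := R_NormedModule)); eexists; eauto.
Qed.

Lemma cderiv_minus (u v : R -> C) (t : R) (a b : C) :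
  cderiv u t a -> cderiv v t b -> cderiv (fun s => u s - v s)%C t (a - b)%C.
Proof.
  intros [H1 H2] [H3 H4]; split.
  - exact (is_derive_minus (K := R_AbsRing) (V := R_NormedModule) _ _ _ _ _ H1 H3).
  - exact (is_derive_minus (K := R_AbsRing) (V := R_NormedModule) _ _ _ _ _ H2 H4).
Qed.

Lemma cderiv_scal (c : C) (u : R -> C) (t : R) (a : C) :
  cderiv u t a -> cderiv (fun s => c * u s)%C t (c * a)%C.
Proof.
  intros [H1 H2].
  assert (forall k f d, is_derive f t d -> is_derive (fun s => k * f s) t (k * d)) as S.
  { intros k f d H. exact (is_derive_scal f t k d H). }
  split.
  - exact (is_derive_minus (K := R_AbsRing) (V := R_NormedModule) _ _ _ _ _
      (S (Re c) _ _ H1) (S (Im c) _ _ H2)).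
  - exact (is_derive_plus (K := R_AbsRing) (V := R_NormedModule) _ _ _ _ _
      (S (Re c) _ _ H2) (S (Im c) _ _ H1)).
Qed.

Lemma cderiv_shift (u : R -> C) (s t : R) (d : C) :
  cderiv u (s + t) d -> cderiv (fun r => u (s + r)) t d.
Proof.
  assert (forall (f : R -> R) l, is_derive f (s + t) l -> is_derive (fun r => f (s + r)) t l) as S.
  { intros f l H. replace l with (scal 1 l) by (unfold scal; simpl; unfold mult; simpl; ring).
    apply (is_derive_comp f (fun r => s + r)); auto. auto_derive; auto. }
  intros [H1 H2]; split; [exact (S (fun r => Re (u r)) _ H1)|exact (S (fun r => Im (u r)) _ H2)].
Qed.

Lemma nonincreasing_of_derive (phi dphi : R -> R) (t : R) :
  0 <= t -> (forall s, 0 <= s <= t -> is_derive phi s (dphi s)) ->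
  (forall s, 0 <= s <= t -> dphi s <= 0) -> phi t <= phi 0.
Proof.
  intros Ht Hd Hn.
  destruct (MVT_gen phi 0 t dphi) as (c & Hc & E).
  - rewrite Rmin_left, Rmax_right by auto. intros s Hs; apply Hd; lra.
  - rewrite Rmin_left, Rmax_right by auto. intros s Hs.
    apply continuity_pt_filterlim.
    apply (ex_derive_continuous (K := R_AbsRing) (V := R_NormedModule)). exists (dphi s); auto.
  - rewrite Rmin_left, Rmax_right in Hc by auto. specialize (Hn c Hc). nra.
Qed.

Lemma is_derive_Cmod_sqr (u : R -> C) (t : R) (d : C) :
  cderiv u t d -> is_derive (fun s => Cmod (u s) * Cmod (u s)) t (2 * Re (Cconj (u t) * d)%C).
Proof.
  intros [H1 H2].
  apply is_derive_ext with (fun s => Re (u s) * Re (u s) + Im (u s) * Im (u s)).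
  { intros s; symmetry; apply Cmod_sqr. }
  pose proof (is_derive_plus (K := R_AbsRing) (V := R_NormedModule) _ _ _ _ _
    (is_derive_mult (K := R_AbsRing) _ _ _ _ _ H1 H1 Rmult_comm)
    (is_derive_mult (K := R_AbsRing) _ _ _ _ _ H2 H2 Rmult_comm)) as H.
  replace (2 * Re (Cconj (u t) * d)%C) with
    (plus (plus (mult (Re d) (Re (u t))) (mult (Re (u t)) (Re d)))
      (plus (mult (Im d) (Im (u t))) (mult (Im (u t)) (Im d)))); [exact H|].
  unfold plus, mult; simpl. unfold Re, Im; simpl. ring.
Qed.

(** Squares are used because the modulus is not differentiable at 0; the extra 1 in [2 * K + 1]
    comes from [2 * rho * |w| <= |w|^2 + rho^2]. *)
Lemma gronwall (w dw : R -> C) (K rho t : R) :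
  0 <= t -> 0 <= K -> 0 <= rho ->
  (forall s, 0 <= s <= t -> cderiv w s (dw s)) ->
  (forall s, 0 <= s <= t -> Cmod (dw s) <= K * Cmod (w s) + rho) ->
  Cmod (w t) * Cmod (w t) <= (Cmod (w 0) * Cmod (w 0) + rho * rho) * exp ((2 * K + 1) * t).
Proof.
  intros Ht HK Hr Hd Hb. set (a := 2 * K + 1).
  set (D := fun s => Cmod (w s) * Cmod (w s)).
  set (phi := fun s => (D s + rho * rho) * exp (- a * s)).
  assert (phi t <= phi 0) as H.
  { apply (nonincreasing_of_derive phi (fun s => 2 * Re (Cconj (w s) * dw s)%C * exp (- a * s)
      + (D s + rho * rho) * (- a * exp (- a * s))) t Ht).
    - intros s Hs. unfold phi.
      apply (is_derive_mult (K := R_AbsRing) (fun s => D s + rho * rho) (fun s => exp (- a * s)));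
        [| |exact Rmult_comm].
      + rewrite <- (Rplus_0_r (2 * _)).
        apply (is_derive_plus (K := R_AbsRing) (V := R_NormedModule) D (fun _ => rho * rho)).
        * apply is_derive_Cmod_sqr; auto.
        * apply (is_derive_const (K := R_AbsRing) (V := R_NormedModule)).
      + auto_derive; auto; ring.
    - intros s Hs. pose proof (exp_pos (- a * s)).
      assert (Re (Cconj (w s) * dw s)%C <= Cmod (w s) * (K * Cmod (w s) + rho)) as L.
      { eapply Rle_trans; [apply Cmod_re_bound|]. rewrite Cmod_mult, Cmod_conj.
        apply Rmult_le_compat_l; [apply Cmod_ge_0|auto]. }
      assert (2 * Re (Cconj (w s) * dw s)%C - a * (D s + rho * rho) <= 0) as L2.
      { unfold D, a. pose proof (Rle_0_sqr (Cmod (w s) - rho)) as S; unfold Rsqr in S. nra. }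
      nra. }
  unfold phi in H. rewrite Rmult_0_r, exp_0, Rmult_1_r in H. fold (D t); fold (D 0).
  assert (exp (- a * t) * exp (a * t) = 1) as E.
  { rewrite <- exp_plus. replace (- a * t + a * t) with 0 by ring. apply exp_0. }
  apply (Rmult_le_compat_r (exp (a * t))) in H; [|apply Rlt_le, exp_pos].
  rewrite Rmult_assoc, E in H. assert (0 <= rho * rho) by nra. lra.
Qed.

Definition Cint (phi : R -> C) (t : R) : C :=
  (RInt (fun s => Re (phi s)) 0 t, RInt (fun s => Im (phi s)) 0 t).

Lemma Cint_cderiv (phi : R -> C) (c : C) (t : R) :
  (forall s, continuous phi s) -> cderiv (fun s => c + Cint phi s)%C t (phi t).
Proof.
  intros H.
  assert (forall (f : R -> R) k, (forall s, continuous f s) ->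
    is_derive (fun s => k + RInt f 0 s) t (f t)) as S.
  { intros f k Hf. replace (f t) with (plus 0 (f t)) by (unfold plus; simpl; ring).
    apply (is_derive_plus (K := R_AbsRing) (V := R_NormedModule) (fun _ => k) (RInt f 0)).
    - apply (is_derive_const (K := R_AbsRing) (V := R_NormedModule)).
    - apply is_derive_RInt with (a := 0); auto.
      apply filter_forall. intros b.
      apply (RInt_correct (V := R_CompleteNormedModule)).
      apply (ex_RInt_continuous (V := R_CompleteNormedModule)); auto. }
  split.
  - apply (S (fun s => Re (phi s))). intros s; apply (continuous_Re_Im phi s); auto.
  - apply (S (fun s => Im (phi s))). intros s; apply (continuous_Re_Im phi s); auto.
Qed.

Lemma RInt_exp_bound (f : R -> R) (c L t : R) :
  0 <= c -> 0 < L -> 0 <= t -> (forall s, continuous f s) ->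
  (forall s, 0 <= s <= t -> Rabs (f s) <= c * exp (L * s)) ->
  Rabs (RInt f 0 t) <= c / L * exp (L * t).
Proof.
  intros Hc HL Ht Hf Hb.
  assert (is_RInt (fun s => c * exp (L * s)) 0 t (c / L * exp (L * t) - c / L)) as I.
  { replace (c / L * exp (L * t) - c / L)
      with (minus (c / L * exp (L * t)) (c / L * exp (L * 0))).
    2:{ rewrite Rmult_0_r, exp_0. unfold minus, plus, opp; simpl. ring. }
    apply (is_RInt_derive (V := R_CompleteNormedModule) (fun s => c / L * exp (L * s))).
    - intros s _. auto_derive; auto; field; lra.
    - intros s _. apply (ex_derive_continuous (K := R_AbsRing) (V := R_NormedModule)).
      auto_derive; auto. }
  assert (ex_RInt f 0 t) as X by (apply ex_RInt_cont; auto).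
  assert (ex_RInt (fun s => c * exp (L * s)) 0 t) as X1 by (eexists; exact I).
  assert (0 <= c / L) by (apply Rdiv_le_0_compat; auto).
  assert (RInt f 0 t <= c / L * exp (L * t)) as U.
  { apply Rle_trans with (RInt (fun s => c * exp (L * s)) 0 t).
    - apply RInt_le; auto. intros s Hs. specialize (Hb s ltac:(lra)).
      apply Rabs_le_between in Hb; lra.
    - rewrite (is_RInt_unique _ _ _ _ I); lra. }
  assert (- (c / L * exp (L * t)) <= RInt f 0 t) as Lo.
  { apply Rle_trans with (RInt (fun s => opp (c * exp (L * s))) 0 t).
    - apply Rle_trans with (opp (c / L * exp (L * t) - c / L)); [unfold opp; simpl; lra|].
      apply Req_le; symmetry. apply (is_RInt_unique (V := R_CompleteNormedModule)).
      apply (is_RInt_opp (V := R_NormedModule) _ _ _ _ I).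
    - apply RInt_le; auto.
      + eexists; apply (is_RInt_opp _ _ _ _ I).
      + intros s Hs. specialize (Hb s ltac:(lra)). unfold opp; simpl.
        apply Rabs_le_between in Hb; lra. }
  apply Rabs_le; lra.
Qed.

Lemma Cint_minus_bound (p q : R -> C) (c L t : R) :
  0 <= c -> 0 < L -> 0 <= t -> (forall s, continuous p s) -> (forall s, continuous q s) ->
  (forall s, 0 <= s <= t -> Cmod (p s - q s) <= c * exp (L * s)) ->
  Cmod (Cint p t - Cint q t) <= 2 * c / L * exp (L * t).
Proof.
  intros Hc HL Ht Hp Hq Hb.
  assert (forall f g : R -> R, (forall s, continuous f s) -> (forall s, continuous g s) ->
    RInt f 0 t - RInt g 0 t = RInt (fun s => f s - g s) 0 t) as E.
  { intros f g Hf Hg. symmetry.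
    apply (RInt_minus (V := R_CompleteNormedModule)); apply ex_RInt_cont; auto. }
  eapply Rle_trans; [apply Cmod_le_Rabs|].
  change (Rabs (RInt (fun s => Re (p s)) 0 t - RInt (fun s => Re (q s)) 0 t)
    + Rabs (RInt (fun s => Im (p s)) 0 t - RInt (fun s => Im (q s)) 0 t)
    <= 2 * c / L * exp (L * t)).
  pose proof (fun s => proj1 (continuous_Re_Im p s) (Hp s)) as Cp.
  pose proof (fun s => proj1 (continuous_Re_Im q s) (Hq s)) as Cq.
  rewrite !E by (intros; try apply Cp; try apply Cq).
  assert (Rabs (RInt (fun s => Re (p s) - Re (q s)) 0 t) <= c / L * exp (L * t)) as B1.
  { apply RInt_exp_bound; auto.
    - intros s; apply continuous_Rminus; [apply Cp|apply Cq].
    - intros s Hs. eapply Rle_trans; [exact (re_le_Cmod (p s - q s))|auto]. }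
  assert (Rabs (RInt (fun s => Im (p s) - Im (q s)) 0 t) <= c / L * exp (L * t)) as B2.
  { apply RInt_exp_bound; auto.
    - intros s; apply continuous_Rminus; [apply Cp|apply Cq].
    - intros s Hs. eapply Rle_trans; [exact (im_le_Cmod (p s - q s))|auto]. }
  replace (2 * c / L * exp (L * t)) with (c / L * exp (L * t) + c / L * exp (L * t))
    by (field; lra).
  lra.
Qed.

(** The intervals of radius [2 * c / 2^n] around [a n] are nested. *)
Lemma geometric_limit (a : nat -> R) (c : R) :
  0 <= c -> (forall n, Rabs (a (S n) - a n) <= c * (/ 2) ^ n) ->
  exists l, forall n, Rabs (a n - l) <= 2 * c * (/ 2) ^ n.
Proof.
  intros Hc H.
  assert (forall n, 0 < (/ 2) ^ n) as Hp by (intros; apply pow_lt; lra).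
  destruct (nested_intervals_common (fun n => a n - 2 * c * (/ 2) ^ n)
    (fun n => 4 * c * (/ 2) ^ n)) as [l Hl].
  - intros n; specialize (Hp n); nra.
  - intros n; specialize (H n); apply Rabs_le_between in H; simpl; lra.
  - intros n; specialize (H n); apply Rabs_le_between in H; simpl; lra.
  - exists l; intros n; specialize (Hl n). apply Rabs_le; lra.
Qed.

Lemma Rmax_0_lipschitz (s t : R) : Rabs (Rmax 0 s - Rmax 0 t) <= Rabs (s - t).
Proof.
  unfold Rmax; destruct (Rle_dec 0 s), (Rle_dec 0 t); apply Rabs_le;
    pose proof (Rle_abs (s - t)); pose proof (Rle_abs (- (s - t))) as Q;
    rewrite Rabs_Ropp in Q; lra.
Qed.

Lemma continuous_Rmax_0 (t : R) : continuous (Rmax 0) t.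
Proof.
  apply filterlim_locally. intros e. exists e. intros s Hs. change (Rabs (s - t) < e) in Hs.
  change (Rabs (Rmax 0 s - Rmax 0 t) < e). eapply Rle_lt_trans; [apply Rmax_0_lipschitz|auto].
Qed.

(* The iterates converge uniformly for the weight [exp (- L t)]; they are
   frozen for [t <= 0] so that everything is defined on the whole line. *)
Lemma picard (V : C -> C) (K : R) (z : C) :
  0 <= K -> (forall a b, Cmod (V a - V b) <= K * Cmod (a - b)) ->
  exists u : R -> C, u 0 = z /\ forall t, 0 <= t -> cderiv u t (V (u t)).
Proof.
  intros HK HV.
  assert (forall w, continuous V w) as CV.
  { intros w. apply continuous_C_iff. intros e He.
    exists (e / (K + 1)); split; [apply Rdiv_lt_0_compat; lra|]. intros v Hv.
    eapply Rle_lt_trans; [apply HV|].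
    apply Rmult_lt_compat_r with (r := K + 1) in Hv; [|lra].
    replace (e / (K + 1) * (K + 1)) with e in Hv by (field; lra).
    pose proof (Cmod_ge_0 (v - w)); nra. }
  set (it := fix it n : R -> C := match n with
    | O => fun _ => z
    | S k => fun t => (z + Cint (fun s => V (it k s)) (Rmax 0 t))%C end).
  assert (forall n t, continuous (it n) t) as Cit.
  { induction n as [|n IH]; intros t; [apply continuous_const|].
    apply (continuous_comp (Rmax 0) (fun s => z + Cint (fun s => V (it n s)) s)%C).
    - apply continuous_Rmax_0.
    - eapply cderiv_continuous, Cint_cderiv. intros s; apply (continuous_comp (it n) V); auto. }
  assert (forall n t, continuous (fun s => V (it n s)) t) as CVit.
  { intros n t; apply (continuous_comp (it n) V); auto. }
  (* A Picard step multiplies the weighted error by at most [2 * K / L <= / 2]; the 2 stems from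
     treating real and imaginary parts separately, and the 1 covers [K = 0]. *)
  set (L := 4 * K + 1). assert (0 < L) as HL by (unfold L; lra).
  set (M := 2 * Cmod (V z)). assert (0 <= M) as HM by (unfold M; pose proof (Cmod_ge_0 (V z)); lra).
  assert (forall n, 0 < (/ 2) ^ n) as Hp by (intros; apply pow_lt; lra).
  assert (forall n t, Cmod (it (S n) t - it n t) <= M * (/ 2) ^ n * exp (L * Rmax 0 t)) as Hit.
  { induction n as [|n IH]; intros t; pose proof (Rmax_l 0 t) as Ht;
      pose proof (exp_pos (L * Rmax 0 t)) as EP.
    - change (Cmod (z + Cint (fun s => V z) (Rmax 0 t) - z) <= M * 1 * exp (L * Rmax 0 t)).
      replace (z + Cint (fun s => V z) (Rmax 0 t) - z)%C
        with (Cint (fun s => V z) (Rmax 0 t) - Cint (fun _ => 0) (Rmax 0 t))%C.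
      + eapply Rle_trans; [apply (Cint_minus_bound _ _ (Cmod (V z)) L)|]; auto;
          try (intros; apply continuous_const).
        * apply Cmod_ge_0.
        * intros s Hs. replace (V z - 0)%C with (V z) by ring.
          assert (1 <= exp (L * s)) as X.
          { rewrite <- exp_0. destruct (Rle_lt_or_eq_dec 0 (L * s)) as [X|X]; [nra| |].
            - apply Rlt_le, exp_increasing; auto.
            - rewrite <- X; lra. }
          pose proof (Cmod_ge_0 (V z)); nra.
        * apply Rmult_le_compat_r; [lra|]. fold M. unfold Rdiv.
          assert (/ L <= 1) by (rewrite <- Rinv_1; apply Rinv_le_contravar; unfold L; lra). nra.
      + assert (Cint (fun _ => 0) (Rmax 0 t) = 0) as ->.
        { unfold Cint. apply C_eq; unfold Re, Im; simpl;
            rewrite (RInt_const (V := R_CompleteNormedModule)); unfold scal; simpl; unfold mult; simpl; ring. }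
        ring.
    - change (Cmod (z + Cint (fun s => V (it (S n) s)) (Rmax 0 t)
        - (z + Cint (fun s => V (it n s)) (Rmax 0 t))) <= M * (/ 2 * (/ 2) ^ n) * exp (L * Rmax 0 t)).
      replace (z + Cint (fun s => V (it (S n) s)) (Rmax 0 t)
        - (z + Cint (fun s => V (it n s)) (Rmax 0 t)))%C
        with (Cint (fun s => V (it (S n) s)) (Rmax 0 t) - Cint (fun s => V (it n s)) (Rmax 0 t))%C
        by ring.
      assert (0 <= M * (/ 2) ^ n) as MP by (specialize (Hp n); apply Rmult_le_pos; lra).
      eapply Rle_trans; [apply (Cint_minus_bound _ _ (K * (M * (/ 2) ^ n)) L)|]; auto.
      + apply Rmult_le_pos; auto.
      + intros s Hs. eapply Rle_trans; [apply HV|]. rewrite Rmult_assoc.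
        apply Rmult_le_compat_l; auto. specialize (IH s).
        rewrite Rmax_right in IH by lra. exact IH.
      + apply Rmult_le_compat_r; [lra|].
        replace (2 * (K * (M * (/ 2) ^ n)) / L) with (M * (/ 2) ^ n * (2 * K / L)) by (field; lra).
        replace (M * (/ 2 * (/ 2) ^ n)) with (M * (/ 2) ^ n * / 2) by ring.
        apply Rmult_le_compat_l; auto.
        apply Rmult_le_reg_r with L; auto. unfold Rdiv; rewrite Rmult_assoc, Rinv_l by lra.
        unfold L; lra. }
  assert (forall t, exists l : C, forall n, Cmod (it n t - l) <= 4 * M * exp (L * Rmax 0 t) * (/ 2) ^ n)
    as Hlim.
  { intros t. set (c := M * exp (L * Rmax 0 t)).
    assert (0 <= c) as Hc by (unfold c; pose proof (exp_pos (L * Rmax 0 t)); nra).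
    destruct (geometric_limit (fun n => Re (it n t)) c Hc) as [l1 H1].
    { intros n. eapply Rle_trans; [exact (re_le_Cmod (it (S n) t - it n t))|].
      eapply Rle_trans; [apply Hit|]. unfold c; apply Req_le; ring. }
    destruct (geometric_limit (fun n => Im (it n t)) c Hc) as [l2 H2].
    { intros n. eapply Rle_trans; [exact (im_le_Cmod (it (S n) t - it n t))|].
      eapply Rle_trans; [apply Hit|]. unfold c; apply Req_le; ring. }
    exists (l1, l2). intros n. eapply Rle_trans; [apply Cmod_le_Rabs|].
    specialize (H1 n); specialize (H2 n).
    change (Rabs (Re (it n t) - l1) + Rabs (Im (it n t) - l2) <= 4 * M * exp (L * Rmax 0 t) * (/ 2) ^ n).
    unfold c in *; lra. }
  set (u := fun t => proj1_sig (constructive_indefinite_description _ (Hlim t))).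
  assert (forall t n, Cmod (it n t - u t) <= 4 * M * exp (L * Rmax 0 t) * (/ 2) ^ n) as Hu.
  { intros t; unfold u; destruct (constructive_indefinite_description _ (Hlim t)); auto. }
  clearbody u; clear Hlim.
  assert (forall c e, 0 < e -> exists n, c * (/ 2) ^ n < e) as Hsmall.
  { intros c e He. pose proof (Rabs_pos c) as P.
    assert (0 < e / (Rabs c + 1)) as He' by (apply Rdiv_lt_0_compat; lra).
    destruct (pow_lt_1_zero (/ 2)) with (y := e / (Rabs c + 1)) as [n Hn]; auto.
    { rewrite Rabs_pos_eq; lra. }
    exists n. specialize (Hn n (le_n n)). specialize (Hp n). rewrite Rabs_pos_eq in Hn by lra.
    apply (Rmult_lt_compat_r (Rabs c + 1)) in Hn; [|lra].
    replace (e / (Rabs c + 1) * (Rabs c + 1)) with e in Hn by (field; lra).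
    pose proof (Rle_abs c). nra. }
  assert (forall t, continuous u t) as Cu.
  { intros t. unfold continuous. apply filterlim_C_iff; [apply locally_filter|]. intros e He.
    set (B := 4 * M * exp (L * (Rabs t + 1))).
    destruct (Hsmall B (e / 3)) as [n Hn]; [lra|].
    assert (forall s, Rabs (s - t) < 1 -> Cmod (it n s - u s) < e / 3) as Hs.
    { intros s Hs. eapply Rle_lt_trans; [|exact Hn]. eapply Rle_trans; [apply Hu|].
      apply Rmult_le_compat_r; [apply Rlt_le, Hp|]. apply Rmult_le_compat_l; [lra|].
      assert (Rmax 0 s <= Rabs t + 1) as X.
      { apply Rmax_lub; [pose proof (Rabs_pos t); lra|].
        apply Rabs_lt_between in Hs. pose proof (Rle_abs t). lra. }
      destruct X as [X| ->]; [apply Rlt_le, exp_increasing; nra|lra]. }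
    assert (0 < e / 3) as He3 by lra.
    pose proof (proj1 (filterlim_C_iff _ _ _) (Cit n t) (e / 3) He3) as [d Hd].
    assert (0 < Rmin d 1) as Hm by (apply Rmin_glb_lt; [apply cond_pos|lra]).
    exists (mkposreal _ Hm). intros s Hs'. change (Rabs (s - t) < Rmin d 1) in Hs'.
    pose proof (Rmin_l d 1); pose proof (Rmin_r d 1).
    assert (Rabs (s - t) < d) as Hsd by lra. specialize (Hd s Hsd). cbv beta in Hd.
    pose proof (Hs s ltac:(lra)) as K1.
    pose proof (Hs t ltac:(replace (t - t) with 0 by ring; rewrite Rabs_R0; lra)) as K2.
    replace (u s - u t)%C with ((it n t - u t) + ((it n s - it n t) - (it n s - u s)))%C by ring.
    eapply Rle_lt_trans; [apply Cmod_triangle|].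
    pose proof (Cmod_minus_le (it n s - it n t) (it n s - u s)). lra. }
  assert (forall t, continuous (fun s => V (u s)) t) as CVu.
  { intros t; apply (continuous_comp u V); auto. }
  (* The limit [u] is only known to be continuous; its Picard image [w] is differentiable, equals
     [u] for [t >= 0], and is the solution returned. *)
  set (w := fun t => (z + Cint (fun s => V (u s)) t)%C).
  assert (forall t, 0 <= t -> w t = u t) as Hw.
  { intros t Ht. destruct (Ceq_dec (w t) (u t)) as [|N]; auto. exfalso.
    pose proof (Cmod_pos_sub _ _ N) as HN.
    destruct (Hsmall (6 * M * exp (L * t)) (Cmod (w t - u t))) as [n Hn]; auto.
    pose proof (Hu t (S n)) as H1. rewrite Rmax_right in H1 by auto.
    assert (Cmod (Cint (fun s => V (u s)) t - Cint (fun s => V (it n s)) t)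
      <= 2 * (K * (4 * M * (/ 2) ^ n)) / L * exp (L * t)) as H2.
    { apply Cint_minus_bound; auto.
      - specialize (Hp n). apply Rmult_le_pos; auto. apply Rmult_le_pos; lra.
      - intros s Hs. eapply Rle_trans; [apply HV|]. rewrite Rmult_assoc.
        apply Rmult_le_compat_l; auto. rewrite Cmod_sub_sym.
        specialize (Hu s n). rewrite Rmax_right in Hu by lra. lra. }
    assert (w t - u t = (Cint (fun s => V (u s)) t - Cint (fun s => V (it n s)) t) + (it (S n) t - u t))%C
      as E.
    { unfold w. change (it (S n) t) with (z + Cint (fun s => V (it n s)) (Rmax 0 t))%C.
      rewrite Rmax_right by auto. ring. }
    rewrite E in Hn at 1.
    pose proof (Cmod_triangle (Cint (fun s => V (u s)) t - Cint (fun s => V (it n s)) t)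
      (it (S n) t - u t)) as T.
    assert (2 * (K * (4 * M * (/ 2) ^ n)) / L <= 2 * M * (/ 2) ^ n) as H3.
    { apply Rmult_le_reg_r with L; auto. unfold Rdiv; rewrite Rmult_assoc, Rinv_l by lra.
      unfold L. specialize (Hp n). assert (0 <= M * (/ 2) ^ n) by (apply Rmult_le_pos; lra). lra. }
    apply (Rmult_le_compat_r (exp (L * t))) in H3; [|apply Rlt_le, exp_pos].
    change ((/ 2) ^ S n) with (/ 2 * (/ 2) ^ n) in H1.
    assert (0 <= M * exp (L * t) * (/ 2) ^ n).
    { specialize (Hp n). pose proof (exp_pos (L * t)).
      apply Rmult_le_pos; [apply Rmult_le_pos|]; lra. }
    lra. }
  exists w; split.
  - unfold w, Cint. apply C_eq; unfold Re, Im; simpl;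
      rewrite (RInt_point (V := R_CompleteNormedModule)); unfold zero; simpl; ring.
  - intros t Ht. rewrite Hw by auto. apply (Cint_cderiv (fun s => V (u s))); auto.
Qed.

(** * Dissipative holomorphic fields generate semigroups *)


Lemma cderiv_linear_approx (u : R -> C) (t : R) (d : C) :
  cderiv u t d -> forall e, 0 < e -> exists delta, 0 < delta /\ forall s, Rabs (s - t) < delta ->
    Cmod (u s - u t - RtoC (s - t) * d)%C <= e * Rabs (s - t).
Proof.
  intros [[_ H1] [_ H2]] e He. assert (0 < e / 2) as He2 by lra.
  specialize (H1 t (fun P HP => HP) (mkposreal _ He2)).
  specialize (H2 t (fun P HP => HP) (mkposreal _ He2)).
  destruct (filter_and _ _ H1 H2) as [delta H]. exists delta; split; [apply cond_pos|].
  intros s Hs. specialize (H s Hs). destruct H as [K1 K2].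
  change (Rabs (Re (u s) - Re (u t) - (s - t) * Re d) <= e / 2 * Rabs (s - t)) in K1.
  change (Rabs (Im (u s) - Im (u t) - (s - t) * Im d) <= e / 2 * Rabs (s - t)) in K2.
  eapply Rle_trans; [apply Cmod_le_Rabs|].
  replace (Re (u s - u t - RtoC (s - t) * d)%C) with (Re (u s) - Re (u t) - (s - t) * Re d)
    by (unfold Re, Im; simpl; ring).
  replace (Im (u s - u t - RtoC (s - t) * d)%C) with (Im (u s) - Im (u t) - (s - t) * Im d)
    by (unfold Re, Im; simpl; ring).
  lra.
Qed.

(** The exponential of minus the integral of [k], in real coordinates. It will be the derivative of
    the flow with respect to the initial value. *)
Lemma linear_ode (k : R -> C) :
  (forall t, continuous k t) ->
  exists E : R -> C, E 0 = 1 /\ forall t, cderiv E t (- (k t * E t))%C.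
Proof.
  intros Hk.
  set (a := fun t => RInt (fun s => Re (k s)) 0 t). set (b := fun t => RInt (fun s => Im (k s)) 0 t).
  assert (forall t, is_derive a t (Re (k t)) /\ is_derive b t (Im (k t))) as Hab.
  { intros t. destruct (Cint_cderiv k 0 t Hk) as [H1 H2]. split.
    - apply is_derive_ext with (2 := H1). intros s; unfold Re, Cint; simpl. apply Rplus_0_l.
    - apply is_derive_ext with (2 := H2). intros s; unfold Im, Cint; simpl. apply Rplus_0_l. }
  exists (fun t => (exp (- a t) * cos (b t), - exp (- a t) * sin (b t))). split.
  - assert (a 0 = 0) as -> by apply (RInt_point (V := R_CompleteNormedModule)).
    assert (b 0 = 0) as -> by apply (RInt_point (V := R_CompleteNormedModule)).
    rewrite Ropp_0, exp_0, cos_0, sin_0. apply C_eq; unfold Re, Im; simpl; ring.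
  - intros t. destruct (Hab t) as [Ha Hb].
    assert (ex_derive a t) as Xa by (eexists; exact Ha).
    assert (ex_derive b t) as Xb by (eexists; exact Hb).
    split; unfold Re at 1 || unfold Im at 1; simpl; auto_derive; auto;
      replace (Derive (fun x => a x) t) with (Re (k t)) by (symmetry; apply is_derive_unique, Ha);
      replace (Derive (fun x => b x) t) with (Im (k t)) by (symmetry; apply is_derive_unique, Hb);
      unfold Re, Im; simpl; ring.
Qed.

Definition retract (r : R) (w : C) : C := (RtoC (r / Rmax r (Cmod w)) * w)%C.

Lemma retract_id (r : R) (w : C) : 0 < r -> Cmod w <= r -> retract r w = w.
Proof.
  intros Hr Hw. unfold retract. rewrite Rmax_left by auto.
  replace (r / r) with 1 by (field; lra). ring.
Qed.

Lemma Cmod_retract (r : R) (w : C) : 0 < r -> Cmod (retract r w) <= r.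
Proof.
  intros Hr. unfold retract. pose proof (Rmax_l r (Cmod w)); pose proof (Rmax_r r (Cmod w)).
  set (m := Rmax r (Cmod w)) in *.
  assert (0 <= r / m) by (apply Rdiv_le_0_compat; lra).
  rewrite Cmod_mult, Cmod_R, Rabs_pos_eq by auto.
  apply Rle_trans with (r / m * m); [apply Rmult_le_compat_l; auto|].
  apply Req_le; field; lra.
Qed.

Lemma retract_lipschitz (r : R) (a b : C) :
  0 < r -> Cmod (retract r a - retract r b) <= 2 * Cmod (a - b).
Proof.
  intros Hr. unfold retract.
  pose proof (Rmax_l r (Cmod a)); pose proof (Rmax_r r (Cmod a)).
  pose proof (Rmax_l r (Cmod b)); pose proof (Rmax_r r (Cmod b)).
  assert (Rabs (Rmax r (Cmod b) - Rmax r (Cmod a)) <= Cmod (a - b)) as HM.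
  { pose proof (Cmod_triangle_sub a b); pose proof (Cmod_triangle_sub b a) as T.
    rewrite (Cmod_sub_sym b a) in T. pose proof (Cmod_ge_0 (a - b)).
    unfold Rmax; destruct (Rle_dec r (Cmod a)), (Rle_dec r (Cmod b)); apply Rabs_le; lra. }
  set (m := Rmax r (Cmod a)) in *. set (n := Rmax r (Cmod b)) in *.
  replace (RtoC (r / m) * a - RtoC (r / n) * b)%C
    with (RtoC (r / m) * (a - b) + RtoC (r / m - r / n) * b)%C by (rewrite RtoC_minus; ring).
  eapply Rle_trans; [apply Cmod_triangle|]. rewrite !Cmod_mult, !Cmod_R.
  assert (0 <= r / m <= 1) as Hrm.
  { split; [apply Rdiv_le_0_compat; lra|]. apply Rmult_le_reg_r with m; [lra|].
    unfold Rdiv; rewrite Rmult_assoc, Rinv_l by lra; lra. }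
  assert (Rabs (r / m - r / n) * Cmod b <= Cmod (a - b)) as Hb.
  { apply Rle_trans with (Rabs (r / m - r / n) * n).
    { apply Rmult_le_compat_l; [apply Rabs_pos|auto]. }
    rewrite <- (Rabs_pos_eq n) at 2 by lra. rewrite <- Rabs_mult.
    replace ((r / m - r / n) * n) with (r / m * (n - m)) by (field; lra).
    rewrite Rabs_mult, (Rabs_pos_eq (r / m)) by lra. pose proof (Rabs_pos (n - m)). nra. }
  rewrite (Rabs_pos_eq (r / m)) by lra. pose proof (Cmod_ge_0 (a - b)). nra.
Qed.

Lemma cdiff_of_quadratic_error (g : C -> C) (z E : C) (K d : R) :
  0 < d -> 0 <= K ->
  (forall w, Cmod (w - z) < d ->
     Cmod (g w - g z - E * (w - z))%C <= K * (Cmod (w - z) * Cmod (w - z))) ->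
  cdiff g z.
Proof.
  intros Hd HK H.
  exists (fun w => if Ceq_dec w z then E else (g w - g z) / (w - z))%C; split.
  - apply continuous_C_iff. intros e He. exists (Rmin d (e / (K + 1))).
    split; [apply Rmin_glb_lt; auto; apply Rdiv_lt_0_compat; lra|].
    intros w Hw. pose proof (Rmin_l d (e / (K + 1))); pose proof (Rmin_r d (e / (K + 1))).
    destruct (Ceq_dec z z) as [_|n]; [|congruence].
    destruct (Ceq_dec w z) as [->|n].
    + replace (E - E)%C with (RtoC 0) by ring. rewrite Cmod_0; auto.
    + specialize (H w ltac:(lra)). pose proof (Cmod_pos_sub _ _ n) as P.
      replace ((g w - g z) / (w - z) - E)%C with ((g w - g z - E * (w - z)) / (w - z))%C
        by (field; apply Csub_neq_0; auto).
      rewrite Cmod_div by (apply Csub_neq_0; auto).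
      set (x := Cmod (w - z)) in *.
      apply Rle_lt_trans with (K * x).
      * apply Rmult_le_reg_r with x; auto. unfold Rdiv; rewrite Rmult_assoc, Rinv_l by lra. lra.
      * assert (x < e / (K + 1)) as L by lra.
        apply (Rmult_lt_compat_r (K + 1)) in L; [|lra].
        replace (e / (K + 1) * (K + 1)) with e in L by (field; lra). lra.
  - intros w; destruct (Ceq_dec w z) as [->|n]; [ring|field; apply Csub_neq_0; auto].
Qed.

Section Flow.
Variable h : C -> C.
Hypothesis Hh : forall z, Cmod z < 1 -> cdiff h z.
Hypothesis Hp : forall z, Cmod z < 1 -> 0 <= Re (Cconj z * h z)%C.

Lemma holomorphic_lipschitz (s : R) : 0 <= s < 1 ->
  exists K, 0 <= K /\ forall a b, Cmod a <= s -> Cmod b <= s ->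
    Cmod (h a - h b) <= K * Cmod (a - b).
Proof.
  intros Hs. destruct (slope_bounds h s Hh Hs) as (K & HK & B). exists K; split; auto.
  intros a b Ha Hb. destruct (B a b Ha Hb) as [B1 _].
  destruct (slope_spec h b) as [_ E]; [apply Hh; lra|].
  rewrite (E a). replace (h b + slope h b a * (a - b) - h b)%C with (slope h b a * (a - b))%C by ring.
  rewrite Cmod_mult. apply Rmult_le_compat_r; auto; apply Cmod_ge_0.
Qed.

(** The bound by [Cmod z] is built in, so that the trajectory picked by [epsilon] in [flow] is known
    to stay in the disk. *)
Definition trajectory (z : C) (u : R -> C) : Prop :=
  u 0 = z /\ forall t, 0 <= t -> Cmod (u t) <= Cmod z /\ cderiv u t (- h (u t))%C.

(* The field is made globally Lipschitz by a radial retraction, which does not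
   change the sign of [Re (conj w * h w)]; hence [Cmod u] decreases and the retraction never acts. *)
Lemma trajectory_exists (z : C) : Cmod z < 1 -> exists u, trajectory z u.
Proof.
  intros Hz. pose proof (Cmod_ge_0 z) as Z0.
  set (r := (1 + Cmod z) / 2). assert (0 < r < 1) as Hr by (unfold r; lra).
  assert (Cmod z < r) as Hzr by (unfold r; lra).
  destruct (holomorphic_lipschitz r ltac:(lra)) as (K & HK & HL).
  destruct (picard (fun w => - h (retract r w))%C (2 * K) z) as (u & U0 & Hu); [lra| |].
  { intros a b. replace (- h (retract r a) - - h (retract r b))%C
      with (- (h (retract r a) - h (retract r b)))%C by ring.
    rewrite Cmod_opp. eapply Rle_trans; [apply HL; apply Cmod_retract; lra|].
    pose proof (retract_lipschitz r a b ltac:(lra)). nra. }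
  assert (forall t, 0 <= t -> Cmod (u t) <= Cmod z) as B.
  { intros t Ht. apply Rsqr_incr_0_var; auto. unfold Rsqr. rewrite <- U0.
    apply (nonincreasing_of_derive (fun s => Cmod (u s) * Cmod (u s))
      (fun s => 2 * Re (Cconj (u s) * - h (retract r (u s)))%C)); auto.
    - intros s Hs. apply is_derive_Cmod_sqr, Hu; lra.
    - intros s Hs. set (w := retract r (u s)).
      assert (0 <= Re (Cconj w * h w)%C) as P.
      { apply Hp. apply Rle_lt_trans with r; [apply Cmod_retract|]; lra. }
      assert (0 < r / Rmax r (Cmod (u s))) as Q.
      { apply Rdiv_lt_0_compat; [lra|]. pose proof (Rmax_l r (Cmod (u s))); lra. }
      set (l := r / Rmax r (Cmod (u s))) in *.
      assert (Re (Cconj w * h w)%C = l * Re (Cconj (u s) * h w)%C) as E.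
      { unfold w at 1, retract. fold l. unfold Re, Im; simpl; ring. }
      assert (Re (Cconj (u s) * - h w)%C = - Re (Cconj (u s) * h w)%C) as E2.
      { unfold Re, Im; simpl; ring. }
      rewrite E2. nra. }
  exists u; split; auto. intros t Ht; split; auto.
  pose proof (Hu t Ht) as D. rewrite retract_id in D; [auto|lra|].
  specialize (B t Ht); lra.
Qed.

(** Gronwall without inhomogeneity. It gives Lipschitz dependence on the initial value and, for
    equal initial values, uniqueness. *)
Lemma trajectories_close (s t K : R) (u v : R -> C) :
  0 <= t -> 0 <= K ->
  (forall a b, Cmod a <= s -> Cmod b <= s -> Cmod (h a - h b) <= K * Cmod (a - b)) ->
  (forall r, 0 <= r -> Cmod (u r) <= s /\ cderiv u r (- h (u r))%C) ->
  (forall r, 0 <= r -> Cmod (v r) <= s /\ cderiv v r (- h (v r))%C) ->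
  Cmod (u t - v t) * Cmod (u t - v t)
    <= Cmod (u 0 - v 0) * Cmod (u 0 - v 0) * exp ((2 * K + 1) * t).
Proof.
  intros Ht HK HL Hu Hv.
  pose proof (gronwall (fun r => u r - v r)%C (fun r => - h (u r) - - h (v r))%C K 0 t Ht HK
    (Rle_refl 0)) as G.
  rewrite Rmult_0_l, Rplus_0_r in G. apply G.
  - intros r Hr. destruct (Hu r), (Hv r); try lra. apply cderiv_minus; auto.
  - intros r Hr. replace (- h (u r) - - h (v r))%C with (- (h (u r) - h (v r)))%C by ring.
    rewrite Cmod_opp, Rplus_0_r. destruct (Hu r), (Hv r); try lra. auto.
Qed.

Definition flow (t : R) (z : C) : C :=
  epsilon (inhabits (fun _ : R => z)) (trajectory z) t.

Lemma flow_trajectory (z : C) : Cmod z < 1 -> trajectory z (fun t => flow t z).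
Proof.
  intros Hz. pose proof (epsilon_spec (inhabits (fun _ : R => z)) _ (trajectory_exists z Hz)) as H.
  exact H.
Qed.

(** The candidate derivative [E] solves the linearised equation along the trajectory of [z]. The
    error [flow r w - flow r z - (w - z) * E r] satisfies a linear inequality whose inhomogeneity is
    quadratic in the distance of the trajectories, hence in [w - z]; Gronwall keeps it quadratic. *)
Lemma flow_cdiff (t : R) (z : C) : 0 <= t -> Cmod z < 1 -> cdiff (flow t) z.
Proof.
  intros Ht Hz. pose proof (Cmod_ge_0 z) as Z0.
  set (s := (1 + Cmod z) / 2). assert (0 <= s < 1) as Hs by (unfold s; lra).
  destruct (slope_bounds h s Hh Hs) as (K & HK & B).
  destruct (holomorphic_lipschitz s Hs) as (K' & HK' & HL).
  assert (forall w, Cmod w <= s -> Cmod w < 1) as S1 by (intros; lra).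
  destruct (flow_trajectory z Hz) as [F0 HF].
  assert (forall r, 0 <= r -> Cmod (flow r z) <= s) as Fs.
  { intros r Hr; destruct (HF r Hr). unfold s; lra. }
  (* The derivative of [h] along the trajectory, frozen for negative times because [linear_ode]
     wants continuity on the whole line. *)
  set (k := fun r : R => slope h (flow (Rmax 0 r) z) (flow (Rmax 0 r) z)).
  (* The derivative of [h] is Lipschitz: by symmetry [slope h a b] is an intermediate value between
     the two derivatives. *)
  assert (forall a b, Cmod a <= s -> Cmod b <= s ->
    Cmod (slope h b b - slope h a a) <= 2 * K * Cmod (b - a)) as HL2.
  { intros a b Ha Hb.
    replace (slope h b b - slope h a a)%C
      with ((slope h a b - slope h a a) - (slope h b a - slope h b b))%C
      by (rewrite (slope_sym h a b) by auto; ring).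
    eapply Rle_trans; [apply Cmod_minus_le|].
    destruct (B b a Hb Ha) as [_ B1]. destruct (B a b Ha Hb) as [_ B2].
    rewrite Cmod_sub_sym in B2. rewrite (Cmod_sub_sym a b) in B2.
    rewrite Cmod_sub_sym in B2. lra. }
  assert (forall r, continuous k r) as Ck.
  { intros r. unfold continuous. apply filterlim_C_iff; [apply locally_filter|]. intros e He.
    assert (continuous (fun r => flow (Rmax 0 r) z) r) as C1.
    { apply (continuous_comp (Rmax 0) (fun r => flow r z)); [apply continuous_Rmax_0|].
      eapply cderiv_continuous. apply (HF (Rmax 0 r)), Rmax_l. }
    assert (0 < e / (2 * K + 1)) as He' by (apply Rdiv_lt_0_compat; lra).
    pose proof (proj1 (filterlim_C_iff _ _ _) C1 _ He') as L.
    generalize L; apply filter_imp. intros q Hq.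
    eapply Rle_lt_trans; [apply HL2; apply Fs, Rmax_l|].
    apply (Rmult_lt_compat_r (2 * K + 1)) in Hq; [|lra].
    replace (e / (2 * K + 1) * (2 * K + 1)) with e in Hq by (field; lra).
    pose proof (Cmod_ge_0 (flow (Rmax 0 q) z - flow (Rmax 0 r) z)). lra. }
  destruct (linear_ode k Ck) as (E & E0 & HE).
  set (a := exp ((2 * K' + 1) * t)). set (b := exp ((2 * K + 1) * t)).
  assert (0 < a) by apply exp_pos. assert (0 < b) by apply exp_pos.
  (* Here [a] bounds the growth of squared distances and [b] that of the squared error, hence
     [sqrt b]; the radius keeps [w] in the disc of radius [s]. *)
  apply (cdiff_of_quadratic_error _ z (E t) (K * a * sqrt b) ((1 - Cmod z) / 2)); [lra| |].
  { apply Rmult_le_pos; [apply Rmult_le_pos; lra|apply sqrt_pos]. }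
  intros w Hw.
  assert (Cmod w < s) as Ws by (pose proof (Cmod_triangle_sub w z); unfold s; lra).
  destruct (flow_trajectory w) as [G0 HG]; [lra|].
  assert (forall r, 0 <= r -> Cmod (flow r w) <= s) as Gs.
  { intros r Hr; destruct (HG r Hr). lra. }
  set (x := Cmod (w - z)) in *. assert (0 <= x) by apply Cmod_ge_0.
  assert (forall r, 0 <= r <= t ->
    Cmod (flow r w - flow r z) * Cmod (flow r w - flow r z) <= x * x * a) as D.
  { intros r Hr.
    pose proof (trajectories_close s r K' (fun r => flow r w) (fun r => flow r z)
      ltac:(lra) HK' HL) as T.
    cbv beta in T. rewrite F0, G0 in T. fold x in T.
    eapply Rle_trans; [apply T|].
    - intros q Hq; split; auto. apply HG; auto.
    - intros q Hq; split; auto. apply HF; auto.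
    - apply Rmult_le_compat_l; [nra|]. unfold a.
      destruct (Rle_lt_or_eq_dec r t) as [L| ->]; [lra| |lra].
      apply Rlt_le, exp_increasing. nra. }
  assert (forall r, 0 <= r <= t -> h (flow r w) =
    (h (flow r z) + slope h (flow r z) (flow r w) * (flow r w - flow r z))%C) as Hsl.
  { intros r Hr. apply (slope_spec h (flow r z)), Hh, S1, Fs; lra. }
  pose proof (gronwall (fun r => flow r w - flow r z - (w - z) * E r)%C
    (fun r => - h (flow r w) - - h (flow r z) - (w - z) * - (k r * E r))%C
    K (K * (x * x * a)) t Ht HK) as G.
  cbv beta in G. rewrite F0, G0, E0 in G.
  replace (w - z - (w - z) * 1)%C with (RtoC 0) in G by ring.
  rewrite Cmod_0, Rmult_0_l, Rplus_0_l in G. fold b in G.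
  assert (0 <= K * (x * x * a)) as R0 by (apply Rmult_le_pos; nra).
  specialize (G R0).
  assert (Cmod (flow t w - flow t z - (w - z) * E t) * Cmod (flow t w - flow t z - (w - z) * E t)
    <= K * (x * x * a) * (K * (x * x * a)) * b) as G'.
  { apply G.
    - intros r Hr. apply cderiv_minus.
      + apply (cderiv_minus (fun r => flow r w) (fun r => flow r z)); [apply HG|apply HF]; lra.
      + apply cderiv_scal, HE.
    - intros r Hr. unfold k. rewrite Rmax_right by lra. rewrite (Hsl r Hr).
      set (p := flow r w) in *. set (q := flow r z) in *.
      replace (- (h q + slope h q p * (p - q)) - - h q - (w - z) * - (slope h q q * E r))%C
        with (- slope h q q * (p - q - (w - z) * E r) - (slope h q p - slope h q q) * (p - q))%C
        by ring.
      eapply Rle_trans; [apply Cmod_minus_le|]. rewrite !Cmod_mult, Cmod_opp.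
      assert (Cmod p <= s) as Hps by (apply Gs; lra). assert (Cmod q <= s) as Hqs by (apply Fs; lra).
      destruct (B q q Hqs Hqs) as [B1 _]. destruct (B p q Hps Hqs) as [_ B2].
      specialize (D r Hr). fold p q in D.
      pose proof (Cmod_ge_0 (p - q)). pose proof (Cmod_ge_0 (p - q - (w - z) * E r)).
      apply Rplus_le_compat; [apply Rmult_le_compat_r; auto|].
      apply Rle_trans with (K * (Cmod (p - q) * Cmod (p - q))); [|apply Rmult_le_compat_l; auto].
      rewrite <- Rmult_assoc. apply Rmult_le_compat_r; auto. }
  replace (E t * (w - z))%C with ((w - z) * E t)%C by ring.
  apply Rsqr_incr_0_var.
  2:{ apply Rmult_le_pos; [apply Rmult_le_pos; [apply Rmult_le_pos; lra|apply sqrt_pos]|nra]. }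
  unfold Rsqr. eapply Rle_trans; [exact G'|].
  apply Req_le. rewrite <- (sqrt_sqrt b) at 1 by lra. ring.
Qed.

Theorem dissipative_generator : holomorphic_generator h.
Proof.
  exists flow. split; [split; [|split; [|split]]|split].
  - intros t Ht; split.
    + intros z Hz. apply cdiff_ex_derive, flow_cdiff; auto.
    + intros z Hz. destruct (flow_trajectory z Hz) as [_ H]. destruct (H t Ht).
      unfold in_disk in *; lra.
  - intros z Hz. apply flow_trajectory; auto.
  - intros s t z Hs Ht Hz. unfold in_disk in Hz.
    destruct (flow_trajectory z Hz) as [F0 HF].
    assert (Cmod (flow t z) < 1) as Hz' by (destruct (HF t Ht); lra).
    destruct (flow_trajectory _ Hz') as [G0 HG].
    pose proof (Cmod_ge_0 z).
    destruct (holomorphic_lipschitz (Cmod z) ltac:(lra)) as (K & HK & HL).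
    (* The semigroup law is uniqueness: both curves solve the equation from [flow t z] and stay in
       the disc of radius [Cmod z]. *)
    pose proof (trajectories_close (Cmod z) s K (fun r => flow (t + r) z) (fun r => flow r (flow t z))
      Hs HK HL) as T.
    cbv beta in T. rewrite G0, Rplus_0_r in T.
    replace (flow t z - flow t z)%C with (RtoC 0) in T by ring.
    rewrite Cmod_0, !Rmult_0_l in T. rewrite Rplus_comm.
    destruct (Ceq_dec (flow (t + s) z) (flow s (flow t z))) as [|N]; auto. exfalso.
    pose proof (Cmod_pos_sub _ _ N) as P.
    assert (Cmod (flow (t + s) z - flow s (flow t z)) * Cmod (flow (t + s) z - flow s (flow t z)) <= 0)
      as T'; [|nra].
    apply T.
    + intros r Hr. destruct (HF (t + r)) as [H1 H2]; [lra|]. split; auto.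
      apply (cderiv_shift (fun r => flow r z)); auto.
    + intros r Hr. destruct (HG r Hr) as [H1 H2]. split; auto.
      destruct (HF t Ht); lra.
  - intros t z Ht Hz. destruct (flow_trajectory z Hz) as [F0 HF].
    apply (filterlim_filter_le_1 (F := locally t)); [apply filter_le_within|].
    eapply cderiv_continuous. apply (HF t Ht).
  - intros z Hz. apply cdiff_ex_derive; auto.
  - intros z Hz. destruct (flow_trajectory z Hz) as [F0 HF].
    destruct (HF 0 (Rle_refl 0)) as [_ D]. rewrite F0 in D.
    apply filterlim_C_iff; [apply at_right_proper_filter|]. intros e He.
    assert (0 < e / 2) as He2 by lra.
    destruct (cderiv_linear_approx _ _ _ D _ He2) as (d & Hd & H).
    exists (mkposreal d Hd). intros t Ht Htp. change (Rabs (t - 0) < d) in Ht.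
    specialize (H t Ht). rewrite F0, !Rminus_0_r in H. rewrite Rabs_pos_eq in H by lra.
    assert (RtoC t <> 0) as Nt by (intros E; apply RtoC_inj in E; lra).
    replace (/ RtoC t * (z - flow t z) - h z)%C
      with (- (flow t z - z - RtoC t * - h z) / RtoC t)%C by (field; auto).
    rewrite Cmod_div, Cmod_opp, Cmod_R, Rabs_pos_eq by (auto; lra).
    apply Rle_lt_trans with (e / 2); [|lra].
    apply Rmult_le_reg_r with t; auto. unfold Rdiv at 1; rewrite Rmult_assoc, Rinv_l by lra. lra.
Qed.

End Flow.

(** * Generators vanishing at the Denjoy-Wolff point 0 *)


(** The generator controls right derivatives only, so the mean value theorem does not apply.
    Instead, the supremum of the times with [|phi t - phi 0| <= e * t] has this property by
    continuity, and the zero right derivative pushes it up to [T]. *)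
Lemma right_derivative_zero_constant (phi : R -> C) :
  (forall t, 0 <= t -> filterlim phi (within (fun s => 0 <= s) (locally t)) (locally (phi t))) ->
  (forall t e, 0 <= t -> 0 < e -> exists d, 0 < d /\ forall r, 0 < r < d ->
     Cmod (phi (t + r) - phi t) <= e * r) ->
  forall t, 0 <= t -> phi t = phi 0.
Proof.
  intros Hc Hd T HT.
  assert (forall t, 0 <= t -> forall e, 0 < e -> exists d, 0 < d /\ forall s, 0 <= s ->
    Rabs (s - t) < d -> Cmod (phi s - phi t) < e) as Hc'.
  { intros t Ht e He. specialize (Hc t Ht).
    apply filterlim_C_iff with (e := e) in Hc; [|apply within_filter, locally_filter|auto].
    destruct Hc as [d H]. exists d; split; [apply cond_pos|]. intros s Hs Hst. apply H; auto. }
  clear Hc.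
  assert (forall e, 0 < e -> Cmod (phi T - phi 0) <= e * T) as H.
  { intros e He.
    set (E := fun t => 0 <= t <= T /\ Cmod (phi t - phi 0) <= e * t).
    destruct (completeness E) as [m [U L]].
    - exists T. intros t [Ht _]; lra.
    - exists 0. split; [lra|]. replace (phi 0 - phi 0)%C with (RtoC 0) by ring.
      rewrite Cmod_0; lra.
    - assert (0 <= m) as M0.
      { apply U. split; [lra|]. replace (phi 0 - phi 0)%C with (RtoC 0) by ring.
        rewrite Cmod_0; lra. }
      assert (m <= T) as MT by (apply L; intros t [Ht _]; lra).
      assert (Cmod (phi m - phi 0) <= e * m) as Em.
      { apply le_of_le_add_eps with (c := 1). intros k Hk.
        destruct (Hc' m M0 k Hk) as (d & Hd0 & H).
        assert (exists t, E t /\ m - d < t) as (t & Et & Ht).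
        { apply NNPP; intros N. assert (m <= m - d); [|lra].
          apply L. intros t Et. apply Rnot_lt_le; intros Q. apply N; exists t; auto. }
        pose proof (U t Et) as Htm. destruct Et as [[Ht0 _] Et].
        specialize (H t Ht0 ltac:(apply Rabs_def1; lra)).
        replace (phi m - phi 0)%C with ((phi t - phi 0) - (phi t - phi m))%C by ring.
        eapply Rle_trans; [apply Cmod_minus_le|].
        assert (e * t <= e * m) by (apply Rmult_le_compat_l; lra). lra. }
      destruct MT as [MT| <-]; auto. exfalso.
      destruct (Hd m e M0 He) as (d & Hd0 & H).
      set (r := Rmin (d / 2) (T - m)).
      assert (0 < r) by (apply Rmin_glb_lt; lra).
      pose proof (Rmin_l (d / 2) (T - m)) as R1; pose proof (Rmin_r (d / 2) (T - m)) as R2.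
      fold r in R1, R2. specialize (H r ltac:(lra)).
      assert (m + r <= m); [|lra]. apply U. split; [lra|].
      replace (phi (m + r)%R - phi 0)%C with ((phi (m + r)%R - phi m) + (phi m - phi 0))%C by ring.
      eapply Rle_trans; [apply Cmod_triangle|]. lra. }
  destruct (Ceq_dec (phi T) (phi 0)) as [|N]; auto. exfalso.
  pose proof (Cmod_pos_sub _ _ N) as P.
  specialize (H (Cmod (phi T - phi 0) / (2 * (T + 1)))).
  assert (0 < Cmod (phi T - phi 0) / (2 * (T + 1))) as Q by (apply Rdiv_lt_0_compat; lra).
  specialize (H Q). set (x := Cmod (phi T - phi 0) / (2 * (T + 1))) in *.
  assert (x * (2 * (T + 1)) = Cmod (phi T - phi 0)) by (unfold x; field; lra). nra.
Qed.

Lemma Re_Cinv_nonneg (z : C) : 0 <= Re z -> 0 <= Re (/ z)%C.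
Proof.
  intros H. change (0 <= Re z * / (Re z ^ 2 + Im z ^ 2)).
  destruct (Req_dec (Re z ^ 2 + Im z ^ 2) 0) as [E|E].
  - rewrite E, Rinv_0; lra.
  - apply Rmult_le_pos; auto. apply Rlt_le, Rinv_0_lt_compat.
    pose proof (pow2_ge_0 (Re z)); pose proof (pow2_ge_0 (Im z)); lra.
Qed.

Lemma Re_conj_mult (z w : C) : Re (Cconj z * (z * w))%C = Cmod z * Cmod z * Re w.
Proof. rewrite Cmod_sqr. unfold Re, Im; simpl; ring. Qed.

Section AttractingOrigin.
Variables (F : R -> C -> C) (f : C -> C).
Hypothesis HF : semigroup F.
Hypothesis Hf : generator_of F f.
Hypothesis HDW : denjoy_wolff_point F 0.

Lemma in_disk_0 : in_disk 0.
Proof. unfold in_disk; rewrite Cmod_0; lra. Qed.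

Lemma semigroup_cdiff (t : R) (z : C) : 0 <= t -> Cmod z < 1 -> cdiff (F t) z.
Proof. intros Ht Hz. destruct HF as (H & _). apply cdiff_ex_derive, (proj1 (H t Ht)), Hz. Qed.

Lemma semigroup_attracted (z : C) : Cmod z < 1 ->
  forall e, 0 < e -> exists T, forall t, T < t -> Cmod (F t z) < e.
Proof.
  intros Hz e He. destruct HDW as (_ & _ & _ & H). specialize (H z Hz).
  apply filterlim_C_iff with (e := e) in H; [|apply Rbar_locally_filter|auto].
  destruct H as [T H]. exists T. intros t Ht. specialize (H t Ht).
  replace (F t z - 0)%C with (F t z) in H by ring. exact H.
Qed.

(** As [s] grows, [F s 0] and [F t (F s 0) = F (t + s) 0] both tend to 0, and [F t] is continuous at
    0. *)
Lemma semigroup_fixes_0 (t : R) : 0 <= t -> F t 0 = 0.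
Proof.
  intros Ht. destruct (Ceq_dec (F t 0) 0) as [|N]; auto. exfalso.
  pose proof (proj1 (Cmod_gt_0 _) N) as P. pose proof in_disk_0 as D0.
  assert (0 < Cmod (F t 0) / 2) as P2 by lra.
  destruct (proj1 (continuous_C_iff (F t) 0) (cdiff_continuous _ _ (semigroup_cdiff t 0 Ht D0)) _ P2)
    as (d & Hd & H).
  destruct (semigroup_attracted 0 D0 d Hd) as [T1 H1].
  destruct (semigroup_attracted 0 D0 _ P2) as [T2 H2].
  set (s := Rmax 0 (Rmax T1 T2) + 1).
  pose proof (Rmax_l 0 (Rmax T1 T2)); pose proof (Rmax_r 0 (Rmax T1 T2)).
  pose proof (Rmax_l T1 T2); pose proof (Rmax_r T1 T2).
  specialize (H (F s 0)). specialize (H1 s ltac:(unfold s; lra)).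
  specialize (H2 (t + s) ltac:(unfold s; lra)).
  replace (F s 0 - 0)%C with (F s 0) in H by ring. specialize (H H1).
  destruct HF as (_ & _ & HS & _).
  rewrite <- HS in H by (auto; unfold s; lra).
  pose proof (Cmod_triangle_sub (F t 0) (F (t + s) 0)) as T. rewrite Cmod_sub_sym in T. lra.
Qed.

Lemma semigroup_contracts (t : R) (z : C) : 0 <= t -> Cmod z < 1 -> Cmod (F t z) <= Cmod z.
Proof.
  intros Ht. apply schwarz_lemma.
  - intros w Hw; apply semigroup_cdiff; auto.
  - intros w Hw. destruct HF as (H & _). apply Rlt_le. apply (proj2 (H t Ht)), Hw.
  - apply semigroup_fixes_0; auto.
Qed.

Lemma generator_approx (z : C) : Cmod z < 1 -> forall e, 0 < e ->
  exists d, 0 < d /\ forall t, 0 < t < d -> Cmod (/ RtoC t * (z - F t z) - f z)%C < e.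
Proof.
  intros Hz e He. destruct Hf as [_ H]. specialize (H z Hz).
  apply filterlim_C_iff with (e := e) in H; [|apply at_right_proper_filter|auto].
  destruct H as [d H]. exists d; split; [apply cond_pos|]. intros t Ht. apply H; [|lra].
  change (Rabs (t - 0) < d). apply Rabs_def1; lra.
Qed.

Lemma generator_cdiff (z : C) : Cmod z < 1 -> cdiff f z.
Proof. intros Hz. apply cdiff_ex_derive, Hf, Hz. Qed.

Lemma generator_vanishes_at_0 : f 0 = 0.
Proof.
  destruct (Ceq_dec (f 0) 0) as [|N]; auto. exfalso.
  destruct (generator_approx 0 in_disk_0 _ (proj1 (Cmod_gt_0 _) N)) as (d & Hd & H).
  specialize (H (d / 2) ltac:(lra)). rewrite semigroup_fixes_0 in H by lra.
  replace (/ RtoC (d / 2) * (0 - 0) - f 0)%C with (- f 0)%C in H by ring.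
  rewrite Cmod_opp in H; lra.
Qed.

(** Contraction gives [Re (conj z * (z - F t z)) >= 0]; division by [t] and the limit preserve the
    sign. *)
Lemma generator_dissipative (z : C) : Cmod z < 1 -> 0 <= Re (Cconj z * f z)%C.
Proof.
  intros Hz. apply Rnot_lt_le; intros L.
  destruct (generator_approx z Hz (- Re (Cconj z * f z)%C)) as (d & Hd & H); [lra|].
  specialize (H (d / 2) ltac:(lra)).
  set (t := d / 2) in *. assert (0 < t) as Ht by (unfold t; lra).
  set (a := (/ RtoC t * (z - F t z))%C) in *.
  assert (0 <= Re (Cconj z * a)%C) as P.
  { unfold a. rewrite <- RtoC_inv by lra.
    replace (Cconj z * (RtoC (/ t) * (z - F t z)))%C
      with (RtoC (/ t) * (Cconj z * z - Cconj z * F t z))%C by ring.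
    replace (Re (RtoC (/ t) * (Cconj z * z - Cconj z * F t z))%C)
      with (/ t * (Cmod z * Cmod z - Re (Cconj z * F t z)%C)).
    2:{ rewrite Cmod_sqr. unfold Re, Im; simpl; ring. }
    apply Rmult_le_pos; [apply Rlt_le, Rinv_0_lt_compat; auto|].
    pose proof (Cmod_re_bound (Cconj z * F t z)%C) as B. rewrite Cmod_mult, Cmod_conj in B.
    pose proof (semigroup_contracts t z ltac:(lra) Hz). pose proof (Cmod_ge_0 z). nra. }
  replace (Cconj z * a)%C with (Cconj z * f z + Cconj z * (a - f z))%C in P by ring.
  rewrite re_plus in P. pose proof (Cmod_re_bound (Cconj z * (a - f z))%C) as B.
  rewrite Cmod_mult, Cmod_conj in B. pose proof (Cmod_ge_0 z); pose proof (Cmod_ge_0 (a - f z)).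
  nra.
Qed.

(** A vanishing generator would freeze every orbit, but the orbit of 1/2 tends to 0. Through
    [re_nonneg_zero] this frees [slope f 0] of zeros. *)
Lemma generator_not_zero : exists z, Cmod z < 1 /\ f z <> 0.
Proof.
  apply NNPP; intros N.
  assert (forall z, Cmod z < 1 -> f z = 0) as Hz.
  { intros z Hz. destruct (Ceq_dec (f z) 0); auto. exfalso; apply N; exists z; auto. }
  destruct HF as (H1 & H2 & H3 & H4).
  set (z := RtoC (/ 2)). assert (Cmod z = / 2) as Ez by (unfold z; rewrite Cmod_R, Rabs_pos_eq; lra).
  assert (Cmod z < 1) as Dz by lra.
  assert (forall t, 0 <= t -> F t z = F 0 z) as K.
  { apply (right_derivative_zero_constant (fun t => F t z)).
    - intros t Ht. apply H4; auto.
    - intros t e Ht He.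
      assert (Cmod (F t z) < 1) as Dt by (apply (proj2 (H1 t Ht)); auto).
      destruct (generator_approx (F t z) Dt e He) as (d & Hd & H).
      exists d; split; auto. intros r Hr. specialize (H r Hr).
      rewrite (Hz _ Dt) in H. rewrite Rplus_comm, H3 by (auto; lra).
      assert (RtoC r <> 0) as Nr by (intros E; apply RtoC_inj in E; lra).
      replace (F r (F t z) - F t z)%C with (- RtoC r * (/ RtoC r * (F t z - F r (F t z)) - 0))%C
        by (field; auto).
      rewrite Cmod_mult, Cmod_opp, Cmod_R, Rabs_pos_eq by lra. nra. }
  destruct (semigroup_attracted z Dz (/ 2)) as [T HT]; [lra|].
  specialize (HT (Rmax 0 T + 1)). pose proof (Rmax_l 0 T); pose proof (Rmax_r 0 T).
  rewrite K, H2 in HT by (auto; lra). specialize (HT ltac:(lra)). lra.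
Qed.

Lemma quotient_continuous (z : C) : Cmod z < 1 -> continuous (slope f 0) z.
Proof. intros Hz. apply slope_continuous; apply generator_cdiff; auto using in_disk_0. apply in_disk_0. Qed.

Lemma quotient_cdiff (z : C) : Cmod z < 1 -> z <> 0 -> cdiff (slope f 0) z.
Proof. intros Hz N. apply slope_cdiff; auto; apply generator_cdiff; auto. apply in_disk_0. Qed.

Lemma generator_factor (z : C) : f z = (z * slope f 0 z)%C.
Proof.
  destruct (slope_spec f 0 (generator_cdiff 0 in_disk_0)) as [_ E].
  rewrite (E z), generator_vanishes_at_0. ring.
Qed.

Lemma quotient_re_nonneg (z : C) : Cmod z < 1 -> 0 <= Re (slope f 0 z).
Proof.
  intros Hz.
  assert (forall w, Cmod w < 1 -> w <> 0 -> 0 <= Re (slope f 0 w)) as H.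
  { intros w Hw N. pose proof (generator_dissipative w Hw) as P.
    rewrite generator_factor, Re_conj_mult in P.
    pose proof (proj1 (Cmod_gt_0 _) N).
    assert (0 < Cmod w * Cmod w) by nra. nra. }
  (* At 0 dissipativity says nothing; the sign comes by continuity from small positive reals. *)
  destruct (Ceq_dec z 0) as [->|N]; auto.
  apply Rnot_lt_le; intros L.
  destruct (proj1 (continuous_C_iff _ _) (quotient_continuous 0 Hz) (- Re (slope f 0 0)))
    as (d & Hd & K); [lra|].
  set (x := Rmin (d / 2) (/ 2)).
  assert (0 < x) by (apply Rmin_glb_lt; lra).
  pose proof (Rmin_l (d / 2) (/ 2)) as M1; pose proof (Rmin_r (d / 2) (/ 2)) as M2; fold x in M1, M2.
  assert (Cmod (RtoC x) = x) as Ex by (rewrite Cmod_R, Rabs_pos_eq; lra).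
  assert (RtoC x <> 0) as Nx by (intros E; apply RtoC_inj in E; lra).
  specialize (H x ltac:(lra) Nx). specialize (K x).
  replace (RtoC x - 0)%C with (RtoC x) in K by ring. specialize (K ltac:(lra)).
  pose proof (Cmod_re_bound (slope f 0 x - slope f 0 0)) as B.
  assert (Re (slope f 0 x - slope f 0 0)%C = Re (slope f 0 x) - Re (slope f 0 0)) as E
    by (unfold Re; simpl; ring).
  lra.
Qed.

Lemma quotient_nonzero (z : C) : Cmod z < 1 -> slope f 0 z <> 0.
Proof.
  intros Hz E. destruct generator_not_zero as (w & Hw & N). apply N.
  rewrite generator_factor.
  rewrite (re_nonneg_zero (slope f 0) 0 quotient_continuous quotient_cdiff quotient_re_nonneg w z);
    auto; ring.
Qed.

(** The function [z / f z] with the singularity at 0 filled in. *)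
Definition reciprocal (z : C) : C := (/ slope f 0 z)%C.

Lemma reciprocal_continuous (z : C) : Cmod z < 1 -> continuous reciprocal z.
Proof. intros Hz; apply continuous_Cinv; [apply quotient_continuous|apply quotient_nonzero]; auto. Qed.

Lemma reciprocal_cdiff (z : C) : Cmod z < 1 -> z <> 0 -> cdiff reciprocal z.
Proof. intros Hz N; apply cdiff_inv; [apply quotient_cdiff|apply quotient_nonzero]; auto. Qed.

Lemma reciprocal_re_nonneg (z : C) : Cmod z < 1 -> 0 <= Re (reciprocal z).
Proof. intros Hz; apply Re_Cinv_nonneg, quotient_re_nonneg; auto. Qed.

End AttractingOrigin.

(** * Boundary null points *)


Lemma angular_lim_iff (g : C -> C) (zeta l : C) :
  angular_lim g zeta l <-> forall M e, 1 < M -> 0 < e -> exists d, 0 < d /\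
    forall z, Cmod (z - zeta) < d -> stolz zeta M z -> Cmod (g z - l) < e.
Proof.
  split.
  - intros H M e HM He. specialize (H M HM).
    apply filterlim_C_iff with (e := e) in H; [|apply within_filter, locally_filter|auto].
    apply locally_C_iff in H. exact H.
  - intros H M HM. apply filterlim_C_iff; [apply within_filter, locally_filter|].
    intros e He. apply locally_C_iff. exact (H M e HM He).
Qed.

Lemma angular_lim_ext (g h : C -> C) (zeta l : C) :
  Cmod zeta = 1 -> (forall z, Cmod z < 1 -> z <> 0 -> g z = h z) ->
  angular_lim g zeta l -> angular_lim h zeta l.
Proof.
  intros Hz E H. apply angular_lim_iff. intros M e HM He.
  destruct (proj1 (angular_lim_iff _ _ _) H M e HM He) as (d & Hd & K).
  exists (Rmin d 1); split; [apply Rmin_glb_lt; lra|].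
  intros z Hzd Hs. pose proof (Rmin_l d 1); pose proof (Rmin_r d 1).
  rewrite <- E; [apply K; auto; lra|apply Hs|]. intros ->.
  replace (0 - zeta)%C with (- zeta)%C in Hzd by ring. rewrite Cmod_opp in Hzd; lra.
Qed.

Lemma angular_lim_continuous (g : C -> C) (zeta : C) :
  continuous g zeta -> angular_lim g zeta (g zeta).
Proof.
  intros H. apply angular_lim_iff. intros M e _ He.
  destruct (proj1 (continuous_C_iff g zeta) H e He) as (d & Hd & K).
  exists d; split; auto.
Qed.

Lemma angular_lim_minus (g h : C -> C) (zeta a b : C) :
  angular_lim g zeta a -> angular_lim h zeta b ->
  angular_lim (fun z => g z - h z)%C zeta (a - b)%C.
Proof.
  rewrite !angular_lim_iff. intros H1 H2 M e HM He.
  destruct (H1 M (e / 2)) as (d1 & P1 & K1); auto; [lra|].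
  destruct (H2 M (e / 2)) as (d2 & P2 & K2); auto; [lra|].
  exists (Rmin d1 d2); split; [apply Rmin_glb_lt; auto|]. intros z Hz Hs.
  pose proof (Rmin_l d1 d2); pose proof (Rmin_r d1 d2).
  replace (g z - h z - (a - b))%C with ((g z - a) - (h z - b))%C by ring.
  eapply Rle_lt_trans; [apply Cmod_minus_le|].
  specialize (K1 z ltac:(lra) Hs); specialize (K2 z ltac:(lra) Hs); lra.
Qed.

Lemma angular_lim_div (g h : C -> C) (zeta a b : C) :
  b <> 0 -> angular_lim g zeta a -> angular_lim h zeta b ->
  angular_lim (fun z => g z / h z)%C zeta (a / b)%C.
Proof.
  intros Nb. rewrite !angular_lim_iff. intros H1 H2 M e HM He.
  pose proof (proj1 (Cmod_gt_0 _) Nb) as Pb. set (x := Cmod b) in *.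
  set (y := Cmod a). assert (0 <= y) by apply Cmod_ge_0.
  (* The first bound keeps [|h z| >= x / 2]; the second makes the numerator of the error at most
     [e * x^2 / 4]. *)
  set (k := Rmin (x / 2) (e * (x * x) / (4 * (x + y)))).
  assert (0 < x * x) by nra.
  assert (0 < k) as Hk.
  { apply Rmin_glb_lt; [lra|]. apply Rdiv_lt_0_compat; [|lra]. apply Rmult_lt_0_compat; auto. }
  pose proof (Rmin_l (x / 2) (e * (x * x) / (4 * (x + y)))) as M1.
  pose proof (Rmin_r (x / 2) (e * (x * x) / (4 * (x + y)))) as M2. fold k in M1, M2.
  destruct (H1 M k) as (d1 & P1 & K1); auto. destruct (H2 M k) as (d2 & P2 & K2); auto.
  exists (Rmin d1 d2); split; [apply Rmin_glb_lt; auto|]. intros z Hz Hs.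
  pose proof (Rmin_l d1 d2); pose proof (Rmin_r d1 d2).
  specialize (K1 z ltac:(lra) Hs); specialize (K2 z ltac:(lra) Hs).
  pose proof (Cmod_triangle_sub b (h z)) as T. rewrite Cmod_sub_sym in T. fold x in T.
  set (w := Cmod (h z)) in *. assert (x / 2 <= w) as Hw by lra.
  assert (h z <> 0) as Nh by (apply Cmod_gt_0; fold w; lra).
  replace (g z / h z - a / b)%C with (((g z - a) * b - a * (h z - b)) / (h z * b))%C
    by (field; auto).
  rewrite Cmod_div, Cmod_mult by (apply Cmult_neq_0; auto). fold x w.
  apply Rmult_lt_reg_r with (w * x); [apply Rmult_lt_0_compat; lra|].
  unfold Rdiv; rewrite Rmult_assoc, Rinv_l, Rmult_1_r by (apply Rgt_not_eq, Rmult_lt_0_compat; lra).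
  eapply Rle_lt_trans; [apply Cmod_minus_le|]. rewrite !Cmod_mult. fold x y.
  assert (Cmod (g z - a) * x <= k * x) by (apply Rmult_le_compat_r; lra).
  assert (y * Cmod (h z - b) <= y * k) by (apply Rmult_le_compat_l; lra).
  assert (k * (4 * (x + y)) <= e * (x * x)).
  { apply (Rmult_le_compat_r (4 * (x + y))) in M2; [|lra].
    replace (e * (x * x) / (4 * (x + y)) * (4 * (x + y))) with (e * (x * x)) in M2 by (field; lra).
    exact M2. }
  assert (e * (x / 2 * x) <= e * (w * x)).
  { apply Rmult_le_compat_l; [lra|]. apply Rmult_le_compat_r; lra. }
  assert (0 < e * (x * x)) by (apply Rmult_lt_0_compat; auto).
  lra.
Qed.

(** For such [s] one has [|1 - s * v|^2 <= 1 - s], so the distance to the circle is at least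
    [s / 2], against the distance [s * |v|] to [zeta]; the added 1 in the aperture makes the
    inequality strict. *)
Lemma stolz_segment (zeta : C) (k s : R) :
  Cmod zeta = 1 -> 0 < s -> s * (1 + k * k) <= 1 ->
  let v : C := (1, k) in
  stolz zeta (2 * Cmod v + 1) (zeta * (1 - s * v))%C /\
  Cmod (zeta * (1 - s * v) - zeta) = s * Cmod v /\ 1 <= Cmod v.
Proof.
  intros Hz Hs Hk v.
  pose proof (Cmod_sqr v) as V. change (Re v) with 1 in V; change (Im v) with k in V.
  pose proof (Cmod_ge_0 v) as V0.
  assert (1 <= Cmod v) as V1 by nra.
  set (x := Cmod (1 - s * v)).
  assert (x * x = 1 - 2 * s + s * (s * (1 + k * k))) as X.
  { unfold x. rewrite Cmod_sqr. unfold Re, Im, v; simpl; ring. }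
  assert (0 <= x) as X0 by apply Cmod_ge_0.
  assert (x * x <= 1 - s) as X1 by nra.
  assert (Cmod (zeta * (1 - s * v))%C = x) as E1 by (rewrite Cmod_mult, Hz; unfold x; ring).
  assert (Cmod (zeta * (1 - s * v) - zeta)%C = s * Cmod v) as E2.
  { replace (zeta * (1 - s * v) - zeta)%C with (- (zeta * (s * v)))%C by ring.
    rewrite Cmod_opp, !Cmod_mult, Hz, Cmod_R, Rabs_pos_eq by lra. ring. }
  repeat split; auto.
  - unfold in_disk. rewrite E1. nra.
  - rewrite E1, E2. assert (s / 2 <= 1 - x) by nra. nra.
Qed.

Section BoundaryNullPoint.
Variables (F : R -> C -> C) (f : C -> C).
Hypothesis HF : semigroup F.
Hypothesis Hf : generator_of F f.
Hypothesis HDW : denjoy_wolff_point F 0.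
Variables (zeta d : C).
Hypothesis Hzeta : Cmod zeta = 1.
Hypothesis Hd : angular_lim (fun z => f z / (z - zeta))%C zeta d.

Let p := slope f 0.

Lemma boundary_neq (z : C) : Cmod z < 1 -> z <> zeta.
Proof. intros H ->; lra. Qed.

(* Along [zeta * (1 - s v)], [Re v > 0], one has [p = - s d v + o(s)], so [Re p >= 0]
   forces [Re (d v) <= 0]; all the slopes [k] are needed to see that [d] is real. *)
Lemma boundary_derivative_re (k : R) : Re d - k * Im d <= 0.
Proof.
  apply Rnot_lt_le; intros L. set (v := (1, k) : C).
  set (x := Re d - k * Im d) in *.
  pose proof (Cmod_sqr v) as V. change (Re v) with 1 in V; change (Im v) with k in V.
  pose proof (Cmod_ge_0 v) as V0. assert (1 <= Cmod v) as V1 by nra.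
  set (n := Cmod v) in *. set (m := Cmod d). assert (0 <= m) by apply Cmod_ge_0.
  set (e := Rmin 1 (x / (4 * n))).
  assert (0 < e) as He by (apply Rmin_glb_lt; [lra|apply Rdiv_lt_0_compat; lra]).
  assert (e <= 1) as He1 by apply Rmin_l.
  assert (e * n <= x / 4) as He2.
  { pose proof (Rmin_r 1 (x / (4 * n))) as Q; fold e in Q.
    apply (Rmult_le_compat_r n) in Q; [|lra].
    replace (x / (4 * n) * n) with (x / 4) in Q by (field; lra). exact Q. }
  destruct (proj1 (angular_lim_iff _ _ _) Hd (2 * n + 1) e) as (r & Hr & K); [lra|auto|].
  (* The three bounds put the point into the Stolz region, put it within [r] of [zeta], and keep the
     second-order term below [x / 4]. With [e * n <= x / 4], half of [x] survives as a
     contradiction. *)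
  set (s := Rmin (/ (n * n)) (Rmin (r / (2 * n)) (x / (4 * (n * n * (m + 1)))))).
  assert (0 < n * n) as N2 by nra.
  assert (0 < n * n * (m + 1)) as N3 by (apply Rmult_lt_0_compat; lra).
  assert (0 < s) as Hs.
  { repeat apply Rmin_glb_lt; [apply Rinv_0_lt_compat; lra| |]; apply Rdiv_lt_0_compat; lra. }
  assert (s * (n * n) <= 1 /\ s * n < r /\ s * (n * n * (m + 1)) <= x / 4) as (S1 & S2 & S3).
  { pose proof (Rmin_l (/ (n * n)) (Rmin (r / (2 * n)) (x / (4 * (n * n * (m + 1)))))) as A.
    pose proof (Rmin_r (/ (n * n)) (Rmin (r / (2 * n)) (x / (4 * (n * n * (m + 1)))))) as B.
    fold s in A, B.
    pose proof (Rmin_l (r / (2 * n)) (x / (4 * (n * n * (m + 1))))).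
    pose proof (Rmin_r (r / (2 * n)) (x / (4 * (n * n * (m + 1))))).
    assert (s <= r / (2 * n)) as B1 by lra.
    assert (s <= x / (4 * (n * n * (m + 1)))) as B2 by lra.
    apply (Rmult_le_compat_r (n * n)) in A; [|lra]. rewrite Rinv_l in A by lra.
    apply (Rmult_le_compat_r n) in B1; [|lra].
    replace (r / (2 * n) * n) with (r / 2) in B1 by (field; lra).
    apply (Rmult_le_compat_r (n * n * (m + 1))) in B2; [|lra].
    replace (x / (4 * (n * n * (m + 1))) * (n * n * (m + 1))) with (x / 4) in B2
      by (field; repeat split; lra).
    repeat split; lra. }
  destruct (stolz_segment zeta k s Hzeta Hs) as (St & Sd & _); [nra|].
  fold v n in St, Sd. set (z := (zeta * (1 - s * v))%C) in *.
  assert (Cmod z < 1) as Dz by apply St.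
  specialize (K z ltac:(rewrite Sd; auto) St).
  set (a := (f z / (z - zeta))%C) in *.
  assert (z - zeta <> 0)%C as Nz by (apply Csub_neq_0, boundary_neq; auto).
  assert (f z = z * p z)%C as Ef by (eapply generator_factor; eauto).
  assert (zeta <> 0) as Nzeta by (intros E; rewrite E, Cmod_0 in Hzeta; lra).
  assert ((1 - s * v) * p z = - (s * (a * v)))%C as Ep.
  { assert (zeta * ((1 - s * v) * p z) = zeta * (- (s * (a * v))))%C as E.
    { transitivity (f z); [rewrite Ef; unfold z; ring|].
      transitivity (a * (z - zeta))%C; [unfold a; field; auto|]. unfold z; ring. }
    apply (f_equal (fun w => (/ zeta * w)%C)) in E.
    rewrite !Cmult_assoc, !Cinv_l, !Cmult_1_l in E by auto. rewrite E; ring. }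
  pose proof (quotient_re_nonneg F f HF Hf HDW z Dz) as P. fold p in P.
  assert (Re (Cconj (1 - s * v) * ((1 - s * v) * p z))%C
    = Cmod (1 - s * v) * Cmod (1 - s * v) * Re (p z)) as Eq by apply Re_conj_mult.
  rewrite Ep in Eq.
  assert (Re (Cconj (1 - s * v) * - (s * (a * v)))%C = s * (- Re (a * v)%C + s * (n * n) * Re a)) as E2.
  { rewrite V. unfold v, Re, Im; simpl; ring. }
  assert (0 <= - Re (a * v)%C + s * (n * n) * Re a) as P2.
  { apply Rmult_le_reg_l with s; auto. rewrite Rmult_0_r, <- E2, Eq.
    pose proof (Cmod_ge_0 (1 - s * v)). apply Rmult_le_pos; nra. }
  assert (Re (a * v)%C = x + Re ((a - d) * v)%C) as E3 by (unfold x, v, Re, Im; simpl; ring).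
  pose proof (Cmod_re_bound ((a - d) * v)%C) as B1. rewrite Cmod_mult in B1. fold n in B1.
  pose proof (Cmod_triangle_sub a d) as T. fold m in T.
  pose proof (Cmod_re_bound a) as B2.
  assert (Cmod (a - d) * n <= e * n) by (apply Rmult_le_compat_r; lra).
  assert (s * (n * n) * Re a <= s * (n * n) * (m + 1)).
  { apply Rmult_le_compat_l; [nra|lra]. }
  lra.
Qed.

(** If [d = 0], then [slope f 0] is of smaller order than [1 - |z|] along the radius, and its
    reciprocal outgrows the bound of [re_nonneg_growth]. *)
Lemma boundary_derivative_nonzero : d <> 0.
Proof.
  intros Ed.
  set (q0 := Cmod (reciprocal f 0)).
  assert (0 <= q0) as Q0 by apply Cmod_ge_0.
  (* With [s <= / 2] the smallness gives [(2 * q0 + 2) * y < s], while the growth bound says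
     [s <= 2 * q0 * y]. *)
  assert (0 < / (4 * q0 + 4)) as He by (apply Rinv_0_lt_compat; lra).
  destruct (proj1 (angular_lim_iff _ _ _) Hd 3 _ ltac:(lra) He) as (r & Hr & K).
  set (s := Rmin (/ 2) (r / 2)).
  assert (0 < s) as Hs by (apply Rmin_glb_lt; lra).
  pose proof (Rmin_l (/ 2) (r / 2)) as M1; pose proof (Rmin_r (/ 2) (r / 2)) as M2; fold s in M1, M2.
  destruct (stolz_segment zeta 0 s Hzeta Hs) as (St & Sd & _); [lra|].
  change (1, 0) with (RtoC 1) in St, Sd. rewrite Cmod_1 in St, Sd.
  replace (2 * 1 + 1) with 3 in St by ring.
  set (z := (zeta * (1 - s * 1))%C) in *.
  assert (Cmod z < 1) as Dz by apply St.
  specialize (K z ltac:(rewrite Sd; lra) St).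
  assert (Cmod z = 1 - s) as Ez.
  { unfold z. replace (1 - s * 1)%C with (RtoC (1 - s)) by (rewrite RtoC_minus; ring).
    rewrite Cmod_mult, Cmod_R, Rabs_pos_eq, Hzeta; lra. }
  rewrite Ed in K. replace (f z / (z - zeta) - 0)%C with (f z / (z - zeta))%C in K by ring.
  rewrite Cmod_div, Sd in K by (apply Csub_neq_0, boundary_neq; auto).
  rewrite (generator_factor F f HF Hf HDW), Cmod_mult, Ez in K.
  pose proof (re_nonneg_growth (reciprocal f) 0 (reciprocal_continuous F f HF Hf HDW)
    (reciprocal_cdiff F f HF Hf HDW) (reciprocal_re_nonneg F f HF Hf HDW) z Dz) as G.
  fold q0 in G. unfold reciprocal in G.
  pose proof (quotient_nonzero F f HF Hf HDW z Dz) as Np.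
  rewrite Cmod_inv, Ez in G by auto.
  pose proof (proj1 (Cmod_gt_0 _) Np) as Pp. set (y := Cmod (slope f 0 z)) in *.
  apply (Rmult_le_compat_r y) in G; [|lra].
  replace (/ y * (1 - (1 - s)) * y) with s in G by (field; lra).
  apply (Rmult_lt_compat_r (s * (4 * q0 + 4))) in K; [|apply Rmult_lt_0_compat; lra].
  replace ((1 - s) * y / (s * 1) * (s * (4 * q0 + 4))) with ((1 - s) * y * (4 * q0 + 4)) in K
    by (field; lra).
  replace (/ (4 * q0 + 4) * (s * (4 * q0 + 4))) with s in K by (field; lra).
  assert (0 <= y * (4 * q0 + 4)) by (apply Rmult_le_pos; lra).
  assert (/ 2 * (y * (4 * q0 + 4)) <= (1 - s) * (y * (4 * q0 + 4))) by (apply Rmult_le_compat_r; lra).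
  lra.
Qed.

Lemma boundary_derivative_negative : 0 < Cmod d /\ d = RtoC (- Cmod d).
Proof.
  pose proof (proj1 (Cmod_gt_0 _) boundary_derivative_nonzero) as P.
  split; auto.
  assert (Im d = 0) as I0.
  { destruct (Req_dec (Im d) 0) as [|N]; auto. exfalso.
    (* This slope makes [Re d - k * Im d] equal to 1. *)
    pose proof (boundary_derivative_re ((Re d - 1) / Im d)) as H.
    replace ((Re d - 1) / Im d * Im d) with (Re d - 1) in H by (field; auto). lra. }
  pose proof (boundary_derivative_re 0) as R0.
  pose proof (Cmod_sqr d) as S. rewrite I0 in S.
  apply C_eq; simpl; [|exact I0]. nra.
Qed.

(** Since [d] is minus its modulus, the limit is [- zeta / |d|], which is the one found in
    [poisson_term_residue_same] for [m = |d|]. *)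
Lemma reciprocal_residue :
  angular_lim (fun z => (z - zeta) * reciprocal f z)%C zeta (zeta / d)%C.
Proof.
  apply angular_lim_ext with (fun z => z / (f z / (z - zeta)))%C; auto.
  - intros z Hz N. rewrite (generator_factor F f HF Hf HDW). unfold reciprocal.
    pose proof (quotient_nonzero F f HF Hf HDW z Hz).
    pose proof (Csub_neq_0 _ _ (boundary_neq z Hz)).
    field; auto.
  - apply angular_lim_div; auto; [apply boundary_derivative_nonzero|].
    apply (angular_lim_continuous (fun z => z)), continuous_id.
Qed.

End BoundaryNullPoint.

(** On the radius, [z - zeta = - (1 - s) * zeta]. This is the form of the limit that
    [julia_half_plane] takes. *)
Lemma angular_residue_radial (g : C -> C) (zeta : C) (L : R) :
  Cmod zeta = 1 ->
  angular_lim (fun z => (z - zeta) * g z)%C zeta (- (L * zeta))%C ->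
  forall e, 0 < e -> exists d, 0 < d /\ forall s, 1 - d < s < 1 ->
    Cmod ((1 - s) * g (s * zeta) - L)%C < e.
Proof.
  intros Hz H e He.
  destruct (proj1 (angular_lim_iff _ _ _) H 3 e ltac:(lra) He) as (r & Hr & K).
  exists (Rmin 1 r); split; [apply Rmin_glb_lt; lra|]. intros s Hs.
  pose proof (Rmin_l 1 r); pose proof (Rmin_r 1 r).
  destruct (stolz_segment zeta 0 (1 - s) Hz) as (St & Sd & _); try lra.
  change (1, 0) with (RtoC 1) in St, Sd. rewrite Cmod_1 in St, Sd.
  replace (2 * 1 + 1) with 3 in St by ring.
  replace (zeta * (1 - RtoC (1 - s) * 1))%C with (s * zeta)%C in St, Sd
    by (rewrite RtoC_minus; ring).
  specialize (K (s * zeta)%C ltac:(rewrite Sd; lra) St).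
  replace ((s * zeta - zeta) * g (s * zeta) - - (L * zeta))%C
    with (- (zeta * ((1 - s) * g (s * zeta) - L)))%C in K by ring.
  rewrite Cmod_opp, Cmod_mult, Hz, Rmult_1_l in K. exact K.
Qed.

(** * Poisson kernels of boundary points *)

Section PoissonTerm.
Variables (zeta eta : C) (m : R).
Hypothesis Hzeta : Cmod zeta = 1.
Hypothesis Heta : Cmod eta = 1.
Hypothesis Hne : eta <> zeta.
Hypothesis Hm : 0 < m.

Definition rotation_ratio : C := (Cconj zeta * eta / (Cconj zeta * eta - 1))%C.

(* [z] times the summand of the theorem; its real part is half a Poisson kernel. *)
Definition poisson_term (z : C) : C := (RtoC (/ m) * (rotation_ratio - z / (z - zeta)))%C.

(** The map [w / (w - 1)] takes the unit circle without 1 to the line of real part 1/2, so [eta]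
    influences only an imaginary constant. *)
Lemma rotation_ratio_re : Re rotation_ratio = / 2.
Proof.
  unfold rotation_ratio. set (w := (Cconj zeta * eta)%C).
  assert (Cmod w = 1) as Hw by (unfold w; rewrite Cmod_mult, Cmod_conj, Hzeta, Heta; ring).
  pose proof (Cmod_sqr w) as S. rewrite Hw in S.
  assert (Re w <> 1) as N.
  { intros E. apply Hne.
    assert (Im w = 0) as I by nra.
    assert (w = 1) as Ew by (apply C_eq; auto).
    assert (zeta * w = eta)%C as Ee.
    { unfold w. rewrite Cmult_assoc, <- Cmod2_conj, Hzeta. simpl; rewrite !Rmult_1_l; ring. }
    rewrite <- Ee, Ew; ring. }
  replace (Re (w / (w - 1))%C) with ((Re w * Re w + Im w * Im w - Re w)
    / ((Re w - 1) ^ 2 + Im w ^ 2)).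
  - replace ((Re w - 1) ^ 2 + Im w ^ 2) with (2 * (1 - Re w)) by (unfold pow; lra).
    rewrite <- S. field. lra.
  - unfold Re, Im in *; simpl in *. field.
    intros E. apply N. nra.
Qed.

(** Multiplied out so as to match the conclusion of [julia_half_plane] with [L = / m]. *)
Lemma poisson_term_re (z : C) : Cmod z < 1 ->
  Re (poisson_term z) * (2 * (Cmod (zeta - z) * Cmod (zeta - z))) = / m * (1 - Cmod z * Cmod z).
Proof.
  intros Hz. unfold poisson_term.
  assert (z <> zeta) as N by (intros ->; lra).
  pose proof (Cmod_pos_sub zeta z (fun E => N (eq_sym E))) as P.
  pose proof (Cmod_sqr (zeta - z)) as S. pose proof (Cmod_sqr zeta) as S1. rewrite Hzeta in S1.
  set (X := Cmod (zeta - z)) in *.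
  rewrite re_scal_l. unfold Cminus at 1. rewrite re_plus, rotation_ratio_re.
  assert (Re (- (z / (z - zeta)))%C * (X * X) = Re z * Re zeta + Im z * Im zeta - Cmod z * Cmod z)
    as E.
  { replace (- (z / (z - zeta)))%C with (z / (zeta - z))%C.
    2:{ field; split; apply Csub_neq_0; auto. }
    rewrite S, Cmod_sqr. unfold Re, Im in *; simpl in *. field. nra. }
  rewrite Cmod_sqr in E |- *.
  assert (X * X = 1 - 2 * (Re z * Re zeta + Im z * Im zeta) + (Re z * Re z + Im z * Im z)) as EX.
  { rewrite S. unfold Re, Im in *; simpl in *; lra. }
  rewrite Rmult_assoc. f_equal. lra.
Qed.

Lemma poisson_term_cdiff (z : C) : z <> zeta -> cdiff poisson_term z.
Proof.
  intros Hz. apply cdiff_mult; [apply cdiff_const|].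
  apply cdiff_minus; [apply cdiff_const|].
  apply cdiff_div; [apply cdiff_id| |apply Csub_neq_0; auto].
  apply cdiff_minus; [apply cdiff_id|apply cdiff_const].
Qed.

Lemma poisson_term_residue_same :
  angular_lim (fun z => (z - zeta) * poisson_term z)%C zeta (- (RtoC (/ m) * zeta))%C.
Proof.
  apply angular_lim_ext with (fun z => RtoC (/ m) * (rotation_ratio * (z - zeta) - z))%C; auto.
  - intros z Hz _. unfold poisson_term. field. apply Csub_neq_0. intros ->; lra.
  - replace (- (RtoC (/ m) * zeta))%C
      with (RtoC (/ m) * (rotation_ratio * (zeta - zeta) - zeta))%C by ring.
    apply (angular_lim_continuous (fun z => RtoC (/ m) * (rotation_ratio * (z - zeta) - z))%C).
    apply continuous_Cmult; [apply continuous_const|].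
    apply continuous_Cminus; [|apply continuous_id].
    apply continuous_Cmult; [apply continuous_const|].
    apply continuous_Cminus; [apply continuous_id|apply continuous_const].
Qed.

Lemma poisson_term_residue_other (xi : C) :
  xi <> zeta -> angular_lim (fun z => (z - xi) * poisson_term z)%C xi 0.
Proof.
  intros N.
  replace (RtoC 0) with ((xi - xi) * poisson_term xi)%C by ring.
  apply (angular_lim_continuous (fun z => (z - xi) * poisson_term z)%C).
  apply continuous_Cmult.
  - apply continuous_Cminus; [apply continuous_id|apply continuous_const].
  - apply cdiff_continuous, poisson_term_cdiff; auto.
Qed.

End PoissonTerm.

(** * The decomposition *)


(** The quotient is [z / ((z - zeta) * g z)]: the denominator tends to 0 and the numerator has
    modulus at least 1/2 near [zeta]. *)
Lemma angular_lim_infty_of_residue (g : C -> C) (zeta : C) :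
  Cmod zeta = 1 -> (forall z, Cmod z < 1 -> g z <> 0) ->
  angular_lim (fun z => (z - zeta) * g z)%C zeta 0 ->
  angular_lim_infty (fun z => z / g z / (z - zeta))%C zeta.
Proof.
  intros Hz Hg H M HM P [B HB].
  assert (0 < / (2 * (Rabs B + 1))) as He.
  { apply Rinv_0_lt_compat. pose proof (Rabs_pos B); lra. }
  destruct (proj1 (angular_lim_iff _ _ _) H M _ HM He) as (d & Hd & K).
  apply locally_C_iff. exists (Rmin d (/ 2)); split; [apply Rmin_glb_lt; lra|].
  intros z Hzd Hs. apply HB.
  pose proof (Rmin_l d (/ 2)); pose proof (Rmin_r d (/ 2)).
  assert (Cmod z < 1) as Dz by apply Hs.
  specialize (K z ltac:(lra) Hs). specialize (Hg z Dz).
  assert (z <> zeta) as N by (intros ->; lra). apply Csub_neq_0 in N.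
  replace ((z - zeta) * g z - 0)%C with ((z - zeta) * g z)%C in K by ring.
  replace (z / g z / (z - zeta))%C with (z / ((z - zeta) * g z))%C by (field; auto).
  assert ((z - zeta) * g z <> 0)%C as N2 by (apply Cmult_neq_0; auto).
  rewrite Cmod_div by auto. pose proof (proj1 (Cmod_gt_0 _) N2) as P2.
  set (x := Cmod ((z - zeta) * g z)) in *.
  pose proof (Cmod_triangle_sub zeta z) as T. rewrite Cmod_sub_sym, Hz in T.
  assert (/ 2 <= Cmod z) as Z2 by lra.
  pose proof (Rle_abs B). pose proof (Rabs_pos B).
  apply Rmult_lt_reg_r with x; auto. unfold Rdiv; rewrite Rmult_assoc, Rinv_l by lra.
  apply (Rmult_lt_compat_r (2 * (Rabs B + 1))) in K; [|lra].
  rewrite Rinv_l in K by lra. nra.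
Qed.

Lemma quotient_generator (g : C -> C) :
  (forall z, Cmod z < 1 -> continuous g z) ->
  (forall z, Cmod z < 1 -> z <> 0 -> cdiff g z) ->
  (forall z, Cmod z < 1 -> 0 <= Re (g z)) ->
  (forall z, Cmod z < 1 -> g z <> 0) ->
  holomorphic_generator (fun z => z / g z)%C.
Proof.
  intros Hc Hd Hp Hn. apply dissipative_generator.
  - intros z Hz. destruct (Ceq_dec z 0) as [->|N].
    (* At 0 the slope function of [z / g z] is [/ g] itself, so continuity of [g] is enough. *)
    + exists (fun w => / g w)%C; split.
      * apply continuous_Cinv; auto.
      * intros w. unfold Cdiv. ring.
    + apply cdiff_div; auto using cdiff_id.
  - intros z Hz. unfold Cdiv. rewrite Re_conj_mult.
    apply Rmult_le_pos; [pose proof (Cmod_ge_0 z); nra|apply Re_Cinv_nonneg; auto].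
Qed.

Fixpoint remainder (f : C -> C) (zeta eta df : nat -> C) (k : nat) (z : C) : C :=
  match k with
  | O => reciprocal f z
  | S j => remainder f zeta eta df j z
      - poisson_term (zeta (S j)) (eta (S j)) (Cmod (df (S j))) z
  end.

Lemma remainder_sum (f : C -> C) (zeta eta df : nat -> C) (k : nat) (z : C) :
  z <> 0 ->
  (reciprocal f z / z)%C =
  (sum_n_m (fun n : nat =>
     RtoC (/ Cmod (df n)) *
       (Cconj (zeta n) * eta n / (Cconj (zeta n) * eta n - 1) * / z - / (z - zeta n))) 1 k
   + remainder f zeta eta df k z / z)%C.
Proof.
  intros N. induction k as [|k IH].
  - rewrite sum_n_m_zero by lia. unfold zero; simpl. ring.
  - rewrite sum_n_Sm by lia. rewrite IH. unfold plus; simpl.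
    unfold poisson_term, rotation_ratio.
    (* Naming the quotient and the inverse leaves [z <> 0] as the only side condition of [field]. *)
    set (c := (Cconj (zeta (S k)) * eta (S k) / (Cconj (zeta (S k)) * eta (S k) - 1))%C).
    unfold Cdiv.
    set (S0 := sum_n_m _ 1 k).
    set (i := (/ (z - zeta (S k)))%C). as_C. field. auto.
Qed.

Theorem corollary5p3
  (F : R -> C -> C) (f : C -> C)
  (HF : semigroup F) (Hf : generator_of F f)
  (HDW : denjoy_wolff_point F 0)
  (N : nat) (zeta eta df : nat -> C)
  (Hzeta : forall n : nat, (1 <= n <= N)%nat ->
     boundary_regular_null_point f (zeta n))
  (Hdistinct : forall m n : nat, (1 <= m <= N)%nat -> (1 <= n <= N)%nat ->
     m <> n -> zeta m <> zeta n)
  (Hdf : forall n : nat, (1 <= n <= N)%nat ->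
     angular_derivative f (zeta n) (df n))
  (Heta : forall n : nat, (1 <= n <= N)%nat -> Cmod (eta n) = 1)
  (Hetazeta : forall n : nat, (1 <= n <= N)%nat -> eta n <> zeta n) :
  exists r : R, 0 <= r /\
  exists h : C -> C,
    holomorphic_generator h /\
    h (RtoC 0) = RtoC 0 /\
    (forall n : nat, (1 <= n <= N)%nat ->
       angular_lim_infty (fun z : C => (h z / (z - zeta n))%C) (zeta n)) /\
    (forall z : C, in_disk z -> z <> RtoC 0 ->
       f z <> RtoC 0 /\ h z <> RtoC 0 /\
       (/ f z =
          sum_n_m (fun n : nat =>
            RtoC (/ Cmod (df n)) *
              (Cconj (zeta n) * eta n / (Cconj (zeta n) * eta n - 1) * / z
               - / (z - zeta n))) 1 N
          + RtoC r / h z)%C).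
Proof.
  set (Q := remainder f zeta eta df).
  assert (forall n, (1 <= n <= N)%nat -> Cmod (zeta n) = 1) as Z1 by (intros n Hn; apply Hzeta, Hn).
  assert (forall n, (1 <= n <= N)%nat -> 0 < Cmod (df n) /\ df n = RtoC (- Cmod (df n))) as Dn.
  { intros n Hn. apply (boundary_derivative_negative F f HF Hf HDW (zeta n) (df n)); auto.
    apply Hdf, Hn. }
  (* The last clause says that after [k] steps the residue is cancelled at the points with [n <= k]
     and still the original one at the others. *)
  assert (forall k, (k <= N)%nat ->
    (forall z, Cmod z < 1 -> continuous (Q k) z) /\
    (forall z, Cmod z < 1 -> z <> 0 -> cdiff (Q k) z) /\
    (forall z, Cmod z < 1 -> 0 <= Re (Q k z)) /\
    (forall n, (1 <= n <= N)%nat -> angular_lim (fun z => (z - zeta n) * Q k z)%C (zeta n)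
       (if Nat.leb n k then 0 else - (RtoC (/ Cmod (df n)) * zeta n))%C)) as HQ.
  { induction k as [|k IH]; intros Hk.
    - split; [|split; [|split]].
      + apply (reciprocal_continuous F f HF Hf HDW).
      + apply (reciprocal_cdiff F f HF Hf HDW).
      + apply (reciprocal_re_nonneg F f HF Hf HDW).
      + intros n Hn. destruct (Nat.leb_spec n 0); [lia|].
        destruct (Dn n Hn) as [P E].
        replace (- (RtoC (/ Cmod (df n)) * zeta n))%C with (zeta n / df n)%C.
        * apply (reciprocal_residue F f HF Hf HDW); [auto|]. apply Hdf, Hn.
        * rewrite E at 1. rewrite RtoC_opp, RtoC_inv by lra. field.
          intros E0; apply RtoC_inj in E0; lra.
    - destruct IH as (Qc & Qd & Qp & Qa); [lia|].
      assert (1 <= S k <= N)%nat as Hn by lia.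
      destruct (Dn _ Hn) as [P _]. pose proof (Z1 _ Hn) as Zn.
      assert (forall z, Cmod z < 1 -> cdiff (poisson_term (zeta (S k)) (eta (S k)) (Cmod (df (S k)))) z)
        as Pd.
      { intros z Hz. apply poisson_term_cdiff. intros ->; lra. }
      split; [|split; [|split]].
      + intros z Hz. apply continuous_Cminus; [auto|apply cdiff_continuous; auto].
      + intros z Hz N0. apply cdiff_minus; auto.
      + intros z Hz. change (0 <= Re (Q k z - poisson_term (zeta (S k)) (eta (S k)) (Cmod (df (S k))) z)%C).
        specialize (Qa (S k) Hn). destruct (Nat.leb_spec (S k) k); [lia|].
        pose proof (Rinv_0_lt_compat _ P) as IP.
        (* The untouched residue at the new point makes Julia's inequality say exactly that
           [Re (Q k)] dominates the kernel to be subtracted. *)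
        pose proof (julia_half_plane (Q k) 0 Qc Qd Qp (zeta (S k)) z (/ Cmod (df (S k))) Zn
          ltac:(lra) (angular_residue_radial _ _ _ Zn Qa) Hz) as J.
        rewrite <- (poisson_term_re (zeta (S k)) (eta (S k))) in J; auto.
        assert (0 < Cmod (zeta (S k) - z)) as X by (apply Cmod_pos_sub; intros E; rewrite E in Zn; lra).
        unfold Cminus at 1. rewrite re_plus.
        change (Re (- poisson_term (zeta (S k)) (eta (S k)) (Cmod (df (S k))) z)%C)
          with (- Re (poisson_term (zeta (S k)) (eta (S k)) (Cmod (df (S k))) z)).
        set (x := Cmod (zeta (S k) - z)) in *.
        set (a := Re (poisson_term (zeta (S k)) (eta (S k)) (Cmod (df (S k))) z)) in *.
        enough (a <= Re (Q k z)) by lra.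
        apply Rmult_le_reg_r with (2 * (x * x)); [nra|lra].
      + intros n Hn'. specialize (Qa n Hn').
        apply angular_lim_ext with (fun z => (z - zeta n) * Q k z
          - (z - zeta n) * poisson_term (zeta (S k)) (eta (S k)) (Cmod (df (S k))) z)%C; auto.
        { intros z _ _. unfold Q; simpl. ring. }
        destruct (Nat.eq_dec n (S k)) as [->|Ne].
        * rewrite Nat.leb_refl. destruct (Nat.leb_spec (S k) k); [lia|].
          replace (RtoC 0) with (- (RtoC (/ Cmod (df (S k))) * zeta (S k))
            - - (RtoC (/ Cmod (df (S k))) * zeta (S k)))%C by ring.
          apply angular_lim_minus; auto. apply poisson_term_residue_same; auto.
        * replace (Nat.leb n (S k)) with (Nat.leb n k).
          2:{ destruct (Nat.leb_spec n k), (Nat.leb_spec n (S k)); auto; lia. }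
          match goal with |- angular_lim _ _ ?l => replace l with (l - 0)%C by ring end.
          apply angular_lim_minus; auto. apply poisson_term_residue_other; auto. }
  destruct (HQ N (le_n N)) as (Qc & Qd & Qp & Qa).
  assert (exists (r : R) (G : C -> C), 0 <= r /\
    (forall z, Cmod z < 1 -> continuous G z) /\
    (forall z, Cmod z < 1 -> z <> 0 -> cdiff G z) /\
    (forall z, Cmod z < 1 -> 0 <= Re (G z)) /\
    (forall z, Cmod z < 1 -> G z <> 0) /\
    (forall n, (1 <= n <= N)%nat -> angular_lim (fun z => (z - zeta n) * G z)%C (zeta n) 0) /\
    (forall z, Cmod z < 1 -> Q N z = (RtoC r * G z)%C)) as (r & G & Hr & Gc & Gd & Gp & Gn & Ga & GQ).
  { destruct (classic (exists w, Cmod w < 1 /\ Q N w = 0)) as [(w & Hw & Ew)|HN].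
    (* One zero makes [Q N] vanish identically, but [h] must still be a generator with the boundary
       behaviour; [G = 1], that is [h z = z], has both. *)
    - exists 0, (fun _ => 1). split; [lra|]. split; [|split; [|split; [|split; [|split]]]].
      + intros; apply continuous_const.
      + intros; apply cdiff_const.
      + intros; simpl; lra.
      + intros z _ E; apply RtoC_inj in E; lra.
      + intros n Hn. replace (RtoC 0) with ((zeta n - zeta n) * 1)%C by ring.
        apply (angular_lim_continuous (fun z => (z - zeta n) * 1)%C).
        apply continuous_Cmult; [|apply continuous_const].
        apply continuous_Cminus; [apply continuous_id|apply continuous_const].
      + intros z Hz. rewrite (re_nonneg_zero (Q N) 0 Qc Qd Qp z w Hz Hw Ew). ring.
    - exists 1, (Q N). split; [lra|]. repeat (split; [assumption|]). split; [|split].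
      + intros z Hz E. apply HN. exists z; auto.
      + intros n Hn. specialize (Qa n Hn).
        destruct (Nat.leb_spec n N); [exact Qa|lia].
      + intros z _. ring. }
  exists r; split; auto. exists (fun z => z / G z)%C. split; [|split; [|split]].
  - apply quotient_generator; auto.
  - unfold Cdiv; ring.
  - intros n Hn. apply angular_lim_infty_of_residue; auto.
  - intros z Hz N0. unfold in_disk in Hz.
    pose proof (quotient_nonzero F f HF Hf HDW z Hz) as Np.
    specialize (Gn z Hz).
    assert (/ G z <> 0)%C as Gi.
    { intros E. pose proof (Cinv_r _ Gn) as E1. rewrite E, Cmult_0_r in E1.
      apply RtoC_inj in E1; lra. }
    rewrite (generator_factor F f HF Hf HDW z).
    split; [apply Cmult_neq_0; auto|].
    split; [apply Cmult_neq_0; auto|].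
    transitivity (reciprocal f z / z)%C; [unfold reciprocal; field; auto|].
    rewrite (remainder_sum f zeta eta df N z N0). f_equal.
    change (remainder f zeta eta df N z) with (Q N z). rewrite GQ by auto. field; auto.
Qed.
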